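(* Let $G$ be a Roelcke precompact, non-archimedean, Polish group and let $G \curvearrowright (\Omega, \mathcal{B}, \mu)$ be a non-singular action on a $\sigma$-finite measure space. Then there exist countably many self-commensurating, open subgroups $(V_i : i \in I)$ of $G$ and measure-preserving actions $V_i \curvearrowright^{\alpha_i} (\Omega_i, \mathcal{B}_i, \mu_i)$, with each $\mu_i$ a probability measure, such that the original action $G \curvearrowright \Omega$ is isomorphic to the disjoint union $$\bigsqcup_i \mathrm{Ind}_{V_i}^G(\alpha_i).$$ In particular, every non-singular action of $G$ is isomorphic to a measure-preserving action (with a possibly infinite measure), and every ergodic non-singular action of $G$ is isomorphic to one of the form $\mathrm{Ind}_V^G(\alpha)$, where $V \leq G$ is a self-commensurating open subgroup and $\alpha$ is a probability measure-preserving action of $V$.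
   Context: A topological group $G$ is non-archimedean if it admits a basis at $1_G$ consisting of open subgroups. It is Roelcke precompact if for every neighborhood $U$ of $1_G$ there is a finite $F \subseteq G$ with $G = UFU$. Two subgroups are commensurate if their intersection has finite index in both; $H \leq G$ is self-commensurating if every $g\in G$ such that $H$ and $gHg^{-1}$ are commensurate belongs to $H$. For a $\sigma$-finite measure space $(\Omega, \mathcal{B}, \mu)$, $\mathrm{MALG}(\mu)$ is the Boolean algebra $\mathcal{B}$ modulo the ideal of null sets, $\mathrm{Aut}^*(\mu)$ is the group of automorphisms of the Boolean algebra $\mathrm{MALG}(\mu)$ (equivalently, bi-measurable bijections of $\Omega$ preserving the null ideal, modulo equality on a co-null set), and $\mathrm{Aut}(\mu)$ is its subgroup of elements which also preserve $\mu$. $\mathrm{Aut}^*(\mu)$ carries the topology induced by its embedding in the unitary group of $L^2(\Omega,\mu)$ (strong operator topology) via the Koopman representation $(g \cdot f)(x) = \big(\frac{\mathrm{d} g_*\mu}{\mathrm{d}\mu}\big)^{1/2}(x)\, f(g^{-1}\cdot x)$. A non-singular action of a topological group $G$ on $(\Omega, \mu)$ is a continuous homomorphism $G \to \mathrm{Aut}^*(\mu)$; it is measure-preserving if its image is contained in $\mathrm{Aut}(\mu)$; it is ergodic if it has no fixed points in $\mathrm{MALG}(\mu)$ other than $\mathbf{0}$ and $\mathbf{1}$. Two actions are isomorphic if there is a $G$-equivariant isomorphism between the measure algebras. The disjoint union of a countable family of non-singular actions $G \curvearrowright (X_i, \nu_i)$ is the action on $\bigsqcup_i X_i$ with measure $\sum_i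 \nu_i$ given by $g\cdot\bigsqcup_i A_i = \bigsqcup_i g\cdot A_i$. Induced action: let $V \leq G$ be an open subgroup of countable index, $\xi$ the counting measure on $G/V$, and $\sigma$ a non-singular action of $V$ on $(X, \nu)$. Let $s \colon G/V \to G$ satisfy $s(gV) \in gV$ for all $g$, and put $c(g,hV) = s(ghV)^{-1} g\, s(hV) \in V$. Then $\mathrm{Ind}_V^G(\sigma)$ is the action of $G$ on $\mathrm{MALG}(G/V \times X, \xi\otimes\nu)$ determined by $g \cdot (\{hV\} \times A) = \{ghV\} \times \sigma(c(g,hV))\cdot A$ for $g,h \in G$, $A \in \mathrm{MALG}(\nu)$. Up to isomorphism it does not depend on $s$. *)

(* Defs.v *)
From HB Require Import structures.
From mathcomp Require Import all_boot all_order all_algebra.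
From mathcomp Require Import all_classical all_reals all_analysis.
From mathcomp Require Import complex.

Set Implicit Arguments.
Unset Strict Implicit.
Unset Printing Implicit Defensive.
Import Order.TTheory GRing.Theory Num.Theory.
Import numFieldNormedType.Exports.

Local Open Scope classical_set_scope.
Local Open Scope ring_scope.

HB.mixin Record isTopologicalGroup G & Group G & Topological G := {
  mulg_continuous : continuous (fun x : G * G => (x.1 * x.2)%g) ;
  invg_continuous : continuous (fun x : G => (x^-1)%g)
}.

#[short(type="topologicalGroupType")]
HB.structure Definition TopologicalGroup :=
  {G of isTopologicalGroup G & Group G & Topological G}.

Section topological_notions.
Variables (R : realType) (T : topologicalType).

Definition separable_space := exists2 S : set T, countable S & dense S.

Definition completely_metrizable := exists dist : T -> T -> R,
  [/\ (forall x y, dist x y = 0 <-> x = y),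
      (forall x y, dist x y = dist y x),
      (forall x y z, dist x z <= dist x y + dist y z),
      (forall x (U : set T), nbhs x U <->
         exists2 e, 0 < e & [set y | dist x y < e] `<=` U)
    & (forall u : nat -> T,
         (forall e, 0 < e -> exists N, forall m n,
            (N <= m)%N -> (N <= n)%N -> dist (u m) (u n) < e) ->
         exists l : T, u @ \oo --> l)].

Definition polish := separable_space /\ completely_metrizable.

End topological_notions.

Section subgroup_type.
Variable G : topologicalGroupType.

(* A subgroup V of G is a term of type [groupClosed G]. *)
Definition subgroup_type (V : groupClosed G) : Type := {x : G | x \in V}.

Variable V : groupClosed G.

HB.instance Definition _ := SubChoice.on (subgroup_type V).

Let subgroup_closed : group_closed (fun x => x \in V).
Proof. by split; [exact: gpred1 | exact: gpredF]. Qed.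

HB.instance Definition _ :=
  SubChoice_isSubGroup.Build G (fun x => x \in V) (subgroup_type V)
    subgroup_closed.

HB.instance Definition _ := Topological.copy (subgroup_type V)
  (initial_topology (val : subgroup_type V -> G)).

Let val_continuous : continuous (val : subgroup_type V -> G).
Proof. exact: initial_continuous. Qed.

Let subgroup_mulg_continuous :
  continuous (fun x : subgroup_type V * subgroup_type V => (x.1 * x.2)%g).
Proof.
apply: continuous_comp_initial => x.
rewrite (_ : _ \o _ = (fun z : G * G => (z.1 * z.2)%g) \o
  (fun y : subgroup_type V * subgroup_type V => (val y.1, val y.2))) //.
apply: continuous_comp; last exact: mulg_continuous.
apply: cvg_pair => /=.
- by apply: (cvg_comp _ _ cvg_fst); exact: val_continuous.
- by apply: (cvg_comp _ _ cvg_snd); exact: val_continuous.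
Qed.

Let subgroup_invg_continuous :
  continuous (fun x : subgroup_type V => (x^-1)%g).
Proof.
apply: continuous_comp_initial => x.
rewrite (_ : _ \o _ = (fun z : G => (z^-1)%g) \o
  (val : subgroup_type V -> G)) //.
apply: continuous_comp; first exact: val_continuous.
exact: invg_continuous.
Qed.

HB.instance Definition _ := isTopologicalGroup.Build (subgroup_type V)
  subgroup_mulg_continuous subgroup_invg_continuous.

End subgroup_type.

Section group_notions.
Variable G : topologicalGroupType.

Definition non_archimedean := forall U : set G, nbhs 1%g U ->
  exists V : groupClosed G, open [set` V] /\ [set` V] `<=` U.

Definition roelcke_precompact := forall U : set G, nbhs 1%g U ->
  exists F : set G, finite_set F /\
    [set: G] = [set x | exists u f v, [/\ U u, F f, U v & x = (u * f * v)%g]].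

(* Meant for subgroups [K] of [H]. *)
Definition finite_index (K H : set G) :=
  finite_set [set [set (h * k)%g | k in K] | h in H].

Definition commensurate (H K : set G) :=
  finite_index (H `&` K) H /\ finite_index (H `&` K) K.

Definition self_commensurating (H : set G) := forall g : G,
  commensurate H [set (g * h * g^-1)%g | h in H] -> H g.

End group_notions.

Fact malg_display : Order.disp_t. Proof. exact: (Order.Disp tt tt). Qed.

Section malg.
Context d (T : measurableType d) (R : realType).
Variable mu : {measure set T -> \bar R}.

Definition mset := set_type (@measurable d T).
HB.instance Definition _ := SubChoice.on mset.

Implicit Types A B C : mset.

Definition malg_eq A B := `[< mu (val A `+` val B) = 0%E >].

Lemma malg_eqP A B :
  reflect (mu.-negligible (val A `+` val B)) (malg_eq A B).
Proof.
have mAB : measurable (val A `+` val B).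
  by apply: measurableU; apply: measurableD; exact: set_mem (valP _).
by apply: (iffP (asboolP _)) => /(negligibleP _ mAB).
Qed.

Let malg_eq_refl : reflexive malg_eq.
Proof. by move=> A; apply/malg_eqP; rewrite setYK; exact: negligible_set0. Qed.

Let malg_eq_sym : symmetric malg_eq.
Proof. by move=> A B; rewrite /malg_eq setYC. Qed.

Let malg_eq_trans : transitive malg_eq.
Proof.
move=> B A C /malg_eqP AB /malg_eqP BC; apply/malg_eqP.
apply: (negligibleS _ (negligibleU AB BC)) => x.
by rewrite /setY /setD /=; have [] := pselect (val B x); tauto.
Qed.

Canonical malg_eq_equiv :=
  EquivRel malg_eq malg_eq_refl malg_eq_sym malg_eq_trans.

Local Open Scope quotient_scope.

Definition malg : Type := {eq_quot malg_eq}.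
HB.instance Definition _ := Choice.on malg.
HB.instance Definition _ := EqQuotient.on malg.

Definition mset_of (A : set T) (mA : measurable A) : mset := exist _ A (mem_set mA).

Definition mset0 := mset_of measurable0.
Definition msetT := mset_of measurableT.
Definition msetI A B :=
  mset_of (measurableI _ _ (set_mem (valP A)) (set_mem (valP B))).
Definition msetU A B :=
  mset_of (measurableU _ _ (set_mem (valP A)) (set_mem (valP B))).
Definition msetC A := mset_of (measurableC (set_mem (valP A))).

Definition malg_bot : malg := \pi_malg mset0.
Definition malg_top : malg := \pi_malg msetT.
Definition malg_meet := lift_op2 malg msetI.
Definition malg_join := lift_op2 malg msetU.
Definition malg_compl := lift_op1 malg msetC.

Let repr_pi A : mu.-negligible (val (repr (\pi_malg A)) `+` val A).
Proof. by apply/malg_eqP; apply/eqmodP; rewrite reprK. Qed.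

Lemma malg_meetE A B : malg_meet (\pi_malg A) (\pi_malg B) = \pi_malg (msetI A B).
Proof.
unlock malg_meet; apply/eqmodP/malg_eqP.
apply: (negligibleS _ (negligibleU (repr_pi A) (repr_pi B))) => x /=.
rewrite /setY /setD /=; have := EM (sval A x); have := EM (sval B x).
have := EM (sval (repr (\pi_malg A)) x).
by have := EM (sval (repr (\pi_malg B)) x); tauto.
Qed.

Lemma malg_joinE A B : malg_join (\pi_malg A) (\pi_malg B) = \pi_malg (msetU A B).
Proof.
unlock malg_join; apply/eqmodP/malg_eqP.
apply: (negligibleS _ (negligibleU (repr_pi A) (repr_pi B))) => x /=.
rewrite /setY /setD /=; have := EM (sval A x); have := EM (sval B x).
have := EM (sval (repr (\pi_malg A)) x).
by have := EM (sval (repr (\pi_malg B)) x); tauto.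
Qed.

Lemma malg_complE A : malg_compl (\pi_malg A) = \pi_malg (msetC A).
Proof.
unlock malg_compl; apply/eqmodP/malg_eqP.
apply: (negligibleS _ (repr_pi A)) => x /=.
rewrite /setY /setD /=; have := EM (sval (repr (\pi_malg A)) x).
by have := EM (sval A x); tauto.
Qed.

Let malg_le a b := malg_meet a b == a.
Let malg_lt a b := (b != a) && malg_le a b.

Ltac malg_law := repeat (let a := fresh in move=> a; elim/quotW: a => a);
  rewrite ?(malg_meetE, malg_joinE, malg_complE); congr (\pi_malg _);
  apply: val_inj => /=.

Let meetC : commutative malg_meet.
Proof. by malg_law; rewrite setIC. Qed.
Let joinC : commutative malg_join.
Proof. by malg_law; rewrite setUC. Qed.
Let meetA : associative malg_meet.
Proof. by malg_law; rewrite setIA. Qed.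
Let joinA : associative malg_join.
Proof. by malg_law; rewrite setUA. Qed.
Let joinKI b a : malg_meet a (malg_join a b) = a.
Proof. by move: b a; malg_law; rewrite setUC setKU. Qed.
Let meetKU b a : malg_join a (malg_meet a b) = a.
Proof. by move: b a; malg_law; rewrite setIC setKI. Qed.
Let meetUl : left_distributive malg_meet malg_join.
Proof. by malg_law; rewrite setIUl. Qed.
Let meetxx : idempotent_op malg_meet.
Proof. by malg_law; rewrite setIid. Qed.

HB.instance Definition _ := @Order.isMeetJoinDistrLattice.Build malg_display
  malg malg_le malg_lt malg_meet malg_join (fun _ _ => erefl)
  (fun _ _ => erefl) meetC joinC meetA joinA joinKI meetKU meetUl meetxx.

Let malg_le0 (a : malg) : (malg_bot <= a)%O.
Proof.
rewrite /Order.le /= /malg_le; apply/eqP; rewrite /malg_bot.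
by move: a; malg_law; rewrite set0I.
Qed.

Let malg_le1 (a : malg) : (a <= malg_top)%O.
Proof.
rewrite /Order.le /= /malg_le; apply/eqP; rewrite /malg_top.
by move: a; malg_law; rewrite setIT.
Qed.

HB.instance Definition _ := Order.hasBottom.Build malg_display malg malg_le0.
HB.instance Definition _ := Order.hasTop.Build malg_display malg malg_le1.

Let malg_joinC (a : malg) : (a `|` malg_compl a)%O = \top%O.
Proof.
rewrite -[\top%O]/malg_top -[Order.join _ _]/(malg_join _ _) /malg_top.
by move: a; malg_law; rewrite setUv.
Qed.

Let malg_meetC (a : malg) : (a `&` malg_compl a)%O = \bot%O.
Proof.
rewrite -[\bot%O]/malg_bot -[Order.meet _ _]/(malg_meet _ _) /malg_bot.
by move: a; malg_law; rewrite setICr.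
Qed.

HB.instance Definition _ := Order.TBDistrLattice_hasComplement.Build
  malg_display malg malg_joinC malg_meetC.

(* Junk value 0 when [A] is not measurable. *)
Definition malg_class (A : set T) : malg := \pi_malg (insubd mset0 A).

Definition malg_repr (a : malg) : set T := val (repr a).

Definition malg_measure (a : malg) : \bar R := mu (malg_repr a).

End malg.

Arguments malg_class {d T R} mu A.
Arguments malg_repr {d T R mu} a.
Arguments malg_measure {d T R mu} a.

Definition boolean_iso d1 d2 (L1 : ctbDistrLatticeType d1)
    (L2 : ctbDistrLatticeType d2) (f : L1 -> L2) :=
  [/\ bijective f,
      {morph f : x y / (x `&` y)%O},
      {morph f : x y / (x `|` y)%O}
    & {morph f : x / (~` x)%O}].

Section aut_star.
Context d (T : measurableType d) (R : realType).
Variable mu : {measure set T -> \bar R}.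

Record aut_star := AutStar {
  aut_fun :> malg mu -> malg mu ;
  aut_funP : boolean_iso aut_fun }.

HB.instance Definition _ := gen_eqMixin aut_star.
HB.instance Definition _ := gen_choiceMixin aut_star.

Lemma aut_starP (g h : aut_star) : g =1 h -> g = h.
Proof.
case: g h => [g gP] [h hP] /= /funext gh; rewrite gh in gP *.
by congr AutStar; exact: Prop_irrelevance.
Qed.

Let aut_one_subproof : boolean_iso (@id (malg mu)).
Proof. by split => //; exists id. Qed.

Let aut_mul_subproof (g h : aut_star) : boolean_iso (g \o h).
Proof.
case: g h => [g [bg gI gU gC]] [h [bh hI hU hC]] /=; split.
- exact: bij_comp.
- by move=> x y /=; rewrite hI gI.
- by move=> x y /=; rewrite hU gU.
- by move=> x /=; rewrite hC gC.
Qed.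

Let aut_inv_exists (g : aut_star) :
  exists h : aut_star, cancel g h /\ cancel h g.
Proof.
case: g => [g [bg gI gU gC]]; have [h gh hg] := bg.
have hP : boolean_iso h.
  split; first by exists g.
  - by move=> x y; apply: (can_inj gh); rewrite gI !hg.
  - by move=> x y; apply: (can_inj gh); rewrite gU !hg.
  - by move=> x; apply: (can_inj gh); rewrite gC !hg.
by exists (AutStar hP).
Qed.

Definition aut_one := AutStar aut_one_subproof.
Definition aut_mul g h := AutStar (aut_mul_subproof g h).
Definition aut_inv g := sval (cid (aut_inv_exists g)).

Let aut_mulA : associative aut_mul.
Proof. by move=> g h k; exact: aut_starP. Qed.
Let aut_mul1 : left_id aut_one aut_mul.
Proof. by move=> g; exact: aut_starP. Qed.
Let aut_mulr1 : right_id aut_one aut_mul.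
Proof. by move=> g; exact: aut_starP. Qed.
Let aut_mulV : left_inverse aut_one aut_inv aut_mul.
Proof.
by move=> g; apply: aut_starP => x /=; rewrite /aut_inv; case: cid => h [].
Qed.
Let aut_mulrV : right_inverse aut_one aut_inv aut_mul.
Proof.
by move=> g; apply: aut_starP => x /=; rewrite /aut_inv; case: cid => h [].
Qed.

HB.instance Definition _ := isGroup.Build aut_star
  aut_mulA aut_mul1 aut_mulr1 aut_mulV aut_mulrV.

Definition aut : set aut_star :=
  [set g | forall a, malg_measure (g a) = malg_measure a].

(* The function x |-> f (g^-1 x). An element of Aut*(mu) need not be induced by
   a point map of T, so this is the measurable function h (unique almost
   everywhere) whose level sets satisfy {h \in B} = g . {f \in B} in MALG(mu)
   for all Borel B. *)
Definition translate (g : aut_star) (f : T -> R) : T -> R :=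
  xget (cst 0) [set h : T -> R | measurable_fun setT h /\
    forall B : set R, measurable B ->
      malg_class mu (h @^-1` B) = g (malg_class mu (f @^-1` B))].

(* d(g_* mu)/d(mu). The library's Radon-Nikodym derivative is restricted to
   finite measures on the numerator, whereas g_* mu is only sigma-finite. *)
Definition rn_derivative (g : aut_star) : T -> R :=
  xget (cst 0) [set w : T -> R | [/\ measurable_fun setT w, (forall x, 0 <= w x) &
    forall A, measurable A ->
      malg_measure ((g^-1)%g (malg_class mu A)) =
      (\int[mu]_(x in A) (w x)%:E)%E]].

Definition koopman (g : aut_star) (f : T -> R[i]) : T -> R[i] := fun x =>
  (Num.sqrt (rn_derivative g x))%:C%C *
  (translate g (fun y => complex.Re (f y)) x +i*
   translate g (fun y => complex.Im (f y)) x)%C.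

Definition L2 : set (T -> R[i]) :=
  [set f | (fun x => complex.Re (f x)) \in Lfun mu 2%:E /\
           (fun x => complex.Im (f x)) \in Lfun mu 2%:E].

Definition L2norm (f : T -> R[i]) : \bar R :=
  ('N[mu]_2%:E[(fun x => (Normc.normc (f x))%:E)])%E.

(* The strong operator topology pulled back along the Koopman representation:
   the coarsest topology making all the maps g |-> koopman g f, for f in L2,
   continuous for the L2 norm. *)
Definition sot_subbase : set (set aut_star) :=
  [set U | exists g f (e : R), [/\ L2 f, 0 < e &
    U = [set h | (L2norm (fun x => (koopman h f x - koopman g f x)%R) < e%:E)%E]]].

HB.instance Definition _ :=
  @isSubBaseTopological.Build aut_star (set aut_star) sot_subbase id.

End aut_star.
Arguments aut_star {d T R} mu.
Arguments aut {d T R} mu.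

Section actions.
Context d (T : measurableType d) (R : realType).
Variables (G : topologicalGroupType) (mu : {measure set T -> \bar R}).

(* The measure is not assumed sigma-finite here so that actions on product and
   sum measures can be stated without a proof of sigma-finiteness. *)
Record nonsingular_action := NonsingularAction {
  action_fun :> G -> aut_star mu ;
  actionM : forall g h, action_fun (g * h)%g = (action_fun g * action_fun h)%g ;
  action_continuous : continuous action_fun }.

Definition measure_preserving (sigma : nonsingular_action) :=
  forall g, aut mu (sigma g).

Definition ergodic (sigma : nonsingular_action) :=
  forall a : malg mu, (forall g, sigma g a = a) -> a = \bot%O \/ a = \top%O.

End actions.
Arguments nonsingular_action {d T R} G mu.

(* The isomorphism of measure algebras need not preserve the measure. *)
Definition isomorphic d1 d2 (T1 : measurableType d1) (T2 : measurableType d2)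
    (R : realType) (G : topologicalGroupType)
    (mu1 : {measure set T1 -> \bar R}) (mu2 : {measure set T2 -> \bar R})
    (sigma : nonsingular_action G mu1) (tau : nonsingular_action G mu2) :=
  exists2 f : malg mu1 -> malg mu2, boolean_iso f &
    forall g a, f (sigma g a) = tau g (f a).

Section dunion_measurable.
Context d (T : nat -> measurableType d).

Definition dunion : Type := {i & T i}.

Definition dunion_in (i : nat) (x : T i) : dunion := existT T i x.

Definition dunion_measurable : set (set dunion) :=
  [set A | forall i, measurable (@dunion_in i @^-1` A)].

Let dunion_measurable0 : dunion_measurable set0.
Proof. by move=> i; rewrite preimage_set0. Qed.
Let dunion_measurableC A : dunion_measurable A -> dunion_measurable (~` A).
Proof. by move=> mA i; rewrite preimage_setC; apply: measurableC; exact: mA. Qed.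
Let dunion_measurable_bigcup (F : (set dunion)^nat) :
  (forall n, dunion_measurable (F n)) -> dunion_measurable (\bigcup_n F n).
Proof.
move=> mF i; rewrite preimage_bigcup; apply: bigcup_measurable => n _.
exact: mF.
Qed.

HB.instance Definition _ := gen_eqMixin dunion.
HB.instance Definition _ := gen_choiceMixin dunion.
HB.instance Definition _ := isPointed.Build dunion (@dunion_in 0 point).
HB.instance Definition _ := @isMeasurable.Build default_measure_display
  dunion dunion_measurable dunion_measurable0 dunion_measurableC
  dunion_measurable_bigcup.

End dunion_measurable.
Arguments dunion {d} T.
Arguments dunion_in {d} T i x.

Section disjoint_union.
Context d (T : nat -> measurableType d) (R : realType).
(* A countable family is indexed by a set [D] of natural numbers (possibly
   empty, whereas a [measurableType] is inhabited); the components outside [D]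
   get measure zero. *)
Variables (D : set nat) (nu : forall i, {measure set (T i) -> \bar R}).

Definition dunion_measure (A : set (dunion T)) : \bar R :=
  (\sum_(0 <= i <oo | i \in D) nu i (dunion_in T i @^-1` A))%E.

Let component i (A : set (dunion T)) : \bar R :=
  if i \in D then nu i (dunion_in T i @^-1` A) else 0%E.

Let component0 i : component i set0 = 0%E.
Proof. by rewrite /component preimage_set0 measure0 if_same. Qed.
Let component_ge0 i A : (0 <= component i A)%E.
Proof. by rewrite /component; case: ifP. Qed.
Let component_sigma_additive i : semi_sigma_additive (component i).
Proof.
rewrite /component; case: (i \in D); last first.
  exact: (@measure_semi_sigma_additive _ (dunion T) R mzero).
move=> F mF tF mUF; rewrite preimage_bigcup.
apply: measure_semi_sigma_additive.
- by move=> n; exact: mF.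
- apply/trivIsetP => m n _ _ mn; rewrite -preimage_setI.
  by move/trivIsetP : tF => /(_ _ _ I I mn) ->; rewrite preimage_set0.
- by rewrite -preimage_bigcup; exact: mUF.
Qed.

HB.instance Definition _ i := isMeasure.Build _ _ _ (component i)
  (component0 i) (@component_ge0 i) (@component_sigma_additive i).

Let dunion_measureE : dunion_measure = mseries component 0.
Proof. by apply/funext => A; rewrite /dunion_measure eseries_mkcond. Qed.

Let dunion_measure0 : dunion_measure set0 = 0%E.
Proof. by rewrite dunion_measureE measure0. Qed.
Let dunion_measure_ge0 A : (0 <= dunion_measure A)%E.
Proof. by rewrite dunion_measureE. Qed.
Let dunion_measure_sigma_additive : semi_sigma_additive dunion_measure.
Proof. rewrite dunion_measureE; exact: measure_semi_sigma_additive. Qed.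

HB.instance Definition _ := isMeasure.Build _ _ _ dunion_measure
  dunion_measure0 dunion_measure_ge0 dunion_measure_sigma_additive.

Definition malg_dunion (A : forall i, malg (nu i)) : malg dunion_measure :=
  malg_class dunion_measure (\bigcup_i (dunion_in T i @` malg_repr (A i))).

Definition is_disjoint_union (G : topologicalGroupType)
    (sigma : forall i, nonsingular_action G (nu i))
    (tau : nonsingular_action G dunion_measure) :=
  forall g A, tau g (malg_dunion A) = malg_dunion (fun i => sigma i g (A i)).

End disjoint_union.

Section cosets.
Variables (G : topologicalGroupType) (V : groupClosed G).

Definition coset_eq : rel G := fun x y => (x^-1 * y)%g \in V.

Let coset_eq_refl : reflexive coset_eq.
Proof. by move=> x; rewrite /coset_eq mulVg gpred1. Qed.
Let coset_eq_sym : symmetric coset_eq.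
Proof. by move=> x y; rewrite /coset_eq -gpredV invgM invgK. Qed.
Let coset_eq_trans : transitive coset_eq.
Proof.
move=> y x z xy yz.
by rewrite /coset_eq -(mulVKg y z) mulgA; exact: gpredM.
Qed.

Canonical coset_eq_equiv :=
  EquivRel coset_eq coset_eq_refl coset_eq_sym coset_eq_trans.

Local Open Scope quotient_scope.

Definition cosets : Type := {eq_quot coset_eq}.
HB.instance Definition _ := Choice.on cosets.
HB.instance Definition _ := EqQuotient.on cosets.

Definition lcoset (g : G) : cosets := \pi_cosets g.

HB.instance Definition _ := isPointed.Build cosets (lcoset 1%g).
HB.instance Definition _ := @isMeasurable.Build default_measure_display
  cosets discrete_measurable discrete_measurable0 discrete_measurableC
  discrete_measurableU.

Definition is_section (s : cosets -> G) := forall g, (g^-1 * s (lcoset g))%g \in V.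

Definition cocycle_val (s : cosets -> G) (g h : G) : G :=
  ((s (lcoset (g * h)))^-1 * g * s (lcoset h))%g.

Lemma cocycle_subproof s g h : is_section s -> cocycle_val s g h \in V.
Proof.
move=> sV; have gh := sV (g * h)%g; have hh := sV h.
have -> : cocycle_val s g h =
    (((g * h)^-1 * s (lcoset (g * h)))^-1 * (h^-1 * s (lcoset h)))%g.
  by rewrite /cocycle_val !invgM !invgK !mulgA mulgK.
by rewrite gpredM// gpredV.
Qed.

Definition cocycle s (sV : is_section s) (g h : G) : subgroup_type V :=
  exist _ (cocycle_val s g h) (cocycle_subproof g h sV).

End cosets.

Section induction.
Context d (T : measurableType d) (R : realType).
Variables (G : topologicalGroupType) (V : groupClosed G).
Variable nu : {sigma_finite_measure set T -> \bar R}.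

Definition induced_measure : {measure set (cosets V * T) -> \bar R} :=
  ((counting : {measure set (cosets V) -> \bar R}) \x nu)%E.

Definition malg_slice (c : cosets V) (a : malg nu) : malg induced_measure :=
  malg_class induced_measure ([set c] `*` malg_repr a).

(* [tau] is Ind_V^G(sigma). As G/V is countable and automorphisms of the
   measure algebra preserve countable joins, the values of [tau g] on the
   {hV} x A determine [tau]. *)
Definition is_induced (sigma : nonsingular_action (subgroup_type V) nu)
    (tau : nonsingular_action G induced_measure) :=
  [/\ open [set` V], countable [set: cosets V] &
    exists (s : cosets V -> G) (sV : is_section s), forall g h a,
      tau g (malg_slice (lcoset V h) a) =
      malg_slice (lcoset V (g * h)%g) (sigma (cocycle sV g h) a)].

End induction.

(* Main.v *)
(** Let G act on L^2(mu) by the Koopman representation, which preserves the cone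
    of nonnegative functions.  In an invariant set Z, the indicator of a subset
    of finite measure is almost fixed by a small open subgroup U, so the
    circumcenter of its U-orbit is a nonzero U-fixed vector f >= 0.  By Roelcke
    precompactness, g |-> <g f, f> takes finitely many values.  Among the vectors
    of the cone whose coefficients lie in this finite set, take eta <> 0 of least
    norm, with stabilizer V.  If the V-orbit of g V is infinite, Ramsey's theorem
    and the minimality of eta (applied to a weak limit of translates of eta) give
    <g eta, eta> = 0.  The g for which this orbit is finite form a
    self-commensurating open subgroup W, and the sum zeta of the W-translates of
    eta is fixed by W and orthogonal to g zeta for g outside W.  As zeta >= 0,
    its support S is W-invariant and disjoint from its translates by g outside W,
    and zeta^2 mu is an invariant measure for W on S: the action on the union of
    the translates of S is induced from W.  Countably many such pieces exhaust
    the space.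

    Elements of Aut*(mu) are treated as automorphisms of the measure algebra,
    without point realizations.  All the actions to be built are factors
    tau h (F a) = F (sigma h a) of sigma (or of its restriction to a subgroup)
    along surjective sigma-homomorphisms F of measure algebras. *)
Require Import Defs.
From HB Require Import structures.
From mathcomp Require Import all_boot all_order all_algebra.
From mathcomp Require Import all_classical all_reals all_analysis.
From mathcomp Require Import measurable_realfun complex.
From mathcomp Require Import ring lra.

Set Implicit Arguments.
Unset Strict Implicit.
Unset Printing Implicit Defensive.
Import Order.CTheory Order.TTheory GRing.Theory Num.Theory.
Import numFieldNormedType.Exports.

Local Open Scope classical_set_scope.
Local Open Scope ring_scope.

(** * Open subgroups and their commensurators *)


(** Finiteness of the set [Phi] of coefficients drives the argument. The squared norm of a vector is
    its coefficient at [1], so a least norm is attained; the distances from [eta] to its translates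
    take finitely many values, so its stabilizer is open; and a weak limit of translates of [eta]
    has its coefficients in the closed set [Phi], so it competes with [eta] for minimality. A limit
    along infinitely many translates with pairwise product [b] has squared norm [b], less than that
    of [eta]; it must vanish, and [<g eta, eta>] with it. Nonnegativity turns orthogonality into
    disjointness of supports, whence the cone.

    Vectors of L^2 are functions, not classes, so the Koopman maps form an action only up to null
    vectors: the Hilbert space part is stated for a semi-inner product, with [sq (x - y) = 0] as
    equality. The obstacle in building the actions is continuity. In the measure-preserving case it
    amounts to [nu (B \ h B)] being small for [h] near [1], a quantity that a Radon-Nikodym density
    makes visible in the L^2 space of the original action. *)

Lemma group_closed_of_set (G : groupType) (S : set G) :
  S 1%g -> (forall x y, S x -> S y -> S (x * y)%g) ->
  (forall x, S x -> S (x^-1)%g) -> exists V : groupClosed G, [set` V] = S.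
Proof.
move=> S1 SM SV; pose V : {pred G} := fun x => `[< S x >].
have VV : invg_closed V by move=> x /asboolP/SV Sx; exact/asboolP.
have V1 : 1%g \in V by exact/asboolP.
have VM : mulg_closed V.
  by move=> x y /asboolP Sx /asboolP Sy; apply/asboolP/SM.
pose iV := isInvClosed.Build G V VV.
pose i1 := isMul1Closed.Build G V V1.
pose iM := isMulClosed.Build G V VM.
pose VG : groupClosed G := HB.pack V iV i1 iM.
exists VG; apply/seteqP; split => x /=; first by move=> /asboolP.
by move=> Sx; apply/asboolP.
Qed.

Section open_subgroups.
Variable G : topologicalGroupType.
Implicit Types (V : groupClosed G) (g h x y : G).

Lemma lcosetP V x y : reflect (lcoset V x = lcoset V y) ((x^-1 * y)%g \in V).
Proof. exact: (iffP (@eqmodP _ (coset_eq_equiv V) x y)). Qed.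

Lemma lcoset_repr V (c : cosets V) : lcoset V (repr c) = c.
Proof. exact: reprK. Qed.

Lemma repr_lcoset V x : exists2 v, v \in V & repr (lcoset V x) = (x * v)%g.
Proof.
exists (x^-1 * repr (lcoset V x))%g; last by rewrite mulgA mulgV mul1g.
by apply/lcosetP; rewrite lcoset_repr.
Qed.

Lemma lcosetMl V g x y : lcoset V x = lcoset V y ->
  lcoset V (g * x)%g = lcoset V (g * y)%g.
Proof.
by move/lcosetP => xy; apply/lcosetP; rewrite invgM -mulgA mulKg.
Qed.

Lemma lcosetMr V x v : v \in V -> lcoset V (x * v)%g = lcoset V x.
Proof. by move=> vV; apply/lcosetP; rewrite invgM mulgVK gpredVr. Qed.

Lemma near_mulg g (U : set G) : nbhs 1%g [set x | U (g * x)%g] -> nbhs g U.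
Proof.
move=> gU; have : nbhs (g^-1 * g)%g [set x | U (g * x)%g] by rewrite mulVg.
move=> /(@mulg_continuous G (g^-1, g)%g) [/= [A B] /= [gA gB] AB].
apply: filterS gB => x Bx /=; have /= := AB ((g^-1)%g, x).
by rewrite mulVKg; apply; split => //; exact: nbhs_singleton gA.
Qed.

Lemma open_subgroup V : nbhs 1%g [set` V] -> open [set` V].
Proof.
move=> V1; rewrite openE => g gV; apply: near_mulg.
by apply: filterS V1 => x /= xV; rewrite gpredM.
Qed.

Lemma subgroup_nbhs V : open [set` V] -> nbhs 1%g [set` V].
Proof. by move=> Vo; apply: open_nbhs_nbhs; split => //=; exact: gpred1. Qed.

Lemma countable_cosets V : separable_space G -> open [set` V] ->
  countable [set: cosets V].
Proof.
move=> [S cS dS] Vo.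
apply: (@sub_countable _ _ _ (lcoset V @` S)); last exact: card_le_trans (card_image_le _ _) cS.
apply: subset_card_le => c _.
have : nbhs (repr c) [set x | ((repr c)^-1 * x)%g \in V].
  apply: near_mulg; apply: filterS (subgroup_nbhs Vo) => x /=.
  by rewrite mulKg.
rewrite nbhsE => -[B [Bo Bc] BV].
have [x [Bx Sx]] := dS B (ex_intro _ _ Bc) Bo.
exists x => //; rewrite -[RHS]lcoset_repr; apply/esym/lcosetP; exact: BV.
Qed.

Lemma finite_double_cosets V : roelcke_precompact G -> open [set` V] ->
  exists2 F : set G, finite_set F & forall g,
    exists u x v, [/\ u \in V, F x, v \in V & g = (u * x * v)%g].
Proof.
move=> rG /subgroup_nbhs /rG [F [finF VFV]]; exists F => // g.
have : [set: G] g by []. rewrite VFV => -[u [x [v [Vu Fx Vv ->]]]].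
by exists u, x, v.
Qed.

Section commensurator.
Variable V : groupClosed G.

(** Equivalently, [V] meets [g V g^-1] in a subgroup of finite index of [V]: one half of
    commensurability. Under Roelcke precompactness this half is symmetric in [g] and [g^-1]
    ([finite_orbitV]). *)
Definition finite_orbit g :=
  finite_set [set lcoset V (v * g)%g | v in [set` V]].

Lemma finite_orbitMl u g : u \in V -> finite_orbit g -> finite_orbit (u * g)%g.
Proof.
move=> uV; apply: sub_finite_set => _ [v vV <-]; exists (v * u)%g.
  by rewrite /= gpredM.
by rewrite mulgA.
Qed.

Lemma finite_orbitMr v g : v \in V -> finite_orbit (g * v)%g <-> finite_orbit g.
Proof.
move=> vV; rewrite /finite_orbit.
by under eq_imagel do rewrite mulgA lcosetMr//.
Qed.

Lemma finite_orbit1 v : v \in V -> finite_orbit v.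
Proof.
move=> vV; apply: (@sub_finite_set _ _ [set lcoset V 1%g]); last exact: finite_set1.
move=> _ [u uV <-] /=; apply/esym/lcosetP.
by rewrite invg1 mul1g gpredM.
Qed.

Lemma finite_orbitM g h :
  finite_orbit g -> finite_orbit h -> finite_orbit (g * h)%g.
Proof.
move=> fg fh.
have : finite_set (\bigcup_(c in [set lcoset V (v * g)%g | v in [set` V]])
    ((fun e => lcoset V (repr c * repr e)%g) @`
     [set lcoset V (v * h)%g | v in [set` V]])).
  by apply: bigcup_finite => // c _; exact: finite_image.
apply: sub_finite_set => _ [v vV <-].
exists (lcoset V (v * g)%g); first by exists v.
have [w wV ->] := repr_lcoset V (v * g)%g.
exists (lcoset V (w^-1 * h)%g).
  by exists (w^-1)%g => //=; rewrite gpredVr.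
have [u uV ->] := repr_lcoset V (w^-1 * h)%g.
by rewrite !mulgA mulgK lcosetMr.
Qed.

Hypotheses (rG : roelcke_precompact G) (Vo : open [set` V]).

(** There are finitely many double cosets [V x V], and the orbit condition says that such a double
    coset consists of finitely many left cosets. *)
Lemma finite_finite_orbit :
  finite_set [set lcoset V g | g in [set g | finite_orbit g]].
Proof.
have [F finF VFV] := finite_double_cosets rG Vo.
have : finite_set (\bigcup_(x in [set x | F x /\ finite_orbit x])
    [set lcoset V (v * x)%g | v in [set` V]]).
  apply: bigcup_finite => [|x []//].
  by apply: sub_finite_set finF => x [].
apply: sub_finite_set => _ [g fg <-].
have [u [x [v [uV Fx vV gE]]]] := VFV g.
exists x; last by exists u => [//|]; rewrite gE; apply/esym; exact: lcosetMr.
split => //.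
have -> : x = (u^-1 * g * v^-1)%g by rewrite gE !mulgA mulVg mul1g mulgK.
by apply/finite_orbitMr; rewrite ?gpredVr//; apply: finite_orbitMl; rewrite ?gpredVr.
Qed.

(** Left multiplication by [g] is an injection of the finite set [E] into itself, hence a bijection;
    so some [h] with finite orbit satisfies [g h V = V], and [g^-1] lies in [h V]. *)
Lemma finite_orbitV g : finite_orbit g -> finite_orbit (g^-1)%g.
Proof.
move=> fg; set E := [set lcoset V g | g in [set g | finite_orbit g]].
have finE : finite_set E := finite_finite_orbit.
pose f (c : cosets V) := lcoset V (g * repr c)%g.
have fE c : E c -> E (f c).
  move=> [h fh <-]; exists (g * h)%g; first exact: finite_orbitM.
  by rewrite /f; apply: lcosetMl; rewrite lcoset_repr.
have finj : {in E &, injective f}.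
  move=> c d _ _ /lcosetP; rewrite invgM -mulgA mulKg => /lcosetP.
  by rewrite !lcoset_repr.
have fEE : f @` E = E.
  have /finite_seqP [s0 Es0] := finE; set s := undup s0.
  have Es : E = [set` s] by rewrite Es0; apply/seteqP; split => x /=; rewrite mem_undup.
  have [|||_ sE] := @uniq_min_size _ (map f s) s.
  - rewrite map_inj_in_uniq ?undup_uniq// => x y xs ys; apply: finj.
      by rewrite Es inE.
    by rewrite Es inE.
  - move=> _ /mapP [x xs ->].
    by have := fE x; rewrite Es /=; exact.
  - by rewrite size_map.
  rewrite Es; apply/seteqP; split => x /=; first by move=> [y ys <-]; rewrite -sE map_f.
  by rewrite -sE => /mapP [y ys ->]; exists y.
have : E (lcoset V 1%g).
  by exists 1%g => //; exact/finite_orbit1/gpred1.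
rewrite -fEE => -[_ [h fh <-]]; rewrite /f => /esym/lcosetP.
rewrite invg1 mul1g; have [v vV ->] := repr_lcoset V h => ghv.
have -> : (g^-1 = h * (v * (g * (h * v))^-1))%g.
  by rewrite !invgM !mulgA mulgK mulgV mul1g.
by apply/finite_orbitMr => //; rewrite gpredM// gpredVr.
Qed.

Lemma commensurator_group :
  exists W : groupClosed G, [set` W] = [set g | finite_orbit g].
Proof.
apply: group_closed_of_set.
- exact/finite_orbit1/gpred1.
- exact: finite_orbitM.
- exact: finite_orbitV.
Qed.

(** If the intersection [K] of [W] with its conjugate by [g] has finite index in [W], then [W g] is
    a finite union of sets [h K g], each inside [h g W], and [W] is a finite union of cosets of [V].
    So [W g], which contains [V g], meets finitely many cosets of [V]. *)
Lemma self_commensurating_commensurator :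
  self_commensurating [set g | finite_orbit g].
Proof.
set W := [set g | finite_orbit g]; set E := [set lcoset V g | g in W].
have finE : finite_set E := finite_finite_orbit.
move=> g [fK _]; set K := W `&` [set (g * h * g^-1)%g | h in W] in fK.
have : finite_set (\bigcup_(C in [set [set (h * k)%g | k in K] | h in W])
   [set lcoset V (x * g)%g | x in C]).
  apply: bigcup_finite => // _ [h Wh <-].
  apply: (@sub_finite_set _ _ ((fun c => lcoset V (h * g * repr c)%g) @` E)).
    move=> _ [_ [k [Wk [w Ww <-]] <-] <-]; exists (lcoset V w); first by exists w.
    have [v vV ->] := repr_lcoset V w.
    by rewrite !mulgA mulgVK lcosetMr.
  exact: finite_image.
apply: sub_finite_set => _ [v vV <-].
exists [set (v * k)%g | k in K]; first by exists v => //; exact: finite_orbit1.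
exists v => //; exists 1%g; last by rewrite mulg1.
have W1 : W 1%g by exact/finite_orbit1/gpred1.
by split => //; exists 1%g => //; rewrite mulg1 mulgV.
Qed.

End commensurator.
End open_subgroups.

(** * Infinite Ramsey theorem *)


Section ramsey.
Variables (T C : choiceType) (A : set T) (k : T -> T -> C).
Variable Phi : set C.
Hypotheses (infA : infinite_set A) (finPhi : finite_set Phi).
Hypothesis kPhi : forall x y, A x -> A y -> Phi (k x y).

Let cofinite_in := [set S : set T | finite_set (A `\` S)].

Let cofinite_in_filter : ProperFilter cofinite_in.
Proof.
split; first by rewrite /cofinite_in /= setD0.
split; rewrite /cofinite_in /=.
- by rewrite setDT; exact: finite_set0.
- by move=> P Q fP fQ; rewrite /cofinite_in /= setDIr finite_setU.
- by move=> P Q PQ; apply: sub_finite_set => x [Ax nQ]; split => // /PQ.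
Qed.

(* Fix a nonprincipal ultrafilter on [A]: almost all elements of [A] have the
   same dominant colour [b], and the sequence is chosen greedily among them. *)
Lemma infinite_ramsey : exists (x : nat -> T) (b : C), [/\ Phi b,
  forall i, A (x i) &
  forall i j, (i < j)%N -> x i <> x j /\ k (x i) (x j) = b].
Proof.
have [U [uU FU]] := ultraFilterLemma cofinite_in_filter.
have pU : ProperFilter U by exact: ultra_proper.
have UA : U A by apply: FU; rewrite /cofinite_in /= setDv; exact: finite_set0.
have colour (f : T -> C) : (forall x, A x -> Phi (f x)) ->
    exists2 b, Phi b & U [set x | f x = b].
  move=> fPhi; apply: contrapT => nf.
  have Un b : Phi b -> U [set x | f x <> b].
    move=> Pb; have [/= Ub|//] := in_ultra_setVsetC [set x | f x = b] uU.
    by exfalso; apply: nf; exists b.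
  have : U [set x | forall b, Phi b -> f x <> b].
    have /finite_seqP [s Phis] := finPhi.
    move: Un; rewrite Phis; elim: s {Phis} => [_|b s IHs Un].
      by apply: filterS filterT.
    have Us : U [set x | forall c, [set` s] c -> f x <> c].
      by apply: IHs => c cs; apply: Un; rewrite /= inE (_ : c \in s) ?orbT.
    apply: filterS (filterI (Un b _) Us); last by rewrite /= mem_head.
    move=> x [/= xb xs] c.
    by rewrite /= inE => /orP[/eqP -> //|]; exact: xs.
  move=> /(filterI UA) /filter_ex [x [Ax]] /(_ _ (fPhi _ Ax)); exact.
have /choice [b0 b0P] : forall x, exists b, A x -> Phi b /\ U [set y | k x y = b].
  move=> x; have [Ax|nAx] := pselect (A x).
    have [b Pb Ub] := colour (k x) (fun y => kPhi Ax).
    by exists b.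
  have [t At] := infinite_setN0 infA.
  by exists (k t t).
have [b Pb Ub] := colour b0 (fun x Ax => (b0P x Ax).1).
pose B := A `&` [set x | b0 x = b].
have next (s : seq T) : (forall x, x \in s -> B x) ->
    exists y, B y /\ forall x, x \in s -> x <> y /\ k x y = b.
  move=> sB; suff : U [set y | forall x, x \in s -> x <> y /\ k x y = b].
    by move=> /(filterI (filterI UA Ub)) /filter_ex [y [By sy]]; exists y.
  elim: s sB => [_|x s IHs sB]; first by apply: filterS filterT.
  have [Ax xb] := sB x (mem_head _ _).
  have Ux : U [set y | k x y = b] by rewrite -xb; exact: (b0P x Ax).2.
  have Unx : U [set y | x <> y].
    apply: FU; rewrite /cofinite_in /=.
    apply: sub_finite_set (finite_set1 x) => y [_ /=].
    by move/contrapT.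
  have Us : U [set y | forall x, x \in s -> x <> y /\ k x y = b].
    by apply: IHs => y ys; apply: sB; rewrite inE ys orbT.
  apply: filterS (filterI (filterI Ux Unx) Us) => y [[/= xy nxy] ys] z.
  by rewrite inE => /orP[/eqP ->|]//; exact: ys.
have [t At] := infinite_setN0 infA.
pose nxt (s : seq T) := xget t [set y | B y /\
  forall x, x \in s -> x <> y /\ k x y = b].
have nxtI s : (forall x, x \in s -> B x) -> B (nxt s) /\
    forall x, x \in s -> x <> nxt s /\ k x (nxt s) = b.
  move=> /next [y yP].
  exact: (@xgetI _ t [set y | B y /\ forall x, x \in s -> x <> y /\ k x y = b] y yP).
pose sq := fix sq n := if n is n'.+1 then nxt (sq n') :: sq n' else [::].
have sqB n : forall x, x \in sq n -> B x.
  elim: n => [//|n IHn] x /=; rewrite inE => /orP[/eqP ->|]; last exact: IHn.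
  exact: (nxtI _ IHn).1.
have nxtP n : B (nxt (sq n)) /\
    forall x, x \in sq n -> x <> nxt (sq n) /\ k x (nxt (sq n)) = b.
  exact: nxtI (sqB n).
have sq_in i j : (i < j)%N -> nxt (sq i) \in sq j.
  elim: j => [//|j IHj]; rewrite ltnS leq_eqVlt => /orP[/eqP ->|/IHj ij] /=.
    exact: mem_head.
  by rewrite inE ij orbT.
exists (fun n => nxt (sq n)), b; split => //.
  by move=> n; have [[]] := nxtP n.
by move=> i j ij; have [_] := nxtP j; apply; exact: sq_in.
Qed.

End ramsey.

(** * Isometric actions preserving a cone *)


Lemma finite_set_min (R : realDomainType) (A : set R) : finite_set A -> A !=set0 ->
  exists2 a, A a & forall b, A b -> a <= b.
Proof.
move=> /finite_seqP [s ->]; elim: s => [[]//|x s IHs _].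
have [->|s0] := eqVneq s [::].
  by exists x; rewrite /= ?mem_head// => b; rewrite inE => /eqP ->.
have /IHs [a sa amin] : [set` s] !=set0.
  by case: s s0 {IHs} => // y s _; exists y; rewrite /= mem_head.
exists (Num.min x a).
  by rewrite /= inE; case: leP => _; rewrite ?eqxx// (_ : a \in s) ?orbT.
move=> b /=; rewrite inE => /orP[/eqP ->|bs]; rewrite ge_min ?lexx//.
by rewrite amin ?orbT.
Qed.

Lemma ex_natSinv_lt (R : realType) (e : R) : 0 < e ->
  exists N, forall n, (N <= n)%N -> (n.+1%:R^-1 : R) < e.
Proof. by move=> e0; have [N _ NP] := near_infty_natSinv_lt (PosNum e0); exists N. Qed.

(** * Semi-inner products: Cauchy-Schwarz and Bessel inequalities *)

Section semi_hilbert.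
Variables (R : realType) (E : lmodType R) (dot : E -> E -> R).
Hypothesis dotC : forall x y, dot x y = dot y x.
Hypothesis dotDl : forall x y z, dot (x + y) z = dot x z + dot y z.
Hypothesis dotZl : forall a x z, dot (a *: x) z = a * dot x z.
Hypothesis dot_ge0 : forall x, 0 <= dot x x.

Local Notation sq x := (dot x x).

Let dotDr x y z : dot z (x + y) = dot z x + dot z y.
Proof. by rewrite dotC dotDl !(dotC z). Qed.
Let dotZr a x z : dot z (a *: x) = a * dot z x.
Proof. by rewrite dotC dotZl dotC. Qed.
Let dotNl x z : dot (- x) z = - dot x z.
Proof. by rewrite -scaleN1r dotZl mulN1r. Qed.
Let dotNr x z : dot z (- x) = - dot z x.
Proof. by rewrite dotC dotNl dotC. Qed.
Let dot0l z : dot 0 z = 0.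
Proof. by rewrite -(scale0r 0) dotZl mul0r. Qed.
Let dot_suml I (r : seq I) (F : I -> E) z :
  dot (\sum_(i <- r) F i) z = \sum_(i <- r) dot (F i) z.
Proof.
elim: r => [|i r IHr]; first by rewrite !big_nil dot0l.
by rewrite !big_cons dotDl IHr.
Qed.
Let dotE := (dotDl, dotDr, dotNl, dotNr, dotZl, dotZr).

Let sqB x y : sq (x - y) = sq x - 2 * dot x y + sq y.
Proof. rewrite !dotE (dotC y x); ring. Qed.

Lemma cauchy_schwarz x y : dot x y ^+ 2 <= sq x * sq y.
Proof.
have := dot_ge0 y; rewrite le_eqVlt => /orP[/eqP y0|y0].
  rewrite -y0 mulr0; have [->|dxy] := eqVneq (dot x y) 0; first by rewrite expr0n.
  (* This multiple of [y] is chosen so that the square would be [-1]. *)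
  have := dot_ge0 (x - ((sq x + 1) / (2 * dot x y)) *: y).
  rewrite sqB !dotE -y0 !mulr0 !addr0.
  rewrite (_ : 2 * _ = sq x + 1); first by lra.
  by field.
have := dot_ge0 (sq y *: x - dot x y *: y).
rewrite sqB !dotE => H.
rewrite -(ler_pM2l y0); nra.
Qed.

Lemma sq_eq0_dot x y : sq x = 0 -> dot x y = 0.
Proof.
move=> x0; have := cauchy_schwarz x y; rewrite x0 mul0r => dxy.
by apply/eqP; rewrite -sqrf_eq0 eq_le dxy sqr_ge0.
Qed.

Lemma eqv_dot x y z : sq (x - y) = 0 -> dot x z = dot y z.
Proof.
by move=> /(sq_eq0_dot z); rewrite dotDl dotNl => /eqP; rewrite subr_eq0 => /eqP.
Qed.

Definition cvgE (u : nat -> E) (l : E) :=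
  forall e : R, 0 < e -> exists N, forall n, (N <= n)%N -> sq (u n - l) < e.

Lemma cvgE_dot u l z : cvgE u l -> (fun n => dot (u n) z) @ \oo --> dot l z.
Proof.
move=> ul; apply/cvgrPdist_lt => e e0.
have z0 : 0 < sq z + 1 by rewrite ltr_pwDr.
have [N NP] := ul (e ^+ 2 / (sq z + 1)) (divr_gt0 (exprn_gt0 _ e0) z0).
exists N => // n /= /NP; rewrite ltr_pdivlMr// => Hn.
rewrite distrC -dotNl -dotDl -(ltr_pXn2r (n := 2)) ?nnegrE ?normr_ge0 ?ltW//.
rewrite real_normK ?num_real//; apply: le_lt_trans (cauchy_schwarz _ _) _.
by apply: le_lt_trans Hn; rewrite ler_wpM2l ?dot_ge0// lerDl.
Qed.

Let lim_cst (u : nat -> R) (a l : R) : u @ \oo --> l -> (forall n, u n = a) -> l = a.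
Proof.
move=> ul ua; have ua' : u = cst a by apply/funext.
by rewrite ua' in ul; apply: (cvg_unique _ ul); [exact: Rhausdorff|exact: cvg_cst].
Qed.

(* Bessel's inequality. *)
Lemma orthogonal_small (y : nat -> E) (r : R) (z : E) (e : R) :
  (forall i, sq (y i) = r) -> (forall i j, i <> j -> dot (y i) (y j) = 0) ->
  0 < e -> exists n, `|dot z (y n)| < e.
Proof.
move=> yr yo e0; apply: contrapT => nex.
have ye n : e <= `|dot z (y n)|.
  by rewrite leNgt; apply/negP => H; apply: nex; exists n.
have r0 : 0 <= r by rewrite -(yr 0%N).
have r1 : 0 < r + 1 by lra.
(* With these signs [<z, s n>] is [|<z, y n>| >= e], so [<z, S n> >= n e], whereas orthogonality
   keeps [sq (S n) <= n r]. *)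
pose s n := Num.sg (dot z (y n)) *: y n.
have zs n : e <= dot z (s n).
  by rewrite /s dotZr -normrEsg.
have ss n : sq (s n) <= r.
  rewrite /s !dotE yr mulrA -expr2 ler_piMl// sqr_sg; by case: eqP.
have so i j : i <> j -> dot (s i) (s j) = 0.
  by move=> ij; rewrite /s !dotE yo// !mulr0.
pose S n := \sum_(0 <= i < n) s i.
have Sz n : n%:R * e <= dot z (S n).
  elim: n => [|n IHn]; first by rewrite mul0r /S big_geq// dotC dot0l.
  rewrite /S big_nat_recr//= dotDr -natr1 mulrDl mul1r lerD//.
have So n m : (n <= m)%N -> dot (S n) (s m) = 0.
  move=> nm; rewrite /S dot_suml big_nat big1// => i /andP[_ im].
  by apply: so => im'; move: im; rewrite im' ltnNge nm.
have SS n : sq (S n) <= n%:R * r.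
  elim: n => [|n IHn]; first by rewrite mul0r /S big_geq// dot0l.
  rewrite /S big_nat_recr//= -/(S n) dotDl !dotDr (dotC (s n)) So// -natr1 mulrDl mul1r.
  by rewrite addr0 add0r lerD.
(* A positive value with [t r <= e], also when [r = 0]: expanding [0 <= sq (z - t S n)] then gives
   [n t e <= sq z], which fails for large [n]. *)
pose t := e / (r + 1).
have t0 : 0 < t by rewrite divr_gt0.
have key n : n%:R * (t * e) <= sq z.
  have := dot_ge0 (z - t *: S n); rewrite sqB !dotE => H.
  have tr : t * r <= e by rewrite /t mulrAC ler_pdivrMr// ler_wpM2l ?ltW//; lra.
  have H1 := ler_wpM2l (ltW t0) (Sz n).
  have H2 := ler_wpM2l (ltW t0) (ler_wpM2l (ltW t0) (SS n)).
  have H3 := ler_wpM2l (ltW t0) (ler_wpM2l (ler0n _ n) tr).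
  by nra.
have te : 0 < t * e by rewrite mulr_gt0.
have := archi_boundP (divr_ge0 (dot_ge0 z) (ltW te)).
by rewrite ltr_pdivrMr// ltNge key.
Qed.

End semi_hilbert.


Section isometric_action.
Variables (R : realType) (E : lmodType R) (dot : E -> E -> R).
Hypothesis dotC : forall x y, dot x y = dot y x.
Hypothesis dotDl : forall x y z, dot (x + y) z = dot x z + dot y z.
Hypothesis dotZl : forall a x z, dot (a *: x) z = a * dot x z.
Hypothesis dot_ge0 : forall x, 0 <= dot x x.

Local Notation sq x := (dot x x).
Local Notation cvgE := (cvgE dot).

Hypothesis dot_complete : forall u : nat -> E,
  (forall e : R, 0 < e -> exists N, forall m n, (N <= m)%N -> (N <= n)%N ->
    sq (u m - u n) < e) -> exists l, cvgE u l.

Variables (G : topologicalGroupType) (K : G -> E -> E).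
Hypothesis KM : forall g h x, sq (K (g * h)%g x - K g (K h x)) = 0.
Hypothesis K1 : forall x, sq (K 1%g x - x) = 0.
Hypothesis Kdot : forall g x y, dot (K g x) (K g y) = dot x y.
Hypothesis Kcont : forall x (e : R), 0 < e -> nbhs 1%g [set g | sq (K g x - x) < e].

Variable Q : set E.
Hypothesis KQ : forall g x, Q x -> Q (K g x).
(** Obtained by duality, the cone is closed and convex at no cost, and stable under [K g] because
    the adjoint [K g^-1] preserves [Q]. The hypothesis [PQ] makes products of its elements
    nonnegative. *)
Definition dual_cone : set E := [set x | forall y, Q y -> 0 <= dot x y].
Local Notation P := dual_cone.
Hypothesis PQ : P `<=` Q.

Let dotDr x y z : dot z (x + y) = dot z x + dot z y.
Proof. by rewrite dotC dotDl !(dotC z). Qed.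
Let dotZr a x z : dot z (a *: x) = a * dot z x.
Proof. by rewrite dotC dotZl dotC. Qed.
Let dotNl x z : dot (- x) z = - dot x z.
Proof. by rewrite -scaleN1r dotZl mulN1r. Qed.
Let dotNr x z : dot z (- x) = - dot z x.
Proof. by rewrite dotC dotNl dotC. Qed.
Let dot0l z : dot 0 z = 0.
Proof. by rewrite -(scale0r 0) dotZl mul0r. Qed.
Let dot_suml I (r : seq I) (F : I -> E) z :
  dot (\sum_(i <- r) F i) z = \sum_(i <- r) dot (F i) z.
Proof.
elim: r => [|i r IHr]; first by rewrite !big_nil dot0l.
by rewrite !big_cons dotDl IHr.
Qed.
Let dotE := (dotDl, dotDr, dotNl, dotNr, dotZl, dotZr).
Let sqB x y : sq (x - y) = sq x - 2 * dot x y + sq y.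
Proof. rewrite !dotE (dotC y x); ring. Qed.
Let eqv_dot := eqv_dot dotC dotDl dotZl dot_ge0.
Let cauchy_schwarz := cauchy_schwarz dotC dotDl dotZl dot_ge0.
Let cvgE_dot := cvgE_dot dotC dotDl dotZl dot_ge0.

Let dotK1 x y : dot (K 1%g x) y = dot x y.
Proof. exact: eqv_dot (K1 x). Qed.

Let dotKM g h x y : dot (K (g * h)%g x) y = dot (K g (K h x)) y.
Proof. exact: eqv_dot (KM g h x). Qed.

Let dotKV g x y : dot (K g x) y = dot x (K (g^-1)%g y).
Proof.
by rewrite -(Kdot g x) [RHS]dotC -dotKM mulgV dotK1 dotC.
Qed.

Let sqKB g x y : sq (K g x - K g y) = sq (x - y).
Proof. by rewrite !sqB !Kdot. Qed.

Let sqB_ge0 x y : 2 * dot x y <= sq x + sq y.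
Proof. have := dot_ge0 (x - y); rewrite sqB; lra. Qed.

Let sqD_le x y : sq (x + y) <= 2 * sq x + 2 * sq y.
Proof. have := sqB_ge0 x y; rewrite !dotE (dotC y x); lra. Qed.

Let sq_sub_le x y z : sq (x - z) <= 2 * sq (x - y) + 2 * sq (y - z).
Proof. by rewrite (_ : x - z = (x - y) + (y - z)) ?sqD_le// addrA subrK. Qed.

Let PD x y : P x -> P y -> P (x + y).
Proof. by move=> Px Py q Qq; rewrite dotDl addr_ge0// ?Px ?Py. Qed.

Let PZ a x : 0 <= a -> P x -> P (a *: x).
Proof. by move=> a0 Px q Qq; rewrite dotZl mulr_ge0// Px. Qed.

Let P0 : P 0.
Proof. by move=> q _; rewrite dot0l. Qed.

Let PK g x : P x -> P (K g x).
Proof. by move=> Px q Qq; rewrite dotKV Px//; exact: KQ. Qed.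

Let P_dot x y : P x -> P y -> 0 <= dot x y.
Proof. by move=> Px /PQ; exact: Px. Qed.

Let P_lim l : (forall e : R, 0 < e -> exists2 y, P y & sq (y - l) < e) -> P l.
Proof.
move=> Pl q Qq; rewrite leNgt; apply/negP => lq.
have q0 : 0 < sq q + 1 by rewrite ltr_pwDr.
have [|y Py yl] := Pl (dot l q ^+ 2 / (sq q + 1)).
  by rewrite divr_gt0// exprn_even_gt0//= lt_eqF.
have := cauchy_schwarz (y - l) q; rewrite dotDl dotNl.
have := Py q Qq; have := dot_ge0 q; have := dot_ge0 (y - l).
move: yl; rewrite ltr_pdivlMr//; nra.
Qed.

(** * Circumcenters: from almost fixed to fixed vectors *)

Section fixed_vector.
Variables (U : groupClosed G) (xi : E).
Hypotheses (Pxi : P xi) (xi0 : 0 < sq xi).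
Hypothesis Uxi : forall u, u \in U -> sq (K u xi - xi) <= sq xi / 8.

Let U1 : 1%g \in U. Proof. exact: gpred1. Qed.

Let orb y := [set sq (K u xi - y) | u in [set` U]].
(** Squared radius of the smallest ball centred at [y] that contains the orbit [U xi]; [d] below is
    its infimum over centres in the cone. *)
Let r2 y := sup (orb y).

Let orb_has_sup y : has_sup (orb y).
Proof.
split; first by exists (sq (K 1%g xi - y)), 1%g => //=; exact: gpred1.
exists (2 * sq xi + 2 * sq y) => _ [u _ <-].
have := sqD_le (K u xi) (- y).
by rewrite Kdot dotNl dotNr opprK.
Qed.

Let r2_ub y u : u \in U -> sq (K u xi - y) <= r2 y.
Proof. by move=> uU; apply: ub_le_sup; [exact: (orb_has_sup y).2|exists u]. Qed.

Let r2_le y c : (forall u, u \in U -> sq (K u xi - y) <= c) -> r2 y <= c.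
Proof.
move=> H; apply: ge_sup; first exact: (orb_has_sup y).1.
by move=> _ [u uU <-]; exact: H.
Qed.

Let rads := [set r2 y | y in P].
Let d := inf rads.

Let r2_ge0 y : 0 <= r2 y.
Proof. by apply: le_trans (r2_ub y U1). Qed.

Let rads_has_inf : has_inf rads.
Proof.
split; first by exists (r2 xi), xi.
by exists 0 => _ [y _ <-]; exact: r2_ge0.
Qed.

Let d_le y : P y -> d <= r2 y.
Proof. by move=> Py; apply: ge_inf; [exact: rads_has_inf.2|exists y]. Qed.

(** Parallelogram law at the midpoint of [y] and [z]. Two almost optimal centres are close: hence
    both the convergence of a minimizing sequence and the invariance of its limit. *)
Let mid_le y z : P y -> P z -> sq (y - z) <= 2 * r2 y + 2 * r2 z - 4 * d.
Proof.
move=> Py Pz; have Pm : P (2^-1 *: (y + z)) by apply: PZ; [lra|exact: PD].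
suff : r2 (2^-1 *: (y + z)) <= (r2 y + r2 z) / 2 - sq (y - z) / 4.
  have := d_le Pm; lra.
apply: r2_le => u uU; have := r2_ub y uU; have := r2_ub z uU.
rewrite !sqB !dotE (dotC z y); lra.
Qed.

Let r2K u y : u \in U -> r2 (K u y) <= r2 y.
Proof.
move=> uU; apply: r2_le => v vV.
have uvU : (u^-1 * v)%g \in U by rewrite gpredM// gpredVr.
apply: le_trans (r2_ub y uvU); rewrite le_eqVlt; apply/orP; left; apply/eqP.
rewrite !sqB !Kdot; congr (_ - 2 * _ + _).
by rewrite dotKM [RHS]dotKV invgK.
Qed.

(* The circumcenter of the orbit [U xi], inside the cone. *)
Lemma ex_fixed_vector : exists f, [/\ P f, 0 < sq f &
  forall u, u \in U -> sq (K u f - f) = 0].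
Proof.
have /choice [y yP] : forall n, exists y, P y /\ r2 y < d + (n.+1%:R^-1 : R).
  move=> n; have [|_ [y Py <-] yd] := @inf_adherent _ rads n.+1%:R^-1 _ rads_has_inf.
    by [].
  by exists y.
have Py n : P (y n) := (yP n).1.
have yd n : r2 (y n) < d + (n.+1%:R^-1 : R) := (yP n).2.
have [f yf] : exists f, cvgE y f.
  apply: dot_complete => e e0.
  have [|N NP] := @ex_natSinv_lt R (e / 4); first by rewrite divr_gt0.
  exists N => m n /NP mN /NP nN; have := mid_le (Py m) (Py n).
  move: mN nN (yd m) (yd n); move: (n.+1%:R^-1) (m.+1%:R^-1) => a b; lra.
have Pf : P f by apply: P_lim => e /yf [N NP]; exists (y N) => //; exact: NP.

exists f; split => //.
(* The centre [xi] gives [d <= sq xi / 8], and for the chosen [n] both errors are below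
   [sq xi / 16]. Then [sq (xi - f) < 2 (3/16 + 1/16) sq xi = sq xi / 2], so [f] is not null. *)
- have d8 : d <= sq xi / 8 by apply: (le_trans (d_le Pxi)); apply: r2_le.
  have xi16 : 0 < sq xi / 16 by rewrite divr_gt0.
  have [N NP] := ex_natSinv_lt xi16.
  have [M MP] := yf _ xi16.
  have := NP _ (leq_maxl N M); have := MP _ (leq_maxr N M).
  set n := maxn N M => nf n16.
  have yx := r2_ub (y n) U1; rewrite sqB Kdot dotK1 -sqB in yx; have yn := yd n.
  have := sq_sub_le xi (y n) f => H.
  have H2 := sq_sub_le xi f 0; rewrite !subr0 in H2.
  move: n16 yn (NP) => {NP}; move: (n.+1%:R^-1) => a n16 yn _; lra.
(* [K u (y n)] is as good a centre as [y n], so both are within [4 / (n + 1)] in square. The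
   fraction 1/64 absorbs the constants of three squared triangle inequalities. *)
- move=> u uU; apply/eqP; rewrite eq_le dot_ge0 andbT leNgt; apply/negP => uf.
  have uf32 : 0 < sq (K u f - f) / 64 by rewrite divr_gt0.
  have [N NP] := ex_natSinv_lt uf32.
  have [M MP] := yf _ uf32.
  have := NP _ (leq_maxl N M); have := MP _ (leq_maxr N M).
  set n := maxn N M => nf n64.
  have yu : sq (K u (y n) - y n) <= 4 * n.+1%:R^-1.
    have := mid_le (PK u (Py n)) (Py n); have := r2K (y n) uU; have := yd n.
    move: (n.+1%:R^-1) => a; lra.
  have H1 := sq_sub_le (K u f) (K u (y n)) f.
  have H2 := sq_sub_le (K u (y n)) (y n) f.
  rewrite sqKB in H1.
  have H3 : sq (f - y n) = sq (y n - f) by rewrite !sqB (dotC f); ring.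
  move: n64 yu; move: (n.+1%:R^-1) => a; lra.
Qed.

End fixed_vector.

(** * Orthogonality of distant translates of a vector of least norm *)

Section minimal_vector.
Variables (Phi : set R) (eta : E).
Hypotheses (finPhi : finite_set Phi) (Peta : P eta) (eta0 : 0 < sq eta).
Hypothesis etaPhi : forall g, Phi (dot (K g eta) eta).
Hypothesis eta_min : forall zeta, P zeta -> 0 < sq zeta ->
  (forall g, Phi (dot (K g zeta) zeta)) -> sq eta <= sq zeta.

Let phi g := dot (K g eta) eta.

Let phi_le g : phi g <= sq eta.
Proof. have := sqB_ge0 (K g eta) eta; rewrite Kdot /phi; lra. Qed.

Let dot_phi g h : dot (K g eta) (K h eta) = phi (h^-1 * g)%g.
Proof. by rewrite /phi dotKM [RHS]dotKV invgK. Qed.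

Let stab_eqv g : phi g = sq eta <-> sq (K g eta - eta) = 0.
Proof. rewrite sqB Kdot -/(phi g); split; lra. Qed.

Variable V : groupClosed G.
Hypothesis VE : [set` V] = [set g | phi g = sq eta].

Let VP g : reflect (phi g = sq eta) (g \in V).
Proof.
apply: (iffP idP) => gV; first by have : [set` V] g by []; rewrite VE.
by have : [set g | phi g = sq eta] g by []; rewrite -VE.
Qed.

Let phiVl v g : v \in V -> phi (v * g)%g = phi g.
Proof.
rewrite -gpredV => /VP /stab_eqv vV.
by rewrite /phi dotKM dotKV dotC (eqv_dot _ vV) dotC.
Qed.

Let phiVr v g : v \in V -> phi (g * v)%g = phi g.
Proof.
by move=> /VP /stab_eqv vV; rewrite /phi dotKM !(dotKV g) (eqv_dot _ vV).
Qed.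

Let phi_ge0 g : 0 <= phi g.
Proof. by apply: P_dot => //; exact: PK. Qed.

(* If [phi g <> 0], extract from the infinite orbit of [K g eta] under the
   stabilizer a sequence [y n] with constant pairwise inner products [b].  Its
   Cesaro means converge to some [zeta], which is also its weak limit, so that
   [zeta] has all its coefficients in [Phi]; but [sq zeta = b < sq eta]. *)
Lemma infinite_orbit_orthogonal g : ~ finite_orbit V g -> phi g = 0.
Proof.
move=> infg; apply/eqP; rewrite eq_le phi_ge0 andbT leNgt; apply/negP => c0.
(* Products of two translates of [eta] are coefficients of [eta], so they lie in [Phi]: this is the
   finite colouring given to Ramsey's theorem. *)
pose k (c c' : cosets V) := dot (K (repr c) eta) (K (repr c') eta).
have kPhi c c' : Phi (k c c') by rewrite /k dot_phi; exact: etaPhi.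
have [x [b [Phib xA xk]]] := infinite_ramsey infg finPhi (fun c c' _ _ => kPhi c c').
pose y n := K (repr (x n)) eta.
have yb i j : i <> j -> dot (y i) (y j) = b.
  move=> ij; have [/xk[_ //]|ji|//] := ltngtP i j.
  by rewrite dotC; have [_] := xk _ _ ji.
have ya i : sq (y i) = sq eta by rewrite /y Kdot.
(* The [y i] come from the [V]-orbit of [g V], and [phi] is constant on [V g V]. So [zeta] too will
   have product [phi g > 0] with [eta], and cannot be null. *)
have yeta i : dot (y i) eta = phi g.
  have [v vV vx] := xA i; rewrite /y.
  have [w wV ->] : exists2 w, w \in V & repr (x i) = (v * g * w)%g.
    by rewrite -vx; exact: repr_lcoset.
  by rewrite -/(phi _) phiVr// phiVl.
have Py i : P (y i) by exact: PK.
have b0 : 0 <= b by rewrite -(@yb 0%N 1%N) ?P_dot.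
have ba : b < sq eta.
  have [x01 _] := xk 0%N 1%N isT.
  rewrite lt_neqAle -(yb 1%N 0%N); last by []. rewrite dot_phi phi_le andbT; apply/eqP => /VP.
  by move=> /lcosetP; rewrite !lcoset_repr.
pose S n := \sum_(0 <= i < n) y i.
pose A n := n.+1%:R^-1 *: S n.+1.
have Sn n : S n.+1 = S n + y n by rewrite /S big_nat_recr.
have dotSy n j : dot (S n) (y j) = b *+ n + (if (j < n)%N then sq eta - b else 0).
  elim: n => [|n IHn]; first by rewrite /S big_geq// dot0l mulr0n addr0.
  rewrite Sn dotDl IHn ltnS mulrS.
  case: ltngtP => [jn|nj|->]; rewrite ?ya ?yb//; try ring.
  - by move=> nj; rewrite nj ltnn in jn.
  - by move=> nj'; rewrite nj' ltnn in nj.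
have dotSS n m : (n <= m)%N ->
    dot (S n) (S m) = b * n%:R * m%:R + (sq eta - b) * n%:R.
  move=> nm; elim: n nm => [_|n IHn nm].
    by rewrite /S big_geq// dot0l !(mulr0, mul0r) addr0.
  rewrite Sn dotDl IHn ?(ltnW nm)// dotC dotSy nm -natr1 -mulr_natr; ring.
(* For [m <= n] it follows that [sq (A m - A n) = (sq eta - b) (1/(m+1) - 1/(n+1))]: the means form
   a Cauchy sequence. *)
have dotAA n m : (n <= m)%N ->
    dot (A n) (A m) = b + (sq eta - b) * m.+1%:R^-1.
  move=> nm; rewrite /A dotZl dotZr dotSS//.
  by field; rewrite !nat1r !pnatr_eq0.
have dotAy n j : (j <= n)%N -> dot (A n) (y j) = b + (sq eta - b) * n.+1%:R^-1.
  move=> jn; rewrite /A dotZl dotSy ltnS jn -mulr_natr.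
  by field; rewrite nat1r pnatr_eq0.
have sum_cst z r n : (forall i, dot (y i) z = r) -> dot (A n) z = r.
  move=> yz; rewrite /A dotZl /S dot_suml.
  rewrite (eq_bigr (fun=> r)) => [|i _]; last exact: yz.
  rewrite sumr_const_nat subn0 -mulr_natr.
  by field; rewrite nat1r pnatr_eq0.
have [zeta Azeta] : exists zeta, cvgE A zeta.
  apply: dot_complete => e e0.
  have d0 : 0 < e / (sq eta - b) by rewrite divr_gt0// subr_gt0.
  have [N NP] := ex_natSinv_lt d0.
  have H m n : (N <= m)%N -> (m <= n)%N -> sq (A m - A n) < e.
    move=> Nm mn; rewrite sqB !dotAA//.
    have := NP m Nm; rewrite ltr_pdivlMr ?subr_gt0//.
    have : 0 <= n.+1%:R^-1 :> R by rewrite invr_ge0.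
    move: (n.+1%:R^-1 : R) (m.+1%:R^-1 : R) => u v u0 vb.
    have : 0 <= (sq eta - b) * u by rewrite mulr_ge0// subr_ge0 ltW.
    nra.
  exists N => m n Nm Nn; have [mn|nm] := leqP m n; first exact: H.
  by rewrite -opprB dotNl dotNr opprK; apply: H => //; exact: ltnW.
have natSinv0 : (fun n => n.+1%:R^-1 : R) @ \oo --> (0 : R).
  exact: cvg_harmonic.
have zy j : dot zeta (y j) = b.
  have h1 := @cvgE_dot _ _ (y j) Azeta.
  have h2 : (fun n => dot (A n) (y j)) @ \oo --> b + (sq eta - b) * 0.
    have h3 : (fun n => b + (sq eta - b) * n.+1%:R^-1) @ \oo -->
        b + (sq eta - b) * 0.
      by apply: cvgD; [exact: cvg_cst|apply: cvgM; [exact: cvg_cst|]].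
    apply: cvg_trans h3; apply: near_eq_cvg.
    by exists j => // n /= jn; rewrite dotAy.
  by rewrite (cvg_unique (@Rhausdorff R) h1 h2) mulr0 addr0.
have lim_cst z r : (forall i, dot (y i) z = r) -> dot zeta z = r.
  move=> yz; have h1 := @cvgE_dot _ _ z Azeta.
  apply: (cvg_unique _ h1) => //.
  rewrite (_ : (fun n => _) = cst r); first exact: cvg_cst.
  by apply/funext => n; exact: sum_cst.
have sqz : sq zeta = b by apply: lim_cst => i; rewrite dotC.
have zeta_eta : dot zeta eta = phi g by apply: lim_cst.
have z0 : 0 < sq zeta.
  rewrite lt_neqAle dot_ge0 andbT; apply/eqP => /esym z0.
  have := cauchy_schwarz zeta eta; rewrite z0 mul0r zeta_eta; nra.
have Pzeta : P zeta.
  apply: P_lim => e /Azeta [N NP]; exists (A N); last exact: NP.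
  apply: PZ; first by rewrite invr_ge0.
  by rewrite /S; elim/big_ind : _ => // u v; exact: PD.
(* The vectors [y n - zeta] are pairwise orthogonal of constant square [sq eta - b], so Bessel's
   inequality makes one of their products with [z] small. *)
have weak z e : 0 < e -> exists n, `|dot z (y n) - dot z zeta| < e.
  move=> e0.
  have [|i j ij||n] := @orthogonal_small _ _ dot dotC dotDl dotZl dot_ge0
      (fun n => y n - zeta) (sq eta - b) z e.
  - by move=> i; rewrite sqB ya sqz dotC zy; ring.
  - by rewrite !dotE yb// sqz zy dotC zy; ring.
  - by [].
  - by exists n; rewrite -dotNr -dotDr.
suff : sq eta <= sq zeta by rewrite sqz leNgt ba.
(* If the coefficient [d0] of [zeta] at [h] were outside the finite set [Phi], it would be at
   distance at least some [d > 0] from it. Replacing [zeta] by [y n] on one side and then, with [n]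
   fixed, by [y m] on the other changes it by less than [d / 2] each time, and ends at a coefficient
   of [eta]. *)
apply: eta_min => // h; apply: contrapT => nPhi; set d0 := dot _ _ in nPhi.
have [d d_gt0 dP] : exists2 d : R, 0 < d & forall p, Phi p -> d <= `|p - d0|.
  have [Phi0|/set0P/negP] := pselect (Phi !=set0); last first.
    by rewrite negbK => /eqP Phi0; exists 1 => // p; rewrite Phi0.
  have [|_ [p Pp <-] pmin] := finite_set_min (finite_image (fun p => `|p - d0|) finPhi).
    by case: Phi0 => p Pp; exists `|p - d0|, p.
  exists `|p - d0|; last by move=> q Pq; apply: pmin; exists q.
  by rewrite normr_gt0 subr_eq0; apply: contra_notN nPhi => /eqP <-.
have d2 : 0 < d / 2 by rewrite divr_gt0.
have [n nP] := weak (K h zeta) _ d2.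
have [m mP] := weak (K (h^-1)%g (y n)) _ d2.
have : d <= `|dot (K (h^-1)%g (y n)) (y m) - d0|.
  by apply: dP; rewrite /y -dotKM dot_phi; exact: etaPhi.
rewrite leNgt => /negP; apply.
rewrite (_ : _ - d0 = (dot (K (h^-1)%g (y n)) (y m) - dot (K (h^-1)%g (y n)) zeta) +
    (dot (K h zeta) (y n) - d0)); last first.
  by rewrite [dot (K _ (y n)) zeta]dotKV invgK (dotC (y n)); ring.
by apply: le_lt_trans (ler_normD _ _) _; lra.
Qed.

End minimal_vector.

Hypothesis roelckeG : roelcke_precompact G.

(** The squared norm is the coefficient at [1], so under the constraint it ranges over a subset of
    the finite set [Phi]. *)
Lemma ex_minimal_vector (Phi : set R) (f : E) :
  finite_set Phi -> P f -> 0 < sq f -> (forall g, Phi (dot (K g f) f)) ->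
  exists eta, [/\ P eta, 0 < sq eta, (forall g, Phi (dot (K g eta) eta)) &
    forall zeta, P zeta -> 0 < sq zeta ->
      (forall g, Phi (dot (K g zeta) zeta)) -> sq eta <= sq zeta].
Proof.
move=> finPhi Pf f0 fPhi.
pose S := [set x | [/\ P x, 0 < sq x & forall g, Phi (dot (K g x) x)]].
have finS : finite_set [set sq x | x in S].
  apply: sub_finite_set finPhi => _ [x [_ _ xPhi] <-].
  by rewrite -dotK1.
have [|_ [eta [Peta eta0 etaPhi] <-] etamin] := finite_set_min finS.
  by exists (sq f), f.
by exists eta; split => // z Pz z0 zPhi; apply: etamin; exists z.
Qed.

Lemma stabilizer_group x :
  exists V : groupClosed G, [set` V] = [set g | dot (K g x) x = sq x].
Proof.
have eqv g : dot (K g x) x = sq x <-> sq (K g x - x) = 0.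
  by rewrite sqB Kdot; split; lra.
apply: group_closed_of_set => /=.
- by rewrite dotK1.
- by move=> g h gx /eqv hx; rewrite dotKM dotKV (eqv_dot _ hx) -dotKV.
- by move=> g gx; rewrite dotC -dotKV.
Qed.

(** As [sq (K g x - x) = 2 (sq x - <K g x, x>)], the orbit of [x] has a gap at [x]: a translate
    closer than the least positive value equals [x] up to a null vector. *)
Lemma stabilizer_open (Phi : set R) x (V : groupClosed G) :
  finite_set Phi -> (forall g, Phi (dot (K g x) x)) ->
  [set` V] = [set g | dot (K g x) x = sq x] -> open [set` V].
Proof.
move=> finPhi xPhi VE; apply: open_subgroup.
(* The element [1] keeps this set nonempty when no element of [Phi] is below [sq x]. *)
pose gaps := [set 2 * (sq x - p) | p in [set p | Phi p /\ p < sq x]] `|` [set 1].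
have fing : finite_set gaps.
  rewrite finite_setU; split; last exact: finite_set1.
  by apply: finite_image; apply: sub_finite_set finPhi => p [].
have [|e ge emin] := finite_set_min fing; first by exists 1; right.
have e0 : 0 < e by case: ge => [[p [_ px] <-]|->//]; rewrite mulr_gt0// subr_gt0.
apply: filterS (Kcont x e0) => g /=; rewrite sqB Kdot => ge'.
suff : [set` V] g by [].
rewrite VE /=; apply/eqP; rewrite eq_le; apply/andP; split.
  by have := sqB_ge0 (K g x) x; rewrite Kdot; lra.
rewrite leNgt; apply/negP => gx.
have : e <= 2 * (sq x - dot (K g x) x).
  by apply: emin; left; exists (dot (K g x) x) => //; split.
lra.
Qed.

Theorem ex_self_commensurating_vector (Phi : set R) (f : E) :
  finite_set Phi -> P f -> 0 < sq f -> (forall g, Phi (dot (K g f) f)) ->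
  exists (W : groupClosed G) zeta,
    [/\ open [set` W], self_commensurating [set` W], P zeta /\ 0 < sq zeta,
      forall g, g \in W -> sq (K g zeta - zeta) = 0 &
      forall g, g \notin W -> dot (K g zeta) zeta = 0].
Proof.
move=> finPhi Pf f0 fPhi.
have [eta [Peta eta0 etaPhi eta_min]] := ex_minimal_vector finPhi Pf f0 fPhi.
have [V VE] := stabilizer_group eta.
have Vo := stabilizer_open finPhi etaPhi VE.
have orth := infinite_orbit_orthogonal finPhi Peta etaPhi eta_min VE.
have [W WE] := commensurator_group roelckeG Vo.
have WP g : (g \in W) <-> finite_orbit V g.
  by have -> : is_true (g \in W) = [set g | finite_orbit V g] g by rewrite -WE.
have VW g : g \in V -> g \in W by move=> gV; apply/WP; exact: finite_orbit1.
pose ps (c c' : cosets V) := dot (K (repr c) eta) (K (repr c') eta).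
have ps_ge0 c c' : 0 <= ps c c' by apply: P_dot; exact: PK.
have [s0 Es0] := (finite_seqP _).1 (finite_finite_orbit roelckeG Vo).
pose s := undup s0.
have sP c : (c \in s) = (repr c \in W).
  have cs : (c \in s0) <-> [set lcoset V g | g in [set g | finite_orbit V g]] c.
    by rewrite Es0.
  rewrite mem_undup; apply/idP/idP => [/cs [g /WP gW <-]|cW].
    by have [v vV ->] := repr_lcoset V g; rewrite gpredM// VW.
  by apply/cs; exists (repr c); [exact/WP|exact: lcoset_repr].
pose zeta := \sum_(c <- s) K (repr c) eta.
have Kz g z : dot (K g zeta) z = \sum_(c <- s) dot (K (g * repr c)%g eta) z.
  rewrite dotKV /zeta dot_suml; apply: eq_bigr => c _.
  by rewrite dotKM [RHS]dotKV.
have zz z : dot z zeta = \sum_(c <- s) dot z (K (repr c) eta).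
  by rewrite dotC /zeta dot_suml; apply: eq_bigr => c _; rewrite dotC.
have reprK g h z : lcoset V g = lcoset V h -> dot (K g eta) z = dot (K h eta) z.
  move=> /lcosetP ghV.
  have -> : dot (K h eta) z = dot (K g (K (g^-1 * h)%g eta)) z.
    by rewrite -dotKM mulVKg.
  rewrite [LHS]dotKV [RHS]dotKV.
  have : [set` V] (g^-1 * h)%g by []. rewrite VE /= => e.
  by apply/esym/eqv_dot; rewrite sqB Kdot e; ring.
exists W, zeta; split.
- apply: open_subgroup; apply: filterS (subgroup_nbhs Vo) => v /=; exact: VW.
- by rewrite WE; exact: self_commensurating_commensurator.
- split.
    by rewrite /zeta; apply: big_ind => [|x y|c _]; [exact: P0|exact: PD|exact: PK].
  (* The summand at the coset [V] contributes [sq eta > 0], and all cross terms are nonnegative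
     since the summands lie in the cone. *)
  have V1s : lcoset V 1%g \in s.
    have [v vV] := repr_lcoset V 1%g; rewrite mul1g sP => ->; exact: VW.
  rewrite {1}/zeta dot_suml (big_rem _ V1s)/= zz (big_rem _ V1s)/= Kdot.
  rewrite -addrA ltr_pwDl// addr_ge0// sumr_ge0// => c _; first exact: ps_ge0.
  by rewrite zz sumr_ge0// => c' _; exact: ps_ge0.
- move=> g gW; rewrite sqB Kdot.
  suff -> : dot (K g zeta) zeta = sq zeta by ring.
  rewrite Kz [RHS]dot_suml.
  (* For [g] in [W], left multiplication by [g] permutes [W / V], hence the terms of the sum. *)
  pose gs (c : cosets V) := lcoset V (g * repr c)%g.
  have gsE (c : cosets V) : dot (K (g * repr c)%g eta) zeta = dot (K (repr (gs c)) eta) zeta.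
    by apply: reprK; rewrite lcoset_repr.
  under eq_bigr do rewrite gsE.
  rewrite -(big_map gs xpredT (fun c : cosets V => dot (K (repr c) eta) zeta)).
  apply: perm_big; apply: uniq_perm; rewrite ?undup_uniq//.
    rewrite map_inj_in_uniq ?undup_uniq// => c d _ _ /lcosetP.
    by rewrite invgM -mulgA mulKg => /lcosetP; rewrite !lcoset_repr.
  have [|||_ //] := @uniq_min_size _ (map gs s) s.
  + rewrite map_inj_in_uniq ?undup_uniq// => c d _ _ /lcosetP.
    by rewrite invgM -mulgA mulKg => /lcosetP; rewrite !lcoset_repr.
  + move=> _ /mapP [c cs ->]; rewrite sP /gs.
    have [v vV ->] := repr_lcoset V (g * repr c)%g.
    rewrite sP in cs; apply: gpredM; [exact: gpredM|exact: VW].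
  + by rewrite size_map.
- move=> g gW; rewrite Kz big_seq big1// => c cs; rewrite zz big_seq big1// => c' c's.
  (* With [c] and [c'] in [W / V] and [g] outside [W], the element [(repr c')^-1 g (repr c)] is
     outside [W], so each term vanishes by [orth]. *)
  have -> : dot (K (g * repr c)%g eta) (K (repr c') eta) =
      dot (K ((repr c')^-1 * (g * repr c))%g eta) eta.
    by rewrite [RHS]dotKM [RHS]dotKV invgK.
  apply: orth => /WP; move: cs c's; rewrite !sP => cW c'W.
  by rewrite gpredMl ?gpredVr// gpredMr//; exact/negP.
Qed.

End isometric_action.

(** * Measure algebras and sigma-homomorphisms *)


Lemma measurable_preimage d d' (T : measurableType d) (X : measurableType d')
    (f : T -> X) B :
  measurable_fun setT f -> measurable B -> measurable (f @^-1` B).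
Proof. by move=> mf mB; rewrite -[_ @^-1` _]setTI; exact: mf. Qed.

Section malg_theory.
Context d (T : measurableType d) (R : realType).
Variable mu : {measure set T -> \bar R}.
Implicit Types (A B : set T) (a b : malg mu).

Let valE A : measurable A -> val (insubd (mset0 T) A) = A.
Proof. by move=> mA; rewrite val_insubd mem_set. Qed.

Lemma malg_classP A B : measurable A -> measurable B ->
  malg_class mu A = malg_class mu B <-> mu (A `+` B) = 0%E.
Proof.
move=> mA mB; rewrite /malg_class; split.
  by move=> /eqmodP /asboolP; rewrite !valE.
by move=> AB; apply/eqmodP/asboolP; rewrite !valE.
Qed.

Lemma measurable_malg_repr a : measurable (malg_repr a).
Proof. by have := valP (repr a); rewrite inE. Qed.
Hint Resolve measurable_malg_repr : core.

Lemma malg_reprK a : malg_class mu (malg_repr a) = a.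
Proof. by rewrite /malg_class /malg_repr valKd reprK. Qed.

Lemma mu_malg_repr A : measurable A ->
  mu (malg_repr (malg_class mu A) `+` A) = 0%E.
Proof. by move=> mA; apply/malg_classP => //; exact: malg_reprK. Qed.

Let msetE A (mA : measurable A) : malg_class mu A = (\pi_(malg mu) (mset_of mA))%qT.
Proof.
by rewrite /malg_class; congr (\pi_(_) _)%qT; apply: val_inj => /=; exact: valE.
Qed.

Lemma malg_classI A B : measurable A -> measurable B ->
  malg_class mu (A `&` B) = (malg_class mu A `&` malg_class mu B)%O.
Proof.
move=> mA mB; rewrite (msetE mA) (msetE mB) (msetE (measurableI _ _ mA mB)).
rewrite -[RHS]/(malg_meet _ _) malg_meetE; congr (\pi_(_) _)%qT.
by apply: val_inj.
Qed.

Lemma malg_classU A B : measurable A -> measurable B ->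
  malg_class mu (A `|` B) = (malg_class mu A `|` malg_class mu B)%O.
Proof.
move=> mA mB; rewrite (msetE mA) (msetE mB) (msetE (measurableU _ _ mA mB)).
rewrite -[RHS]/(malg_join _ _) malg_joinE; congr (\pi_(_) _)%qT.
by apply: val_inj.
Qed.

Lemma malg_class0 : malg_class mu set0 = \bot%O.
Proof.
rewrite (msetE measurable0) -[RHS]/(malg_bot mu); congr (\pi_(_) _)%qT.
Qed.

Lemma malg_classT : malg_class mu setT = \top%O.
Proof.
rewrite (msetE measurableT) -[RHS]/(malg_top mu); congr (\pi_(_) _)%qT.
Qed.

Lemma malg_classC A : measurable A ->
  malg_class mu (~` A) = (~` malg_class mu A)%O.
Proof.
move=> mA; have mCA := measurableC mA.
set a := malg_class mu A; set c := malg_class mu (~` A).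
have ac0 : (c `&` a)%O = \bot%O.
  by rewrite -malg_classI// setICl malg_class0.
have ac1 : (a `|` c)%O = \top%O.
  by rewrite -malg_classU// setUv malg_classT.
apply/eqP; rewrite eq_le -disj_leC ac0 eqxx /=.
by rewrite -[X in (X <= _)%O]meetx1 -ac1 meetUr meetCx join0x leIr.
Qed.

Lemma malg_class_eq0 A : measurable A -> malg_class mu A = \bot%O <-> mu A = 0%E.
Proof. by move=> mA; rewrite -malg_class0 malg_classP// setY0. Qed.

Lemma malg_class_le A B : measurable A -> measurable B ->
  (malg_class mu A <= malg_class mu B)%O <-> mu (A `\` B) = 0%E.
Proof.
move=> mA mB; have mAB : measurable (A `\` B) by exact: measurableD.
rewrite -[in X in X <-> _](complK (malg_class mu B)) -disj_leC -malg_classC//.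
rewrite -malg_classI//; last exact: measurableC.
by rewrite -setDE; split => [/eqP/malg_class_eq0|/malg_class_eq0 ->//]; exact.
Qed.

Lemma mu_eq_class A B : measurable A -> measurable B ->
  malg_class mu A = malg_class mu B -> mu A = mu B.
Proof.
move=> mA mB /malg_classP => /(_ mA mB) AB0.
have mAB : measurable (A `\` B) by exact: measurableD.
have mBA : measurable (B `\` A) by exact: measurableD.
have mAIB : measurable (A `&` B) by exact: measurableI.
have AB : mu (A `\` B) = 0%E.
  apply/eqP; rewrite eq_le measure_ge0 andbT -AB0 le_measure ?inE//.
    by apply: measurableU.
  exact: subsetUl.
have BA : mu (B `\` A) = 0%E.
  apply/eqP; rewrite eq_le measure_ge0 andbT -AB0 le_measure ?inE//.
    by apply: measurableU.
  exact: subsetUr.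
have -> : mu A = (mu (A `\` B) + mu (A `&` B))%E by exact: measureDI.
have -> : mu B = (mu (B `\` A) + mu (B `&` A))%E by exact: measureDI.
by rewrite AB BA (setIC B).
Qed.

Lemma malg_measure_class A : measurable A -> malg_measure (malg_class mu A) = mu A.
Proof. by move=> mA; apply: mu_eq_class => //; rewrite malg_reprK. Qed.

Lemma malg_classDP A B : measurable A -> measurable B ->
  malg_class mu A = malg_class mu B <->
  mu (A `\` B) = 0%E /\ mu (B `\` A) = 0%E.
Proof.
move=> mA mB; rewrite -!malg_class_le//; split => [->|[AB BA]]; first by rewrite !lexx.
by apply/eqP; rewrite eq_le AB BA.
Qed.

Lemma malg_class_bigcup_le (A : (set T)^nat) b : (forall n, measurable (A n)) ->
  (forall n, (malg_class mu (A n) <= b)%O) ->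
  (malg_class mu (\bigcup_n A n) <= b)%O.
Proof.
move=> mA Ab; rewrite -(malg_reprK b); apply/malg_class_le => //.
  exact: bigcup_measurable.
rewrite setDE setI_bigcupl; apply/negligibleP.
  apply: bigcup_measurable => n _; apply: measurableI => //; exact: measurableC.
apply: negligible_bigcup => n; apply/negligibleP.
  by apply: measurableI => //; exact: measurableC.
by rewrite -setDE; apply/malg_class_le => //; rewrite malg_reprK.
Qed.

Lemma malg_class_le_bigcup (A : (set T)^nat) n : (forall n, measurable (A n)) ->
  (malg_class mu (A n) <= malg_class mu (\bigcup_n A n))%O.
Proof.
move=> mA; apply/malg_class_le => //; first exact: bigcup_measurable.
by rewrite (_ : _ `\` _ = set0) ?measure0// setD_eq0; exact: bigcup_sup.
Qed.

End malg_theory.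
#[global] Hint Resolve measurable_malg_repr : core.

Section sigma_morphism.
Context d1 d2 (T1 : measurableType d1) (T2 : measurableType d2) (R : realType).
Variables (mu : {measure set T1 -> \bar R}) (nu : {measure set T2 -> \bar R}).

(** Countable joins are written through unions of representatives, whose class does not depend on
    the choice made. The notion covers quotient maps, such as the restriction to a subset, as well
    as automorphisms. *)
Record sigma_morphism (F : malg mu -> malg nu) := SigmaMorphism {
  sigma_morphismC : forall a, F (~` a)%O = (~` F a)%O ;
  sigma_morphism_bigcup : forall A : (set T1)^nat, (forall n, measurable (A n)) ->
    F (malg_class mu (\bigcup_n A n)) =
    malg_class nu (\bigcup_n malg_repr (F (malg_class mu (A n)))) }.

(** A Boolean isomorphism preserves and reflects the order, and the class of a countable union is
    the least upper bound of the classes, which the order determines. *)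
Lemma boolean_iso_sigma_morphism F : boolean_iso F -> sigma_morphism F.
Proof.
move=> [[F' FK F'K] FI FU FC]; split => // A mA.
have Fle a b : (F a <= F b)%O = (a <= b)%O.
  by rewrite !leEmeet -FI; apply/eqP/eqP => [/(can_inj FK)|->].
have mR n : measurable (malg_repr (F (malg_class mu (A n)))) by [].
apply/eqP; rewrite eq_le; apply/andP; split.
  rewrite -(F'K (malg_class nu _)) Fle; apply: malg_class_bigcup_le => // n.
  rewrite -Fle F'K -[X in (X <= _)%O]malg_reprK.
  exact: (malg_class_le_bigcup _ n).
apply: malg_class_bigcup_le => // n; rewrite malg_reprK Fle.
exact: malg_class_le_bigcup.
Qed.

Section theory.
Variable F : malg mu -> malg nu.
Hypothesis sF : sigma_morphism F.

Lemma sigma_morphismU a b : F (a `|` b)%O = (F a `|` F b)%O.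
Proof.
rewrite -(malg_reprK a) -(malg_reprK b) -malg_classU//.
pose A n := if n is 0%N then malg_repr a else malg_repr b.
have bigA (T : Type) (B C : set T) : B `|` C = \bigcup_n (if n is 0%N then B else C).
  apply/seteqP; split => [x [Bx|Cx]|x [[|n] _]].
  - by exists 0%N.
  - by exists 1%N.
  - by left.
  - by right.
rewrite bigA (sigma_morphism_bigcup sF); last by case.
rewrite -[F (malg_class mu (malg_repr a))]malg_reprK.
rewrite -[F (malg_class mu (malg_repr b))]malg_reprK -malg_classU// bigA.
by congr malg_class; apply: eq_bigcupr => -[|n] _.
Qed.

Lemma sigma_morphismI a b : F (a `&` b)%O = (F a `&` F b)%O.
Proof.
by apply: compl_inj; rewrite complI -!(sigma_morphismC sF) complI sigma_morphismU.
Qed.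

Lemma sigma_morphism_le a b : (a <= b)%O -> (F a <= F b)%O.
Proof. by rewrite !leEmeet -sigma_morphismI => /eqP ->. Qed.

Lemma sigma_morphism0 : F \bot%O = \bot%O.
Proof.
have : (F \bot%O <= ~` F \bot%O)%O.
  by rewrite -(sigma_morphismC sF) sigma_morphism_le// le0x.
by rewrite -disj_leC meetxx => /eqP.
Qed.

Lemma sigma_morphism1 : F \top%O = \top%O.
Proof.
by apply: compl_inj; rewrite -(sigma_morphismC sF) !compl1; exact: sigma_morphism0.
Qed.

End theory.
End sigma_morphism.

Lemma aut_sigma_morphism d (T : measurableType d) (R : realType)
  (mu : {measure set T -> \bar R}) (g : aut_star mu) : sigma_morphism g.
Proof. exact: boolean_iso_sigma_morphism (aut_funP g). Qed.

Section translation.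
Context d (T : measurableType d) (R : realType).
Variable mu : {measure set T -> \bar R}.
Implicit Types (g : aut_star mu).

(* Plays the role of [h = f \o g^-1]: [g] need not be induced by a point map. *)
Definition translates_to d' (X : measurableType d') g (f h : T -> X) :=
  measurable_fun setT h /\ forall B, measurable B ->
    malg_class mu (h @^-1` B) = g (malg_class mu (f @^-1` B)).

(** Allows the identity defining [translates_to] to be checked on a generating family: rectangles
    for pairs, half-lines for real functions. *)
Lemma translates_sigma_algebra d' (X : measurableType d') g (f h : T -> X) :
  measurable_fun setT f -> measurable_fun setT h ->
  sigma_algebra setT [set B | measurable B /\
    malg_class mu (h @^-1` B) = g (malg_class mu (f @^-1` B))].
Proof.
move=> mf mh; have sg := aut_sigma_morphism g; split.
- by split => //; rewrite !preimage_set0 malg_class0 (sigma_morphism0 sg).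
- move=> B [mB hB]; rewrite setTD; split; first exact: measurableC.
  have mfB := measurable_preimage mf mB; have mhB := measurable_preimage mh mB.
  rewrite -[h @^-1` _]/(~` (h @^-1` B)) -[f @^-1` _]/(~` (f @^-1` B)).
  have -> := malg_classC mu mfB.
  have -> := malg_classC mu mhB.
  by rewrite hB (sigma_morphismC sg).
- move=> B BP; have mB n : measurable (B n) := (BP n).1.
  have hB n := (BP n).2; split; first exact: bigcup_measurable.
  rewrite !preimage_bigcup (sigma_morphism_bigcup sg); last first.
    by move=> n; exact: measurable_preimage.
  apply/eqP; rewrite eq_le; apply/andP; split; apply: malg_class_bigcup_le => //.
  + by move=> n; exact: measurable_preimage.
  + move=> n; rewrite hB -[X in (X <= _)%O]malg_reprK.
    exact: (@malg_class_le_bigcup _ _ _ mu (fun n => malg_repr (g (malg_class mu (f @^-1` B n))))).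
  + move=> n; rewrite malg_reprK -hB.
    apply: (@malg_class_le_bigcup _ _ _ mu (fun n => h @^-1` B n)) => k.
    exact: measurable_preimage.
Qed.

(** This replaces a point map: with [translates_to_comp], it shows that translation commutes with
    measurable operations on two functions and transports almost everywhere relations between
    them. *)
Lemma translates_to_pair d1 d2 (X1 : measurableType d1) (X2 : measurableType d2)
    g (f1 h1 : T -> X1) (f2 h2 : T -> X2) :
  measurable_fun setT f1 -> measurable_fun setT f2 ->
  translates_to g f1 h1 -> translates_to g f2 h2 ->
  translates_to g (fun x => (f1 x, f2 x)) (fun x => (h1 x, h2 x)).
Proof.
move=> mf1 mf2 [mh1 h1E] [mh2 h2E]; have sg := aut_sigma_morphism g.
have mf : measurable_fun setT (fun x => (f1 x, f2 x)) by apply/measurable_fun_pairP; split.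
have mh : measurable_fun setT (fun x => (h1 x, h2 x)) by apply/measurable_fun_pairP; split.
split => // B mB.
have := translates_sigma_algebra g mf mh => /smallest_sub.
move=> /(_ [set A1 `*` A2 | A1 in measurable & A2 in measurable]).
rewrite measurable_prod_measurableType in mB.
move=> /(_ _ _ mB) [] //.
move=> _ [A1 mA1 [A2 mA2 <-]]; split; first exact: measurableX.
have preX (k1 : T -> X1) (k2 : T -> X2) :
  (fun x => (k1 x, k2 x)) @^-1` (A1 `*` A2) = k1 @^-1` A1 `&` k2 @^-1` A2 by [].
have mp1 (k : T -> X1) : measurable_fun setT k -> measurable (k @^-1` A1).
  by move=> mk; exact: measurable_preimage.
have mp2 (k : T -> X2) : measurable_fun setT k -> measurable (k @^-1` A2).
  by move=> mk; exact: measurable_preimage.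
rewrite !preX (malg_classI _ (mp1 _ mf1) (mp2 _ mf2)).
by rewrite (malg_classI _ (mp1 _ mh1) (mp2 _ mh2)) (sigma_morphismI sg) h1E ?h2E.
Qed.

Lemma translates_to_comp d1 d2 (X1 : measurableType d1) (X2 : measurableType d2)
    g (f h : T -> X1) (phi : X1 -> X2) : measurable_fun setT phi ->
  translates_to g f h -> translates_to g (phi \o f) (phi \o h).
Proof.
move=> mphi [mh hE]; split; first exact: measurableT_comp.
by move=> B mB; exact: (hE _ (measurable_preimage mphi mB)).
Qed.

End translation.

(** * Translation of functions *)


Lemma malg_class0_ae d (T : measurableType d) (R : realType)
    (mu : {measure set T -> \bar R}) A : measurable A ->
  malg_class mu A = \bot%O <-> {ae mu, forall x, ~ A x}.
Proof.
move=> mA; split.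
  move/(malg_class_eq0 _ mA) => A0; exists A; split => // x /=.
  by move/contrapT.
move=> nA; apply/malg_class_eq0 => //; apply/negligibleP => //.
by apply: negligibleS nA => x /= Ax; exact.
Qed.

Section translation.
Context d (T : measurableType d) (R : realType).
Variable mu : {measure set T -> \bar R}.
Implicit Types (g : aut_star mu) (f h : T -> R).

Lemma translates_to_ae d' (X : measurableType d') g (f h : T -> X) (B : set X) :
  measurable_fun setT f -> measurable B -> translates_to g f h ->
  {ae mu, forall x, ~ B (f x)} -> {ae mu, forall x, ~ B (h x)}.
Proof.
move=> mf mB [mh hE] fB; apply/(malg_class0_ae _ (measurable_preimage mh mB)).
rewrite hE//; have /(malg_class0_ae _ (measurable_preimage mf mB)) -> := fB.
exact: (sigma_morphism0 (aut_sigma_morphism g)).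
Qed.

Let D : set (R * R) := [set p | p.1 != p.2].
Let mD : measurable D.
Proof.
rewrite (_ : D = (fun p : R * R => p.1 - p.2) @^-1` [set~ 0]).
  by apply: measurable_preimage; [exact: measurable_funB|exact: measurableC].
apply/seteqP; split => p; rewrite /D /=.
  by move=> /negP + /eqP; rewrite subr_eq0.
by move=> n; apply/negP; rewrite -subr_eq0 => /eqP.
Qed.

(* As translations are compatible with pairing, they transport the almost
   everywhere relation [f1 = f2]. *)
Lemma translates_to_unique g f1 f2 h1 h2 :
  measurable_fun setT f1 -> measurable_fun setT f2 ->
  {ae mu, forall x, f1 x = f2 x} ->
  translates_to g f1 h1 -> translates_to g f2 h2 -> {ae mu, forall x, h1 x = h2 x}.
Proof.
move=> mf1 mf2 f12 t1 t2.
have mf : measurable_fun setT (fun x => (f1 x, f2 x)) by apply/measurable_fun_pairP; split.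
have := translates_to_ae mf mD (translates_to_pair mf1 mf2 t1 t2).
move=> H; have {}H := H _; apply: filterS (H _) => [x /negP|].
  by rewrite negbK => /eqP.
by apply: filterS f12 => x ->; rewrite /D /= eqxx.
Qed.

Lemma translates_to_ge0 g f h : measurable_fun setT f -> translates_to g f h ->
  {ae mu, forall x, 0 <= f x} -> {ae mu, forall x, 0 <= h x}.
Proof.
move=> mf fh f0.
have := @translates_to_ae _ _ g f h (`]-oo, 0[)%classic mf (measurable_itv _) fh.
move=> H; apply: filterS (H _) => [x|].
  by move=> /negP; rewrite in_itv/= -leNgt.
by apply: filterS f0 => x fx; apply/negP; rewrite in_itv/= -leNgt.
Qed.

Lemma translates_to1 f : measurable_fun setT f -> translates_to (1%g : aut_star mu) f f.
Proof. by move=> mf; split. Qed.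

Lemma translates_toM g g' f h k : measurable_fun setT h ->
  translates_to g f h -> translates_to g' h k -> translates_to (g' * g)%g f k.
Proof. by move=> mh [_ hE] [mk kE]; split => // B mB; rewrite kE// hE. Qed.

Lemma translates_to_indic g A : measurable A ->
  translates_to g (\1_A : T -> R) \1_(malg_repr (g (malg_class mu A))).
Proof.
move=> mA; have sg := aut_sigma_morphism g; set A' := malg_repr _.
have mA' : measurable A' by exact: measurable_malg_repr.
split; first exact: measurable_indic.
move=> B mB; rewrite !preimage_indic.
case: ifPn => _; case: ifPn => _.
- by rewrite malg_classT (sigma_morphism1 sg).
- by rewrite malg_reprK.
- have -> := malg_classC mu mA; have -> := malg_classC mu mA'.
  by rewrite malg_reprK (sigma_morphismC sg).
- by rewrite malg_class0 (sigma_morphism0 sg).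
Qed.

End translation.


Lemma malg_class_bigcup_eq d (T : measurableType d) (R : realType)
    (mu : {measure set T -> \bar R}) (C D : (set T)^nat) :
  (forall n, measurable (C n)) -> (forall n, measurable (D n)) ->
  (forall n, malg_class mu (C n) = malg_class mu (D n)) ->
  malg_class mu (\bigcup_n C n) = malg_class mu (\bigcup_n D n).
Proof.
move=> mC mD CD; apply/eqP; rewrite eq_le.
apply/andP; split; apply: malg_class_bigcup_le => // n.
  by rewrite CD; exact: malg_class_le_bigcup.
by rewrite -CD; exact: malg_class_le_bigcup.
Qed.

Lemma sigma_morphism_bigcupE d1 d2 (T1 : measurableType d1) (T2 : measurableType d2)
    (R : realType) (mu : {measure set T1 -> \bar R}) (nu : {measure set T2 -> \bar R})
    (F : malg mu -> malg nu) (A : (set T1)^nat) (C : (set T2)^nat) :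
  sigma_morphism F -> (forall n, measurable (A n)) -> (forall n, measurable (C n)) ->
  (forall n, malg_class nu (C n) = F (malg_class mu (A n))) ->
  F (malg_class mu (\bigcup_n A n)) = malg_class nu (\bigcup_n C n).
Proof.
move=> sF mA mC CA; rewrite (sigma_morphism_bigcup sF)//.
by apply: malg_class_bigcup_eq => // n; rewrite malg_reprK CA.
Qed.

Section existence.
Context d (T : measurableType d) (R : realType).
Variables (mu : {measure set T -> \bar R}) (g : aut_star mu) (f : T -> R).
Hypothesis mf : measurable_fun setT f.

(* Off the null set [N], the sets [B n] (the images of the [f > q n]) are nested
   like the rationals [q n] and determine a real-valued function. *)
Let q n : R := ratr (odflt 0 (unpickle n : option rat)).
Let A n := f @^-1` `]q n, +oo[%classic.
Let B n := malg_repr (g (malg_class mu (A n))).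
Let C n m := if q m < q n then B n `\` B m else set0.
Let N := (\bigcup_n \bigcup_m C n m) `|` (~` (\bigcup_n B n) `|` ~` (\bigcup_n ~` B n)).

Let sg := aut_sigma_morphism g.

Let qdense a b : a < b -> exists n, a < q n < b.
Proof.
by move=> /rat_in_itvoo[r]; rewrite in_itv/= => rab; exists (pickle r); rewrite /q pickleK.
Qed.

Let mA n : measurable (A n).
Proof. exact: measurable_preimage. Qed.

Let mB n : measurable (B n).
Proof. exact: measurable_malg_repr. Qed.

Let BA n : malg_class mu (B n) = g (malg_class mu (A n)).
Proof. exact: malg_reprK. Qed.

Let mC n m : measurable (C n m).
Proof. by rewrite /C; case: ifP => // _; exact: measurableD. Qed.

Let mN : measurable N.
Proof.
apply: measurableU.
  by apply: bigcup_measurable => n _; apply: bigcup_measurable => m _; exact: mC.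
apply: measurableU; apply: measurableC; apply: bigcup_measurable => n _ //.
exact: measurableC.
Qed.

Let N0 : mu.-negligible N.
Proof.
apply: negligibleU; last apply: negligibleU.
- apply: negligible_bigcup => n; apply: negligible_bigcup => m; rewrite /C.
  case: ifPn => qmn; last exact: negligible_set0.
  apply/negligibleP; first exact: measurableD.
  apply/malg_class_le => //; rewrite !BA; apply: sigma_morphism_le => //.
  apply/malg_class_le => //; rewrite (_ : _ `\` _ = set0) ?measure0// setD_eq0 /A.
  by move=> x /=; rewrite !in_itv/= !andbT; exact: lt_trans.
- apply/negligibleP; first by apply: measurableC; exact: bigcup_measurable.
  apply/malg_class_eq0; first by apply: measurableC; exact: bigcup_measurable.
  have mUB : measurable (\bigcup_n B n) by exact: bigcup_measurable.
  have -> := malg_classC mu mUB.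
  rewrite -(sigma_morphism_bigcupE sg mA mB BA) (_ : \bigcup_n A n = setT).
    by rewrite malg_classT (sigma_morphism1 sg) compl1.
  apply/seteqP; split => // x _.
  have [|m /andP[_ qm]] := @qdense (f x - 1) (f x); first by rewrite ltrBlDr ltrDl.
  by exists m => //; rewrite /A /= in_itv/= qm.
- have mCB n : measurable (~` B n) by exact: measurableC.
  have mCA n : measurable (~` A n) by exact: measurableC.
  have mUB : measurable (\bigcup_n ~` B n) by exact: bigcup_measurable.
  apply/negligibleP; first exact: measurableC.
  apply/malg_class_eq0; first exact: measurableC.
  have -> := malg_classC mu mUB.
  rewrite -(sigma_morphism_bigcupE sg mCA mCB); last first.
    move=> n; have -> := malg_classC mu (mA n); have -> := malg_classC mu (mB n).
    by rewrite BA (sigma_morphismC sg).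
  rewrite (_ : \bigcup_n ~` A n = setT).
    by rewrite malg_classT (sigma_morphism1 sg) compl1.
  apply/seteqP; split => // x _.
  have [|m /andP[qm _]] := @qdense (f x) (f x + 1); first by rewrite ltrDl.
  exists m => //=; rewrite /A /= in_itv/= andbT; apply/negP.
  by rewrite -leNgt ltW.
Qed.

Let h x := if x \in N then 0 else sup [set q n | n in [set n | B n x]].

Let hP x c : ~ N x -> c < h x <-> exists2 n, c < q n & B n x.
Proof.
move=> nN; rewrite /h memNset//; set S := [set _ | _ in _].
have NBm n m : B n x -> q m < q n -> B m x.
  move=> Bn qmn; apply: contrapT => nBm; apply: nN; left.
  by exists n => //; exists m => //; rewrite /C qmn.
have [n0 Bn0] : exists n, B n x.
  apply: contrapT => nB; apply: nN; right; left => -[n _ Bn].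
  by apply: nB; exists n.
have [n1 nBn1] : exists n, ~ B n x.
  apply: contrapT => nB; apply: nN; right; right => -[n _ Bn].
  by apply: nB; exists n.
have supS : has_sup S.
  split; first by exists (q n0), n0.
  exists (q n1) => _ [n Bn <-]; rewrite leNgt; apply/negP => qn.
  exact: nBn1 (NBm _ _ Bn qn).
split=> [cS|[n cn Bn]]; last first.
  by apply: lt_le_trans cn _; apply: ub_le_sup; [exact: supS.2|exists n].
have d0 : 0 < sup S - c by rewrite subr_gt0.
have [_ [n Bn <-]] := sup_adherent d0 supS.
by rewrite subKr => cn; exists n.
Qed.

Let E c n := if c < q n then B n else set0.

Let hE c : h @^-1` `]c, +oo[%classic =
  (\bigcup_n E c n `&` ~` N) `|` (if c < 0 then N else set0).
Proof.
apply/seteqP; split => x /=; rewrite in_itv/= andbT.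
  have [Nx|nN] := pselect (N x); first by rewrite /h mem_set// => ->; right.
  move=> /(hP _ nN) [n cn Bn]; left; split => //.
  by exists n => //; rewrite /E cn.
case.
  move=> [[n _ En] nN]; apply/(hP _ nN); exists n; move: En; rewrite /E; by case: ifP.
by case: ifPn => // c0 Nx; rewrite /h mem_set.
Qed.

Let mE c n : measurable (E c n).
Proof. by rewrite /E; case: ifP. Qed.

Let mUE c : measurable (\bigcup_n E c n `&` ~` N).
Proof.
by apply: measurableI; [exact: bigcup_measurable|exact: measurableC].
Qed.

Let mh : measurable_fun setT h.
Proof.
apply: (measurability _ (RGenOInfty.measurableE R)) => _ [_ [c ->] <-].
rewrite setTI hE; apply: measurableU => //; by case: ifP.
Qed.

Lemma ex_translation : exists h, translates_to g f h.
Proof.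
exists h; split => //; have sA := translates_sigma_algebra g mf mh.
move=> D mD; have mD' : (@RGenOInfty.G R).-sigma.-measurable D.
  by rewrite -RGenOInfty.measurableE.
(* Half-lines generate the Borel sets. Off [N], the preimage of []c, +oo[] under [h] is the union of
   the [B n] with [q n > c], the image under [g] of the corresponding union for [f]. *)
suff : [set B : set R | measurable B /\
    malg_class mu (h @^-1` B) = g (malg_class mu (f @^-1` B))] D by case.
apply: (smallest_sub sA) mD' => _ [c ->]; split => //.
have -> : f @^-1` `]c, +oo[%classic = \bigcup_n (if c < q n then A n else set0).
  apply/seteqP; split => x /=; rewrite in_itv/= andbT.
    move=> /qdense [n /andP[cn nf]]; exists n => //.
    by rewrite cn /A /= in_itv/= nf.
  move=> [n _]; case: ifPn => // cn; rewrite /A /= in_itv/= andbT.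
  exact: lt_trans.
rewrite (sigma_morphism_bigcupE (C := E c) sg)//; last 2 first.
- by move=> n; case: ifP.
- move=> n; rewrite /E; case: ifP => // _.
  by rewrite !malg_class0 (sigma_morphism0 sg).
have mhc : measurable (h @^-1` `]c, +oo[%classic) by exact: measurable_preimage.
have mE' : measurable (\bigcup_n E c n) by exact: bigcup_measurable.
apply/malg_classP => //; apply/negligibleP.
  by apply: measurableU; exact: measurableD.
apply: negligibleS N0 => x; rewrite hE; case: ifPn => _; rewrite /setY/setD/setU/setI/setC /=;
  have := EM (N x); tauto.
Qed.

End existence.

Section translate.
Context d (T : measurableType d) (R : realType).
Variables (mu : {measure set T -> \bar R}) (g : aut_star mu) (f : T -> R).

Lemma translateP : measurable_fun setT f -> translates_to g f (translate g f).
Proof.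
by move=> /(ex_translation g) hP; rewrite /translate; exact: (xgetPex (cst 0) hP).
Qed.

Lemma measurable_translate : measurable_fun setT (translate g f).
Proof. by rewrite /translate; case: xgetP => // h _ []. Qed.

End translate.

(** * Densities *)


Section weighted_change_of_variables.
Context d1 d2 (T1 : measurableType d1) (T2 : measurableType d2) (R : realType).
Variables (mu : {measure set T1 -> \bar R}) (nu : {measure set T2 -> \bar R}).
Variables (h : T1 -> T2) (w : T1 -> R).
Hypotheses (mh : measurable_fun setT h) (mw : measurable_fun setT w).
Hypothesis w0 : forall x, 0 <= w x.
Hypothesis nuE : forall B, measurable B ->
  nu B = (\int[mu]_(x in h @^-1` B) (w x)%:E)%E.

Local Open Scope ereal_scope.
Import HBNNSimple.

(** For indicators this is [nuE]; linearity and monotone convergence along simple functions do the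
    rest. *)
Lemma ge0_integral_weighted_comp (phi : T2 -> \bar R) :
  measurable_fun setT phi -> (forall y, 0 <= phi y) ->
  \int[mu]_x (phi (h x) * (w x)%:E) = \int[nu]_y phi y.
Proof.
move=> mphi phi0; pose k := nnsfun_approx measurableT mphi.
have mew : measurable_fun setT (EFin \o w) by exact/measurable_EFinP.
have mkh n : measurable_fun setT (fun x => (k n (h x))%:E).
  by apply/measurable_EFinP; exact: measurableT_comp.
have -> : \int[nu]_y phi y = lim (\int[nu]_y (k n y)%:E @[n --> \oo]).
  have kphi y : phi y = lim ((EFin \o k n) y @[n --> \oo]).
    by apply/esym/cvg_lim => //; exact: cvg_nnsfun_approx.
  under eq_integral do rewrite kphi.
  apply: monotone_convergence => //.
  - by move=> n; exact/measurable_EFinP.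
  - by move=> n y _ /=; rewrite lee_fin.
  - by move=> y _ a b ab; rewrite lee_fin; exact/lefP/nd_nnsfun_approx.
have -> : \int[mu]_x (phi (h x) * (w x)%:E) =
    lim (\int[mu]_x ((k n (h x))%:E * (w x)%:E) @[n --> \oo]).
  have kphi x : phi (h x) * (w x)%:E =
      lim ((k n (h x))%:E * (w x)%:E @[n --> \oo]).
    apply/esym/cvg_lim => //; apply: cvgeZr => //.
    exact: (@cvg_nnsfun_approx _ _ _ _ measurableT _ mphi).
  under eq_integral do rewrite kphi.
  apply: monotone_convergence => //.
  - by move=> n; exact: emeasurable_funM.
  - by move=> n x _ /=; rewrite mule_ge0 ?lee_fin.
  - move=> x _ a b ab; rewrite lee_wpmul2r ?lee_fin//.
    exact/lefP/nd_nnsfun_approx.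
suff kE n : \int[mu]_x ((k n (h x))%:E * (w x)%:E) = \int[nu]_y (k n y)%:E.
  by under eq_fun do rewrite kE.
have indic0 r y : 0 <= (r * \1_(k n @^-1` [set r]) y)%:E.
  exact: nnfun_muleindic_ge0.
transitivity (\int[nu]_y
   (\sum_(r \in range (k n)) (r * \1_(k n @^-1` [set r]) y)%:E)); last first.
  by apply: eq_integral => t _; rewrite /= fimfunE -fsumEFin.
have mindic r : measurable_fun setT (fun y => (r * \1_(k n @^-1` [set r]) y)%:E).
  by apply/measurable_EFinP; exact: measurable_funM.
rewrite ge0_integral_fsum//.
transitivity (\int[mu]_x (\sum_(r \in range (k n))
    (r * \1_(k n @^-1` [set r]) (h x))%:E * (w x)%:E)).
  apply: eq_integral => x _.
  rewrite -ge0_mule_fsuml => [|r]; last exact: indic0.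
  by rewrite fsumEFin // -fimfunE.
have mindich r : measurable_fun setT
    (fun x => (r * \1_(k n @^-1` [set r]) (h x))%:E * (w x)%:E).
  by apply: emeasurable_funM => //; exact: (measurableT_comp (mindic r)).
rewrite ge0_integral_fsum//; last first.
  by move=> r x _; rewrite mule_ge0// lee_fin.
apply: eq_fsbigr => r; rewrite inE => -[t _ rE].
have r0 : (0 <= r)%R by rewrite -rE.
have mr : measurable (k n @^-1` [set r]) by exact: measurable_sfunP.
under [RHS]eq_integral do rewrite EFinM.
rewrite ge0_integralZl_EFin//; last exact/measurable_EFinP.
rewrite integral_indic// setIT nuE// -ge0_integralZl_EFin//; last 3 first.
- exact: measurable_preimage.
- by move=> x _; rewrite lee_fin.
- exact: measurable_funTS.
rewrite [RHS]integral_mkcond; apply: eq_integral => x _.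
rewrite EFinM -muleA patchE.
rewrite indicE; have [kr|nkr] := pselect (k n (h x) = r).
  by rewrite !mem_set// mul1e.
by rewrite !memNset// mul0e mule0.
Qed.

End weighted_change_of_variables.


Section pullback_measure.
Context d1 d2 (T1 : measurableType d1) (T2 : measurableType d2) (R : realType).
Variables (mu : {measure set T1 -> \bar R}) (nu : {measure set T2 -> \bar R}).
Variables (F : malg mu -> malg nu) (sF : sigma_morphism F).
Variables (b : set T2) (mb : measurable b).

Let im A := malg_repr (F (malg_class mu A)).

Let imE A : malg_class nu (im A) = F (malg_class mu A).
Proof. exact: malg_reprK. Qed.

Let mim A : measurable (im A).
Proof. exact: measurable_malg_repr. Qed.

(* The proofs are arguments so that they can be found by canonical inference. *)
Definition pullback_measure of sigma_morphism F & measurable b :=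
  fun A : set T1 => nu (malg_repr (F (malg_class mu A)) `&` b).

Local Notation pb := (pullback_measure sF mb).

Let pullback0 : pb set0 = 0%E.
Proof.
apply: subset_measure0 (_ : im set0 `&` b `<=` im set0) _ => //.
- exact: measurableI.
- apply/malg_class_eq0 => //.
  by rewrite imE malg_class0 (sigma_morphism0 sF).
Qed.

Let pullback_ge0 A : (0 <= pb A)%E.
Proof. exact: measure_ge0. Qed.

Let pullback_semi_sigma_additive : semi_sigma_additive pb.
Proof.
move=> A mA tA mUA; set C := fun n => im (A n).
have mC n : measurable (C n) by exact: mim.
(* Images of disjoint sets are disjoint only up to null sets; [seqDU C] makes them disjoint without
   changing their classes. *)
have mD n : measurable (seqDU C n).
  by apply: measurableD => //; exact: bigsetU_measurable.
have CC n k : (k < n)%N -> nu (C n `&` C k) = 0%E.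
  move=> kn; apply/malg_class_eq0; first exact: measurableI.
  have -> := malg_classI nu (mC n) (mC k).
  rewrite /C !imE -(sigma_morphismI sF); have <- := malg_classI mu (mA n) (mA k).
  have /trivIsetP/(_ n k I I) -> := tA; last by rewrite neq_ltn kn orbT.
  by rewrite malg_class0 (sigma_morphism0 sF).
have CD n : malg_class nu (seqDU C n) = malg_class nu (C n).
  apply/malg_classDP => //; split.
    by rewrite (_ : _ `\` _ = set0) ?measure0// setD_eq0; exact: subDsetl.
  have mCk k : measurable (if (k < n)%N then C n `&` C k else set0).
    by case: ifP => // _; exact: measurableI.
  apply/negligibleP; first exact: measurableD.
  apply: (@negligibleS _ _ _ _ (\bigcup_k (if (k < n)%N then C n `&` C k else set0))).
    move=> x [Cnx nD]; apply: contrapT => nU; apply: nD; split => //.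
    rewrite -bigcup_mkord => -[k /= kn Ckx].
    by apply: nU; exists k => //; rewrite kn.
  apply: negligible_bigcup => k; apply/negligibleP => //.
  by case: ifP => [kn|_]; [exact: CC|exact: measure0].
have UE : nu (im (\bigcup_n A n) `&` b) = nu (\bigcup_n (seqDU C n `&` b)).
  have mUD : measurable (\bigcup_n seqDU C n) by exact: bigcup_measurable.
  rewrite -setI_bigcupl; apply: mu_eq_class; try exact: measurableI.
  have -> := malg_classI nu (mim _) mb; have -> := malg_classI nu mUD mb.
  congr Order.meet; rewrite imE; apply: sigma_morphism_bigcupE => // n.
  by rewrite CD /C imE.
have nE n : nu (im (A n) `&` b) = nu (seqDU C n `&` b).
  apply: mu_eq_class; try exact: measurableI.
  have -> := malg_classI nu (mim _) mb; have -> := malg_classI nu (mD n) mb.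
  by rewrite CD.
rewrite /pullback_measure UE; under eq_fun do under eq_bigr do rewrite nE.
apply: measure_semi_sigma_additive.
- by move=> n; exact: measurableI.
- apply/trivIsetP => i j _ _ ij.
  have /trivIsetP/(_ i j I I ij) dij := @trivIset_seqDU _ C.
  by rewrite setIACA dij set0I.
- by apply: bigcup_measurable => n _; exact: measurableI.
Qed.

HB.instance Definition _ := isMeasure.Build _ _ _ pb
  pullback0 pullback_ge0 pullback_semi_sigma_additive.

End pullback_measure.


(** Cutting with a set [b] of finite measure gives the Radon-Nikodym theorem a finite measure to
    differentiate; absolute continuity holds because [F] maps bottom to bottom. *)
Lemma pullback_density d1 d2 (T1 : measurableType d1) (T2 : measurableType d2)
    (R : realType) (mu : {sigma_finite_measure set T1 -> \bar R})
    (nu : {measure set T2 -> \bar R}) (F : malg mu -> malg nu) (b : set T2) :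
  sigma_morphism F -> measurable b -> (nu b < +oo)%E ->
  exists f : T1 -> R, [/\ measurable_fun setT f, (forall x, 0 <= f x) &
    forall A, measurable A ->
      nu (malg_repr (F (malg_class mu A)) `&` b) = (\int[mu]_(x in A) (f x)%:E)%E].
Proof.
move=> sF mb nub; pose m : {measure set T1 -> \bar R} := pullback_measure sF mb.
have fm : fin_num_fun m.
  move=> A mA; rewrite ge0_fin_numE//; apply: le_lt_trans nub.
  by apply: le_measure; rewrite ?inE//; exact: measurableI.
pose i := Measure_isFinite.Build _ _ _ m fm.
pose m' : {finite_measure set T1 -> \bar R} := HB.pack (Measure.sort m) i.
have dom : m' `<< mu.
  apply/null_content_dominatesP => A mA A0.
  apply: subset_measure0 (_ : _ `<=` malg_repr (F (malg_class mu A))) _ => //.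
  - exact: measurableI.
  - apply/malg_class_eq0 => //; rewrite malg_reprK.
    by have /malg_class_eq0 -> := A0; rewrite ?(sigma_morphism0 sF).
have [f [f0 ffin fint fE]] := radon_nikodym_sigma_finite dom.
exists (fine \o f); split.
- apply: measurableT_comp => //; exact: measurable_int fint.
- by move=> x; rewrite fine_ge0.
- move=> A mA; rewrite -[LHS]/(m' A) fE//; apply: eq_integral => x _ /=.
  by rewrite fineK.
Qed.

Section density.
Context d (T : measurableType d) (R : realType).
Variable mu : {sigma_finite_measure set T -> \bar R}.
Implicit Types (g : aut_star mu) (w : T -> R).

Definition is_density g w := [/\ measurable_fun setT w, (forall x, 0 <= w x) &
  forall A, measurable A -> malg_measure ((g^-1)%g (malg_class mu A)) =
    (\int[mu]_(x in A) (w x)%:E)%E].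

Lemma finite_cover : exists P : (set T)^nat, [/\ (forall n, measurable (P n)),
  (forall n, (mu (P n) < +oo)%E), trivIset setT P & \bigcup_n P n = setT].
Proof.
have [E UE /all_and2[mE fE]] := sigma_finiteT mu; exists (seqDU E).
have mD n : measurable (seqDU E n).
  by apply: measurableD => //; exact: bigsetU_measurable.
split => //; [|by rewrite UE [RHS]seqDU_bigcup_eq].
by move=> n; apply: le_lt_trans (fE n); rewrite le_measure ?inE//; exact: subDsetl.
Qed.

Lemma measure_partition (P : (set T)^nat) A : (forall n, measurable (P n)) ->
  trivIset setT P -> \bigcup_n P n = setT -> measurable A ->
  mu A = (\sum_(n <oo) mu (A `&` P n))%E.
Proof.
move=> mP tP UP mA; have := @measure_semi_bigcup _ _ _ mu (fun n => A `&` P n).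
rewrite -setI_bigcupr UP setIT; apply => //.
- by move=> n; exact: measurableI.
- by apply/trivIsetP => i j _ _ ij; rewrite setIACA (trivIsetP.1 tP)// setI0.
Qed.

(** The density is the sum of those of the finite measures obtained by cutting [g^-1 A] with the
    cells [P n] of a partition. *)
Lemma ex_density g : exists w, is_density g w.
Proof.
have [P [mP fP tP UP]] := finite_cover.
have sg := aut_sigma_morphism (g^-1)%g.
have /choice [f fP'] n := pullback_density sg (mP n) (fP n).
have mf n : measurable_fun setT (f n) by have [] := fP' n.
have f0 n x : 0 <= f n x by have [] := fP' n.
have fE n A (mA : measurable A) := let: And3 _ _ H := fP' n in H A mA.
pose we x := (\sum_(n <oo) (f n x)%:E)%E.
have we0 x : (0 <= we x)%E by apply: nneseries_ge0 => n _ _; rewrite lee_fin.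
have mwe : measurable_fun setT we.
  apply: ge0_emeasurable_sum => // [n x _ _|n _]; first by rewrite lee_fin.
  exact/measurable_EFinP.
have weE A : measurable A -> (\int[mu]_(x in A) we x)%E =
    malg_measure ((g^-1)%g (malg_class mu A)).
  move=> mA; rewrite integral_nneseries//; last 2 first.
  - by move=> n; apply/measurable_EFinP; exact: measurable_funTS.
  - by move=> n x _; rewrite lee_fin.
  apply/esym; etransitivity; first by apply: (measure_partition mP tP UP); exact: measurable_malg_repr.
  by apply: eq_eseriesr => n _; rewrite -fE.
(* The sum may be infinite at some points, but its integral over [g (P n)] is [mu (P n) < +oo], and
   these sets cover the space up to a null set. *)
have wefin : {ae mu, forall x, we x \is a fin_num}.
  pose E n := malg_repr (g (malg_class mu (P n))).
  have mE n : measurable (E n) by exact: measurable_malg_repr.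
  have EN n : {ae mu, forall x, E n x -> we x \is a fin_num}.
    apply: integrable_ae => //; apply/integrableP; split; first exact: measurable_funTS.
    under eq_integral do rewrite gee0_abs//.
    rewrite weE// malg_reprK -[X in malg_measure X]/((g^-1 * g)%g _) mulVg.
    by rewrite (malg_measure_class _ (mP n)); exact: fP.
  have : {ae mu, forall x, ~ (~` \bigcup_n E n) x}.
    have mUE : measurable (\bigcup_n E n) by exact: bigcup_measurable.
    apply/malg_class0_ae; first exact: measurableC.
    have -> := malg_classC mu mUE.
    have sg' := aut_sigma_morphism g.
    rewrite -(sigma_morphism_bigcupE sg' mP mE) => [|n]; last exact: malg_reprK.
    by rewrite UP malg_classT (sigma_morphism1 sg') compl1.
  have : {ae mu, forall x, forall n, E n x -> we x \is a fin_num}.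
    exact/ae_foralln.
  apply: filterS2 => x H /=; rewrite notK => -[n _]; exact: H.
exists (fine \o we); split.
- exact: measurableT_comp.
- by move=> x; rewrite fine_ge0.
- move=> A mA; rewrite -weE//; apply: ge0_ae_eq_integral => //.
  + exact: measurable_funTS.
  + by apply: measurable_funTS; apply/measurable_EFinP; exact: measurableT_comp.
  + by move=> x _; rewrite lee_fin fine_ge0.
  + by apply: filterS wefin => x wx _ /=; rewrite fineK.
Qed.

Lemma rn_derivativeP g : is_density g (rn_derivative g).
Proof.
by have := ex_density g; rewrite /rn_derivative => hP; exact: (xgetPex (cst 0) hP).
Qed.

Lemma density_unique g w w' : is_density g w -> is_density g w' ->
  {ae mu, forall x, w x = w' x}.
Proof.
move=> [mw w0 wE] [mw' w'0 w'E].
have [P [mP fP _ UP]] := finite_cover.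
pose E n := malg_repr (g (malg_class mu (P n))).
have mE n : measurable (E n) by exact: measurable_malg_repr.
have EN n : {ae mu, forall x, E n x -> w x = w' x}.
  have : ae_eq mu (E n) (EFin \o w) (EFin \o w').
    apply: integral_ae_eq => //.
    - apply/integrableP; split.
        by apply: measurable_funTS; exact/measurable_EFinP.
      under eq_integral do rewrite gee0_abs ?lee_fin//.
      rewrite -wE// malg_reprK -[X in malg_measure X]/((g^-1 * g)%g _) mulVg.
      by rewrite (malg_measure_class _ (mP n)); exact: fP.
    - by apply: measurable_funTS; exact/measurable_EFinP.
    - by move=> A _ mA; rewrite -wE// -w'E.
  by apply: filterS => x H /H [].
have : {ae mu, forall x, ~ (~` \bigcup_n E n) x}.
  have mUE : measurable (\bigcup_n E n) by exact: bigcup_measurable.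
  apply/malg_class0_ae; first exact: measurableC.
  have -> := malg_classC mu mUE.
  have sg' := aut_sigma_morphism g.
  rewrite -(sigma_morphism_bigcupE sg' mP mE) => [|n]; last exact: malg_reprK.
  by rewrite UP malg_classT (sigma_morphism1 sg') compl1.
have : {ae mu, forall x, forall n, E n x -> w x = w' x} by exact/ae_foralln.
by apply: filterS2 => x H /=; rewrite notK => -[n _]; exact: H.
Qed.

End density.

(** * The Koopman representation *)


Section aut_inverse.
Context d (T : measurableType d) (R : realType).
Variables (mu : {measure set T -> \bar R}) (g : aut_star mu).

Lemma aut_starKV : cancel (g^-1)%g g.
Proof. by move=> a; rewrite -[LHS]/((g * g^-1)%g a) mulgV. Qed.

Lemma aut_starK : cancel g (g^-1)%g.
Proof. by move=> a; rewrite -[LHS]/((g^-1 * g)%g a) mulVg. Qed.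

End aut_inverse.

Lemma measurable_pair d d1 d2 (T : measurableType d) (X1 : measurableType d1)
    (X2 : measurableType d2) (f1 : T -> X1) (f2 : T -> X2) :
  measurable_fun setT f1 -> measurable_fun setT f2 ->
  measurable_fun setT (fun x => (f1 x, f2 x)).
Proof. by move=> mf1 mf2; apply/measurable_fun_pairP; split. Qed.

Section koopman_real.
Context d (T : measurableType d) (R : realType).
Variable mu : {sigma_finite_measure set T -> \bar R}.
Implicit Types (g : aut_star mu) (f : T -> R).

(** The measure [w mu] gives [h^-1 B] the mass [mu (g^-1 (h^-1 B)) = mu (f^-1 B)]: the image of
    [w mu] by [h] is the image of [mu] by [f]. *)
Lemma translates_change_of_variables d' (X : measurableType d') g (f h : T -> X)
    (w : T -> R) (phi : X -> \bar R) :
  measurable_fun setT f -> translates_to g f h -> is_density g w ->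
  measurable_fun setT phi -> (forall y, (0 <= phi y)%E) ->
  (\int[mu]_x (phi (h x) * (w x)%:E) = \int[mu]_x phi (f x))%E.
Proof.
move=> mf [mh hE] [mw w0 wE] mphi phi0.
pose mfi := isMeasurableFun.Build _ _ _ _ _ mf.
pose f' : {mfun T >-> X} := HB.pack f mfi.
rewrite -[RHS](@ge0_integral_pushforward _ _ _ _ _ f _ mu setT phi)//.
apply: ge0_integral_weighted_comp => // B mB.
rewrite -wE ?hE; last exact: measurable_preimage.
  rewrite aut_starK.
  by rewrite malg_measure_class//; exact: measurable_preimage.
exact: measurable_preimage.
Qed.

(** If [A] is the zero set of [w], then [g^-1 A] is null; applying [g], so is [A]. *)
Lemma density_gt0 g w : is_density g w -> {ae mu, forall x, 0 < w x}.
Proof.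
move=> [mw w0 wE]; have mA : measurable (w @^-1` [set 0]) by exact: measurable_preimage.
have : {ae mu, forall x, ~ (w @^-1` [set 0]) x}.
  apply/malg_class0_ae => //.
  have : malg_measure (g^-1%g (malg_class mu (w @^-1` [set 0]))) = 0%E.
    by rewrite wE// integral0_eq// => x ->.
  rewrite /malg_measure => /malg_class_eq0; rewrite malg_reprK.
  move=> /(_ (@measurable_malg_repr _ _ _ _ _)) /(congr1 g).
  rewrite aut_starKV => ->.
  exact: (sigma_morphism0 (aut_sigma_morphism g)).
apply: filterS => x /= wx; rewrite lt_neqAle w0 andbT; apply/eqP => /esym.
exact: wx.
Qed.

Definition koopman_real g f x := Num.sqrt (rn_derivative g x) * translate g f x.

Let rnP g : is_density g (rn_derivative g) := rn_derivativeP g.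

Let mrn g : measurable_fun setT (rn_derivative g).
Proof. by have [] := rnP g. Qed.

Let msqrt : measurable_fun setT (@Num.sqrt R).
Proof. exact: continuous_measurable_fun (@sqrt_continuous R). Qed.

Lemma measurable_koopman_real g f : measurable_fun setT (koopman_real g f).
Proof.
apply: measurable_funM; last exact: measurable_translate.
exact: measurableT_comp.
Qed.

Lemma koopman_real_ae_eq g f f' : measurable_fun setT f -> measurable_fun setT f' ->
  {ae mu, forall x, f x = f' x} ->
  {ae mu, forall x, koopman_real g f x = koopman_real g f' x}.
Proof.
move=> mf mf' ff'.
have := translates_to_unique mf mf' ff' (translateP g mf) (translateP g mf').
by apply: filterS => x; rewrite /koopman_real => ->.
Qed.

Lemma koopman_real1 f : measurable_fun setT f ->
  {ae mu, forall x, koopman_real 1%g f x = f x}.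
Proof.
move=> mf; have ff : {ae mu, forall x, f x = f x} by exact: aeW.
have h1 := translates_to_unique mf mf ff (translateP 1%g mf) (translates_to1 mu mf).
have d1 : is_density (1%g : aut_star mu) (cst 1 : T -> R).
  split => // A mA; rewrite invg1 malg_measure_class//.
  by rewrite -[RHS]/(\int[mu]_(x in A) (cst 1%E x))%E integral_cst// mul1e.
have := density_unique (rnP 1%g) d1.
by apply: filterS2 h1 => x; rewrite /koopman_real => -> ->; rewrite sqrtr1 mul1r.
Qed.

(** Chain rule for Radon-Nikodym derivatives. The absolute value is there because a density is
    nonnegative everywhere, while the translate of a nonnegative function is so only almost
    everywhere. *)
Lemma density_chain g h : is_density (g * h)%g
  (fun x => rn_derivative g x * `|translate g (rn_derivative h) x|).
Proof.
have mt := measurable_translate g (rn_derivative h).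
split.
- by apply: measurable_funM => //; exact: measurableT_comp.
- by move=> x; rewrite mulr_ge0//; have [] := rnP g.
move=> A mA; rewrite invgM -[LHS]/(malg_measure (h^-1%g (g^-1%g (malg_class mu A)))).
set B := malg_repr (g^-1%g (malg_class mu A)).
have mB : measurable B by exact: measurable_malg_repr.
rewrite -(malg_reprK (g^-1%g _)) -/B.
have [_ wh0 ->//] := rnP h.
have [_ wg0 _] := rnP g.
pose phi (p : R * R) : \bar R := (`|p.1 * p.2|)%:E.
have phi0 p : (0 <= phi p)%E by rewrite lee_fin.
have mphi : measurable_fun setT phi.
  by apply/measurable_EFinP; apply: measurableT_comp => //; exact: measurable_funM.
have gBA : malg_class mu (malg_repr (g (malg_class mu B))) = malg_class mu A.
  by rewrite malg_reprK /B malg_reprK aut_starKV.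
have tI : translates_to g (\1_B : T -> R) \1_A.
  have [_ tB] := translates_to_indic g mB; split; first exact: measurable_indic.
  move=> C mC; rewrite -tB//.
  have mA' : measurable (malg_repr (g (malg_class mu B))) by exact: measurable_malg_repr.
  rewrite !preimage_indic; case: ifP => _; case: ifP => _ //.
  by have -> := malg_classC mu mA; have -> := malg_classC mu mA'; rewrite gBA.
have mI : measurable_fun setT (\1_B : T -> R) by exact: measurable_indic.
have mp : measurable_fun setT (fun x => (\1_B x : R, rn_derivative h x)).
  by exact: measurable_pair.
have := translates_change_of_variables mp
  (translates_to_pair mI (mrn h) tI (translateP g (mrn h)))
  (rnP g) mphi phi0.
rewrite /phi /= => H; rewrite integral_mkcond [RHS]integral_mkcond.
rewrite [LHS](_ : _ = (\int[mu]_x `|\1_B x * rn_derivative h x|%:E)%E); last first.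
  apply: eq_integral => x _; rewrite patchE indicE; case: ifP => _ /=.
    by rewrite mul1r ger0_norm.
  by rewrite mul0r normr0.
rewrite -H; apply: eq_integral => x _; rewrite patchE indicE; case: ifP => _ /=.
  by rewrite mul1r mulrC EFinM.
by rewrite mul0r normr0 mul0e.
Qed.

Lemma koopman_realM g h f : measurable_fun setT f ->
  {ae mu, forall x, koopman_real (g * h)%g f x = koopman_real g (koopman_real h f) x}.
Proof.
move=> mf; have mhf := measurable_koopman_real h f.
have ff : {ae mu, forall x, f x = f x} by exact: aeW.
have mtf := measurable_translate h f.
have e1 := translates_to_unique mf mf ff (translateP (g * h)%g mf)
  (translates_toM mtf (translateP h mf) (translateP g mtf)).
have e2 := density_unique (rnP (g * h)%g) (density_chain g h).
have t3 := translates_to_pair (mrn h) mtf (translateP g (mrn h)) (translateP g mtf).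
have mp : measurable_fun setT (fun x => (rn_derivative h x, translate h f x)).
  by exact: measurable_pair.
have mphi : measurable_fun setT (fun p : R * R => Num.sqrt p.1 * p.2).
  apply: measurable_funM => //; exact: measurableT_comp.
have t4 := translates_to_comp mphi t3.
have e3 := translates_to_unique mhf mhf (aeW _ (fun x => erefl)) (translateP g mhf) t4.
have e4 := translates_to_ge0 (mrn h) (translateP g (mrn h)).
have {}e4 := e4 (aeW _ (fun x => let: And3 _ w0 _ := rnP h in w0 x)).
apply: filterS2 (filterI e1 e2) (filterI e3 e4) => x [h1 h2] [h3 h4].
rewrite /koopman_real h1 h2 h3 /= ger0_norm// sqrtrM; last by have [] := rnP g.
by rewrite mulrA.
Qed.

Lemma koopman_real_ge0 g f : measurable_fun setT f ->
  {ae mu, forall x, 0 <= f x} -> {ae mu, forall x, 0 <= koopman_real g f x}.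
Proof.
move=> mf f0; have := translates_to_ge0 mf (translateP g mf) f0.
by apply: filterS => x tx; rewrite mulr_ge0// sqrtr_ge0.
Qed.

(** The square root of the density is a common factor, so a [phi] homogeneous of degree 2 releases
    the density itself and the change of variables applies. The squares of [p.1], [p.1 + p.2] and
    [p.1 - p.2] yield the isometry properties. *)
Lemma koopman_real_comp2 g f1 f2 (phi : R * R -> \bar R) :
  measurable_fun setT f1 -> measurable_fun setT f2 ->
  measurable_fun setT phi -> (forall p, (0 <= phi p)%E) ->
  (forall c a b, 0 <= c -> phi (c * a, c * b) = ((c ^+ 2)%:E * phi (a, b))%E) ->
  (\int[mu]_x phi (koopman_real g f1 x, koopman_real g f2 x) =
   \int[mu]_x phi (f1 x, f2 x))%E.
Proof.
move=> mf1 mf2 mphi phi0 phiZ.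
have mp : measurable_fun setT (fun x => (f1 x, f2 x)) by exact: measurable_pair.
rewrite -(translates_change_of_variables mp
  (translates_to_pair mf1 mf2 (translateP g mf1) (translateP g mf2)) (rnP g) mphi phi0).
apply: eq_integral => x _; rewrite /koopman_real.
rewrite (phiZ _ _ _ (sqrtr_ge0 _)) sqr_sqrtr; first by rewrite muleC.
by have [] := rnP g.
Qed.

(** Vanishing off [A] is a relation between [f] and the indicator of [A], so it is transported by
    translating the pair. *)
Lemma koopman_real_support g f A : measurable_fun setT f -> measurable A ->
  {ae mu, forall x, ~ A x -> f x = 0} ->
  {ae mu, forall x, ~ malg_repr (g (malg_class mu A)) x -> koopman_real g f x = 0}.
Proof.
move=> mf mA fA; set A' := malg_repr _.
have mA1 : measurable_fun setT (\1_A : T -> R) by exact: measurable_indic.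
pose D : set (R * R) := [set p | p.1 == 0] `&` [set p | p.2 != 0].
have mD : measurable D.
  have m0 : measurable ([set x : R | x == 0]).
    rewrite (_ : [set x | _] = [set 0]) ?measurable_set1//.
    by apply/seteqP; split => x /= /eqP.
  apply: measurableI; first exact: (measurable_preimage (measurable_fst) m0).
  rewrite (_ : [set p | _] = ~` ((@snd R R) @^-1` [set x : R | x == 0])).
    apply: measurableC; exact: (measurable_preimage (measurable_snd) m0).
  by apply/seteqP; split => p /= /negP.
have mp : measurable_fun setT (fun x => (\1_A x : R, f x)) by exact: measurable_pair.
have := translates_to_ae mp mD
  (translates_to_pair mA1 mf (translates_to_indic g mA) (translateP g mf)).
move=> H; apply: filterS (H _) => [x /= nD nA'x|].
  rewrite /koopman_real; apply/eqP; rewrite mulf_eq0; apply/orP; right.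
  apply/negPn/negP => t0; apply: nD; split => //=.
  by rewrite indicE memNset.
apply: filterS fA => x fA0 [/=]; rewrite indicE.
have [Ax|nAx] := pselect (A x); first by rewrite mem_set// oner_eq0.
by rewrite fA0// eqxx.
Qed.

End koopman_real.

(** * The space of square-integrable functions *)


Section L2_space.
Context d (T : measurableType d) (R : realType).
Variable mu : {measure set T -> \bar R}.
Implicit Types f h : T -> R.

Lemma Lnorm2_lt (F : T -> R) (e : R) : 0 < e -> (forall x, 0 <= F x) ->
  (('N[mu]_2%:E[(fun x => (F x)%:E)] < e%:E)%E =
   (\int[mu]_x ((F x) ^+ 2)%:E < (e ^+ 2)%:E)%E).
Proof.
move=> e0 F0; have NE : (\int[mu]_x ((F x) ^+ 2)%:E)%E =
    ('N[mu]_2%:E[(fun x => (F x)%:E)] `^ 2)%E.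
  rewrite powR_Lnorm//; apply: eq_integral => x _.
  by rewrite /= ger0_norm// -powR_mulrn.
rewrite NE; have := Lnorm_ge0 mu 2%:E (fun x => (F x)%:E).
case: ('N[mu]_2%:E[_])%E => [r|_|//].
  rewrite lee_fin => r0; rewrite poweR_EFin !lte_fin powR_mulrn//.
  by rewrite ltr_pXn2r// nnegrE ltW.
by rewrite poweRyr// !ltNge !leey.
Qed.

Lemma Lfun2P f : f \in Lfun mu 2%:E <->
  measurable_fun setT f /\ (\int[mu]_x ((f x) ^+ 2)%:E < +oo)%E.
Proof.
split.
  move=> lf; split; first by move: lf; rewrite inE => /andP[/[!inE]].
  have /integrableP [_] := Lfun2_integrable_sqr lf.
  by under eq_integral do rewrite gee0_abs ?lee_fin ?sqr_ge0//.
move=> [mf lf]; rewrite inE; apply/andP; split; rewrite inE//= /finite_norm.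
apply: (@lty_poweRy _ _ 2) => //; rewrite powR_Lnorm//.
rewrite (eq_integral (fun x => ((f x) ^+ 2)%:E))// => x _ /=.
by rewrite powR_mulrn// real_normK ?num_real.
Qed.

Local Notation E := (LfunType mu (lee1n 2)).

Definition L2dot (f h : E) : R := \int[mu]_x (f x * h x).

Lemma L2_integrableM (f h : E) : mu.-integrable setT (fun x => (f x * h x)%:E).
Proof. by apply/Lfun1_integrable; apply: Lfun2_mul_Lfun1; exact: LfunP. Qed.

Lemma L2dotC (f h : E) : L2dot f h = L2dot h f.
Proof. by apply: eq_Rintegral => x _; rewrite mulrC. Qed.

Lemma L2dotDl (f h k : E) : L2dot (f + h) k = L2dot f k + L2dot h k.
Proof.
rewrite -RintegralD//; [|exact: L2_integrableM..].
by apply: eq_Rintegral => x _; rewrite mulrDl.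
Qed.

Lemma L2dotZl a (f h : E) : L2dot (a *: f) h = a * L2dot f h.
Proof.
rewrite -RintegralZl//; last exact: L2_integrableM.
by apply: eq_Rintegral => x _; rewrite -mulrA.
Qed.

Lemma L2dot_ge0 (f : E) : 0 <= L2dot f f.
Proof. by apply: Rintegral_ge0 => x _; rewrite -expr2 sqr_ge0. Qed.

Lemma L2dotE (f : E) : (L2dot f f)%:E = (\int[mu]_x ((f x) ^+ 2)%:E)%E.
Proof.
rewrite /L2dot /Rintegral fineK; last first.
  by apply: integrable_fin_num => //; exact: L2_integrableM.
by apply: eq_integral => x _.
Qed.

Lemma L2dot_ae_eq (f f' h h' : E) : {ae mu, forall x, f x = f' x} ->
  {ae mu, forall x, h x = h' x} -> L2dot f h = L2dot f' h'.
Proof.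
move=> ff' hh'; rewrite /L2dot /Rintegral; congr fine.
apply: ae_eq_integral => //.
- by apply: measurable_int (L2_integrableM f h).
- by apply: measurable_int (L2_integrableM f' h').
- by apply: filterS2 ff' hh' => x -> ->.
Qed.

Lemma L2dot_eq0 (f : E) : L2dot f f = 0 <-> {ae mu, forall x, f x = 0}.
Proof.
split=> [ff0|f0].
  have : (\int[mu]_x `|((f x) ^+ 2)%:E| = 0)%E.
    under eq_integral do rewrite gee0_abs ?lee_fin ?sqr_ge0//.
    by rewrite -L2dotE ff0.
  move/ae_eq_integral_abs => H; have := H measurableT.
  have m2 : measurable_fun setT (fun x => ((f x) ^+ 2)%:E).
    by apply/measurable_EFinP; apply: measurable_funX.
  move=> /(_ m2); apply: filterS => x /(_ I) /= [] /eqP.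
  by rewrite sqrf_eq0 => /eqP.
have -> : L2dot f f = L2dot 0 0 by apply: L2dot_ae_eq; apply: filterS f0 => x ->.
by rewrite -(scale0r 0) L2dotZl mul0r.
Qed.

Definition toL2 f (mf : measurable_fun setT f)
    (lf : (\int[mu]_x ((f x) ^+ 2)%:E < +oo)%E) : E :=
  Lfun_Sub (lee1n 2) ((Lfun2P f).2 (conj mf lf)).

End L2_space.


Lemma sum_geometric_half_le (R : realType) n :
  \sum_(0 <= k < n) (2^-1 : R) ^+ k <= 2.
Proof.
suff : \sum_(0 <= k < n) (2^-1 : R) ^+ k = 2 - 2 * 2^-1 ^+ n.
  by move=> ->; rewrite gerBl mulr_ge0// exprn_ge0.
elim: n => [|n IHn]; first by rewrite big_geq// expr0 mulr1 subrr.
by rewrite big_nat_recr//= IHn exprS; move: (2^-1 ^+ n) => c; lra.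
Qed.

(** Since [|x| <= 2^-k + 2^k x^2], the increments are absolutely summable. *)
Lemma cvg_weighted_sq_increments (R : realType) (v : nat -> R) :
  (\sum_(k <oo) (2 ^+ k * (v k.+1 - v k) ^+ 2)%:E < +oo)%E -> cvgn v.
Proof.
move=> fs; pose a k := 2 ^+ k * (v k.+1 - v k) ^+ 2.
have a0 k : 0 <= a k by rewrite mulr_ge0// sqr_ge0.
pose M := fine (\sum_(k <oo) (a k)%:E)%E.
have ME : M%:E = (\sum_(k <oo) (a k)%:E)%E.
  rewrite fineK// ge0_fin_numE//.
  by apply: nneseries_ge0 => k _ _; rewrite lee_fin.
have aM n : \sum_(0 <= k < n) a k <= M.
  rewrite -lee_fin ME -sumEFin; apply: nneseries_lim_ge => k _ _.
  by rewrite lee_fin.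
have amgm k : `|v k.+1 - v k| <= 2^-1 ^+ k + a k.
  rewrite /a; set x := v k.+1 - v k; have p0 : 0 < (2 ^+ k : R) by rewrite exprn_gt0.
  rewrite exprVn -(ler_pM2r p0) mulrDl mulVf ?gt_eqF//.
  rewrite -[x ^+ 2]real_normK ?num_real//; have := normr_ge0 x.
  move: (2 ^+ k) `|x| p0 => p y p0 y0; nra.
have cs : cvgn (series (fun k => `|v k.+1 - v k|)).
  apply: nondecreasing_is_cvgn.
    by apply: nondecreasing_series => k _ _.
  exists (2 + M) => _ [n _ <-]; rewrite /series /=.
  apply: le_trans (_ : \sum_(0 <= k < n) (2^-1 ^+ k + a k) <= _).
    by apply: ler_sum => k _; exact: amgm.
  by rewrite big_split/= lerD// sum_geometric_half_le.
have {}cs : cvgn (series (telescope v)) by exact: normed_cvg.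
rewrite (_ : v = (fun n => v 0%N + series (telescope v) n)); last first.
  by apply/funext => n; rewrite [LHS]eq_sum_telescope.
by apply: is_cvgD; [exact: is_cvg_cst|exact: cs].
Qed.

(** * Completeness of L^2 *)

Section completeness.
Context d (T : measurableType d) (R : realType).
Variable mu : {measure set T -> \bar R}.
Local Notation E := (LfunType mu (lee1n 2)).
Local Notation dot := (@L2dot _ T R mu).
Local Notation sq x := (dot x x).

Lemma limn_einf_le (u : nat -> \bar R) (c : \bar R) k :
  (forall m, (k <= m)%N -> (u m <= c)%E) -> (limn_einf u <= c)%E.
Proof.
move=> uc; rewrite limn_einf_lim; apply: lime_le.
  by apply: is_cvg_einfs.
near=> n; apply: (@le_trans _ _ (u (maxn n k))).
  by apply: ereal_inf_lbound; exists (maxn n k) => //=; rewrite leq_maxl.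
by apply: uc; rewrite leq_maxr.
Unshelve. all: by end_near. Qed.

(* Along a fast subsequence [v], the weighted sum of the squared increments is
   integrable, so [v] converges almost everywhere; Fatou's lemma bounds the
   distance to the limit. *)
Lemma L2_fast_cvg (v : nat -> E) :
  (forall k m, (k <= m)%N -> sq (v m - v k) <= 4^-1 ^+ k) ->
  exists l : E, forall k, sq (v k - l) <= 4^-1 ^+ k.
Proof.
move=> vfast; pose s x := (\sum_(k <oo) (2 ^+ k * (v k.+1 x - v k x) ^+ 2)%:E)%E.
have mv k : measurable_fun setT (v k : T -> R) by exact: measurable_funP.
have mterm k : measurable_fun setT (fun x => (2 ^+ k * (v k.+1 x - v k x) ^+ 2)%:E).
  apply/measurable_EFinP; apply: measurable_funM => //.
  by apply: measurable_funX; exact: measurable_funB.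
have term0 k x : (0 <= (2 ^+ k * (v k.+1 x - v k x) ^+ 2)%:E)%E.
  by rewrite lee_fin mulr_ge0// sqr_ge0.
have ms : measurable_fun setT s by apply: ge0_emeasurable_sum => // k x _ _.
have s0 x : (0 <= s x)%E by exact: nneseries_ge0.
have intv k m : (k <= m)%N ->
    (\int[mu]_x ((v m x - v k x) ^+ 2)%:E <= (4^-1 ^+ k)%:E)%E.
  move=> km; have := vfast k m km; rewrite -lee_fin; apply: le_trans.
  by rewrite L2dotE.
have ints : (\int[mu]_x s x < +oo)%E.
  rewrite integral_nneseries//.
  apply: le_lt_trans (_ : \sum_(k <oo) (2^-1 ^+ k)%:E < +oo)%E.
    apply: lee_nneseries => [k _ _|k _]; first exact: integral_ge0.
    under eq_integral do rewrite EFinM.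
    rewrite ge0_integralZl_EFin//; last 2 first.
    - by move=> x _; rewrite lee_fin sqr_ge0.
    - by apply/measurable_EFinP; apply: measurable_funX; exact: measurable_funB.
    apply: le_trans (lee_wpmul2l _ (intv k k.+1 (leqnSn k))) _.
      by rewrite lee_fin.
    rewrite -EFinM lee_fin -exprMn -(_ : 2^-1 = 2 * 4^-1 :> R)//; by field.
  apply: le_lt_trans (_ : 2%:E < +oo)%E; last exact: ltry.
  apply: lime_le; first by apply: is_cvg_nneseries => k _ _; rewrite lee_fin exprn_ge0.
  by apply: nearW => n; rewrite sumEFin lee_fin; exact: sum_geometric_half_le.
have sfin : {ae mu, forall x, s x \is a fin_num}.
  have : {ae mu, forall x, setT x -> s x \is a fin_num}.
    apply: integrable_ae => //; apply/integrableP; split => //.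
    by under eq_integral do rewrite gee0_abs//.
  by apply: filterS => x; exact.
pose N := s @^-1` [set +oo%E].
have mN : measurable N by exact: measurable_preimage.
have N0 : {ae mu, forall x, ~ N x}.
  by apply: filterS sfin => x + /= Nx; rewrite Nx.
(* Cut off on the null set [N] where the series is infinite, the sequence converges at every point,
   so that its limit is measurable. *)
pose w k x := v k x * \1_(~` N) x.
have wl x : cvgn (w ^~ x).
  have [Nx|nN] := pselect (N x).
    rewrite (_ : w ^~ x = cst 0); first exact: is_cvg_cst.
    by apply/funext => k; rewrite /w indicE memNset// mulr0.
  rewrite (_ : w ^~ x = (fun k => v k x)); last first.
    by apply/funext => k; rewrite /w indicE mem_set// mulr1.
  by apply: cvg_weighted_sq_increments; rewrite -/(s x) ltey; apply/eqP.
pose l x := limn (w ^~ x).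
have mw k : measurable_fun setT (w k).
  by apply: measurable_funM => //; apply: measurable_indic; exact: measurableC.
have ml : measurable_fun setT l.
  by apply: (@measurable_fun_cvg _ _ _ setT w l) => // x _; exact: wl.
have wv k : {ae mu, forall x, w k x = v k x}.
  by apply: filterS N0 => x nN; rewrite /w indicE mem_set// mulr1.
have bound k : (\int[mu]_x ((l x - v k x) ^+ 2)%:E <= (4^-1 ^+ k)%:E)%E.
  have mD m : measurable_fun setT (fun x => ((w m x - v k x) ^+ 2)%:E).
    by apply/measurable_EFinP; apply: measurable_funX; exact: measurable_funB.
  rewrite (eq_integral (fun x => limn_einf (fun m => ((w m x - v k x) ^+ 2)%:E))).
    apply: le_trans (fatou _ measurableT mD _) _.
      by move=> n x _; rewrite lee_fin sqr_ge0.
    apply: (@limn_einf_le _ _ k) => m km; apply: le_trans (intv k m km).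
    rewrite (_ : (\int[mu]_x _)%E = (\int[mu]_x ((v m x - v k x) ^+ 2)%:E)%E)//.
    apply: ge0_ae_eq_integral => //.
    - by apply/measurable_EFinP; apply: measurable_funX; exact: measurable_funB.
    - by move=> x _; rewrite lee_fin sqr_ge0.
    - by move=> x _; rewrite lee_fin sqr_ge0.
    - by apply: filterS (wv m) => x -> _.
  move=> x _; have H : (fun m => ((w m x - v k x) ^+ 2)%:E) @ \oo -->
      ((l x - v k x) ^+ 2)%:E.
    apply: cvg_EFin; first exact: nearW.
    have hB : (fun m => w m x - v k x) @ \oo --> l x - v k x.
      by apply: cvgB; [exact: wl|exact: cvg_cst].
    exact: (cvgM hB hB).
  by have [->] := cvg_limn_einf_sup H.
have ll : (\int[mu]_x ((l x - v 0%N x) ^+ 2)%:E < +oo)%E.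
  exact: le_lt_trans (bound 0%N) (ltry _).
have mlv : measurable_fun setT (fun x => l x - v 0%N x) by exact: measurable_funB.
(* Square integrability is known for [l - v 0], so the limit enters [E] as this difference plus
   [v 0]. *)
exists (toL2 mlv ll + v 0%N) => k; rewrite -lee_fin L2dotE.
rewrite (_ : (\int[mu]_x _)%E = (\int[mu]_x ((l x - v k x) ^+ 2)%:E)%E)//.
apply: eq_integral => x _; congr EFin.
by rewrite -[LHS]/((v k x - ((l x - v 0%N x) + v 0%N x)) ^+ 2) subrK -sqrrN opprB.
Qed.

Lemma L2_complete (u : nat -> E) :
  (forall e : R, 0 < e -> exists N, forall m n, (N <= m)%N -> (N <= n)%N ->
    sq (u m - u n) < e) -> exists l, cvgE dot u l.
Proof.
move=> cu; have p0 k : 0 < (4^-1 : R) ^+ k by rewrite exprn_gt0.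
have /choice [N NP] := fun k => cu _ (p0 k).
(* [L2_fast_cvg] compares each term with every earlier one; the maximum makes [n m] exceed all the
   thresholds [N k] with [k <= m]. *)
pose n k := \max_(i < k.+1) N i.
have Nn k m : (k <= m)%N -> (N k <= n m)%N.
  move=> km; have km' : (k < m.+1)%N by rewrite ltnS.
  exact: (@leq_bigmax _ (fun i : 'I_m.+1 => N i) (Ordinal km')).
have [|l lP] := @L2_fast_cvg (fun k => u (n k)).
  by move=> k m km; apply/ltW/NP; exact: Nn.
exists l => e e0.
have [k ke] : exists k, (4^-1 : R) ^+ k < e / 4.
  have e4 : 0 < e / 4 by rewrite divr_gt0.
  have [M MP] := ex_natSinv_lt e4; exists M; apply: le_lt_trans (MP M (leqnn _)).
  rewrite exprVn lef_pV2 ?posrE ?exprn_gt0 ?ltr0n// -natrX ler_nat.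
  by rewrite ltn_expl.
exists (N k) => m km.
have h1 := NP k m (n k) km (Nn k k (leqnn _)).
have h2 := lP k.
rewrite (_ : u m - l = (u m - u (n k)) + (u (n k) - l)); last by rewrite addrA subrK.
move: h1 h2; move: (u m - u (n k)) (u (n k) - l) => a b h1 h2.
have h3 := L2dot_ge0 (a - b).
have dNl x y : dot (- x) y = - dot x y by rewrite -scaleN1r L2dotZl mulN1r.
have dNr x y : dot x (- y) = - dot x y by rewrite L2dotC dNl L2dotC.
have dDr x y z : dot x (y + z) = dot x y + dot x z.
  by rewrite L2dotC L2dotDl !(L2dotC x).
rewrite L2dotDl !dDr !dNl !dNr (L2dotC b a) opprK in h3.
rewrite L2dotDl !dDr (L2dotC b a).
move: (4^-1 ^+ k) ke h1 h2 => c ke h1 h2; lra.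
Qed.

End completeness.

(** * Continuity of actions *)


Lemma cvg_aut_star d (T : measurableType d) (R : realType)
    (mu : {measure set T -> \bar R}) (F : set_system (aut_star mu)) (t : aut_star mu) :
  Filter F -> F --> t <-> forall U, @sot_subbase _ _ _ mu U -> U t -> F U.
Proof.
move=> FF; split=> [Ft U sU Ut|FU].
  apply: Ft; exists U; split=> //; exists [set U]; last first.
    by rewrite predeqE => ?; split=> [[_ ->]|] //; exists U.
  move=> _ ->; exists (finmap.fset1 U).
    by move=> V; rewrite finmap.inE => /eqP ->; exact: mem_set.
  by rewrite predeqE=> ?; split=> [|??]; [apply|]; rewrite /= finmap.inE // =>/eqP->.
move=> A /= [_ [[B sB <-] [C BC Ct] sUBA]].
rewrite nbhs_filterE; apply: filterS sUBA _; apply: (@filterS _ _ _ C).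
  by move=> ? ?; exists C.
have /sB [D sD IDeC] := BC; rewrite -IDeC; apply: filter_bigI => U DU.
apply: FU; first by have /sD/set_mem := DU.
by move: Ct; rewrite -IDeC => /(_ _ DU).
Qed.

Section sot.
Context d (T : measurableType d) (R : realType).
Variable mu : {sigma_finite_measure set T -> \bar R}.
Implicit Types (f : T -> R) (F : T -> R[i]).

Lemma L2norm_lt F (e : R) : 0 < e -> (L2norm mu F < e%:E)%E =
  (\int[mu]_x ((complex.Re (F x)) ^+ 2 + (complex.Im (F x)) ^+ 2)%:E < (e ^+ 2)%:E)%E.
Proof.
move=> e0; rewrite /L2norm Lnorm2_lt//; last first.
  by move=> x; case: (F x) => a b /=; exact: sqrtr_ge0.
congr (_ < _)%E; apply: eq_integral => x _; congr EFin.
by case: (F x) => a b /=; rewrite sqr_sqrtr// addr_ge0// sqr_ge0.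
Qed.

Lemma koopmanE (g : aut_star mu) F x : koopman g F x =
  (koopman_real g (fun y => complex.Re (F y)) x +i*
   koopman_real g (fun y => complex.Im (F y)) x)%C.
Proof. by rewrite /koopman /koopman_real; simpc. Qed.

(** Continuity at the identity, for real functions and squared norms. For homomorphisms this is
    equivalent to continuity into [aut_star mu], by the two implications below. *)
Definition strongly_continuous (G : topologicalGroupType) (rho : G -> aut_star mu) :=
  forall f, measurable_fun setT f -> (\int[mu]_x ((f x) ^+ 2)%:E < +oo)%E ->
  forall e : R, 0 < e -> nbhs 1%g [set g |
    (\int[mu]_x ((koopman_real (rho g) f x - f x) ^+ 2)%:E < e%:E)%E].

Variables (G : topologicalGroupType) (rho : G -> aut_star mu).
Hypothesis rhoM : forall g h, rho (g * h)%g = (rho g * rho h)%g.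

Lemma action1 : rho 1%g = 1%g.
Proof. by apply: (mulgI (rho 1%g)); rewrite -rhoM !mulg1. Qed.

Let msqB (f h : T -> R) : measurable_fun setT f -> measurable_fun setT h ->
  measurable_fun setT (fun x => ((f x - h x) ^+ 2)%:E).
Proof.
move=> mf mh; apply/measurable_EFinP; apply: measurable_funX.
exact: measurable_funB.
Qed.

Lemma continuous_strongly_continuous : continuous rho -> strongly_continuous rho.
Proof.
move=> crho f mf lf e e0; pose F x := (f x +i* 0)%C.
(* The subbase bounds norms and the conclusion squared norms: [r <= 1] gives [r ^+ 2 <= r <= e]. *)
pose r := Num.min 1 e.
have r0 : 0 < r by rewrite lt_min ltr01.
have re : r ^+ 2 <= e.
  apply: le_trans (_ : r <= e); last by rewrite ge_min lexx orbT.
  by rewrite expr2 ger_pMr// ge_min lexx.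
have L2F : L2 mu F by split; apply/Lfun2P => //=; split => //;
  rewrite expr0n /= integral0.
pose U := [set h : aut_star mu |
  (L2norm mu (fun x => (koopman h F x - koopman (1%g : aut_star mu) F x)%R) < r%:E)%E].
have sU : @sot_subbase _ _ _ mu U by exists (1%g : aut_star mu), F, r.
have U1 : U (rho 1%g).
  rewrite action1 /U /= L2norm_lt//.
  under eq_integral do rewrite subrr /= expr0n /= addr0.
  by rewrite integral0 lte_fin exprn_gt0.
have HU : nbhs 1%g (rho @^-1` U).
  exact: (cvg_aut_star _ _).1 (crho 1%g) U sU U1.
apply: filterS HU => g; rewrite /= /U /= L2norm_lt// => gU.
apply: le_lt_trans (lt_le_trans gU _); last by rewrite lee_fin.
apply: (@ae_ge0_le_integral _ _ _ mu setT).
- by [].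
- by move=> x _; rewrite lee_fin sqr_ge0.
- by apply: msqB => //; exact: measurable_koopman_real.
- by move=> x _; rewrite lee_fin addr_ge0// sqr_ge0.
- under eq_fun do rewrite !koopmanE /=.
  apply/measurable_EFinP; apply: measurable_funD; apply: measurable_funX;
  by apply: measurable_funB; exact: measurable_koopman_real.
- apply: filterS (koopman_real1 mu mf) => x <- _; rewrite !koopmanE /= lee_fin.
  by rewrite lerDl sqr_ge0.
Qed.

(** Used with a suitable [t], it brings the coefficient of the main term [a ^+ 2] as close to 1 as
    the slack of a strict inequality demands, at the price of a large factor on the small term
    [b ^+ 2]. *)
Lemma sq_addr_le (a b t : R) : 0 < t ->
  (a + b) ^+ 2 <= (1 + t) * a ^+ 2 + (1 + t^-1) * b ^+ 2.
Proof.
move=> t0; rewrite -subr_ge0.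
rewrite (_ : _ - _ = t^-1 * (t * a - b) ^+ 2); last by field; rewrite gt_eqF.
by rewrite mulr_ge0 ?sqr_ge0// invr_ge0 ltW.
Qed.

Let koopman_sqB (g : aut_star mu) (f h : T -> R) :
  measurable_fun setT f -> measurable_fun setT h ->
  (\int[mu]_x ((koopman_real g f x - koopman_real g h x) ^+ 2)%:E =
   \int[mu]_x ((f x - h x) ^+ 2)%:E)%E.
Proof.
move=> mf mh.
apply: (@koopman_real_comp2 _ _ _ _ g f h (fun p => ((p.1 - p.2) ^+ 2)%:E)) => //.
- apply/measurable_EFinP; apply: measurable_funX; exact: measurable_funB.
- by move=> p; rewrite lee_fin sqr_ge0.
- by move=> c a b _ /=; rewrite -mulrBr exprMn EFinM.
Qed.

(* Isometry of the Koopman operators reduces continuity at [g] to continuity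
   at [1]; the triangle inequality is used in its squared form. *)
Lemma strongly_continuous_continuous : strongly_continuous rho -> continuous rho.
Proof.
move=> sc g0; apply/cvg_aut_star => _ [k [F [e [[/Lfun2P [mf lf] /Lfun2P [mh lh]] e0 ->]]]].
set f := fun x => complex.Re (F x) in mf lf; set h := fun x => complex.Im (F x) in mh lh.
rewrite /= L2norm_lt// => g0U.
pose D (u1 u2 : T -> R) : \bar R := (\int[mu]_x ((u1 x - u2 x) ^+ 2)%:E)%E.
pose kr (g : aut_star mu) u := koopman_real g u.
have mkr g u : measurable_fun setT (kr g u) by exact: measurable_koopman_real.
have D0 u1 u2 : (0 <= D u1 u2)%E.
  by apply: integral_ge0 => x _; rewrite lee_fin sqr_ge0.
have LE (g g' : aut_star mu) :
    (\int[mu]_x ((complex.Re (koopman g F x - koopman g' F x)) ^+ 2 +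
      (complex.Im (koopman g F x - koopman g' F x)) ^+ 2)%:E)%E =
    (D (kr g f) (kr g' f) + D (kr g h) (kr g' h))%E.
  rewrite /D -ge0_integralD//; try (by move=> ? _; rewrite lee_fin sqr_ge0);
    try exact: msqB.
  by apply: eq_integral => x _; rewrite !koopmanE /= EFinD.
have Dadd (t : R) u1 u2 u3 : 0 < t -> measurable_fun setT u1 -> measurable_fun setT u2 ->
    measurable_fun setT u3 ->
    (D u1 u3 <= (1 + t)%:E * D u2 u3 + (1 + t^-1)%:E * D u1 u2)%E.
  move=> t0 m1 m2 m3; have t1 : 0 <= 1 + t by lra.
  have t2 : 0 <= 1 + t^-1 by rewrite addr_ge0// invr_ge0 ltW.
  have sqp (u v : T -> R) x : setT x -> (0 <= ((u x - v x) ^+ 2)%:E)%E.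
    by rewrite lee_fin sqr_ge0.
  have mZ (c : R) (u v : T -> R) : measurable_fun setT u -> measurable_fun setT v ->
      measurable_fun setT (fun x => c%:E * ((u x - v x) ^+ 2)%:E)%E.
    by move=> mu' mv; apply: emeasurable_funM => //; exact: msqB.
  have sqZ (u v : T -> R) (c : R) x : 0 <= c -> setT x ->
      (0 <= c%:E * ((u x - v x) ^+ 2)%:E)%E.
    by move=> c0 _; rewrite mule_ge0// lee_fin sqr_ge0.
  have mm := msqB.
  have DZ (c : R) (u v : T -> R) : 0 <= c -> measurable_fun setT u -> measurable_fun setT v ->
      (c%:E * D u v = \int[mu]_x (c%:E * ((u x - v x) ^+ 2)%:E))%E.
    move=> c0 mu' mv; rewrite ge0_integralZl_EFin//; last exact: msqB.
    by move=> x _; rewrite lee_fin sqr_ge0.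
  rewrite !DZ// -ge0_integralD//; try (by move=> ? _; exact: sqZ);
    try exact: mZ.
  apply: ge0_le_integral => //.
  - by move=> x _; rewrite lee_fin sqr_ge0.
  - exact: msqB.
  - by apply: emeasurable_funD; exact: mZ.
  move=> x _; rewrite -!EFinM -EFinD lee_fin.
  rewrite (_ : u1 x - u3 x = (u2 x - u3 x) + (u1 x - u2 x)); last by ring.
  exact: sq_addr_le.
rewrite LE in g0U; set A := (D _ _ + D _ _)%E in g0U.
have A0 : (0 <= A)%E by rewrite adde_ge0.
have [c cE] : exists c : R, A = c%:E.
  by case: A A0 g0U => [c _ _|//|//]; exists c.
rewrite cE lte_fin in g0U; have c0 : 0 <= c by rewrite -lee_fin -cE.
(* From [c < e ^+ 2], [t] takes at most half of the slack; [del] below is such that the error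
   [(1 + t^-1) (2 del)] fills exactly what remains. *)
have [t t0 tc] : exists2 t : R, 0 < t & (1 + t) * c < e ^+ 2.
  exists ((e ^+ 2 - c) / (2 * (c + 1))).
    by rewrite divr_gt0// ?subr_gt0// mulr_gt0//; lra.
  set t := _ / _; have : t * c <= (e ^+ 2 - c) / 2.
    rewrite /t invfM mulrA -mulrA ler_piMr//; first by lra.
    by rewrite ler_pdivrMl; lra.
  lra.
pose del := (e ^+ 2 - (1 + t) * c) / (2 * (1 + t^-1)).
have t1 : 0 < 1 + t^-1 by rewrite addr_gt0// invr_gt0.
have del0 : 0 < del by rewrite divr_gt0// ?subr_gt0// mulr_gt0.
have Nf := sc f mf lf del del0; have Nh := sc h mh lh del del0.
apply: near_mulg; apply: filterS (filterI Nf Nh) => x [/= xf xh].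
rewrite L2norm_lt// LE.
have step u : measurable_fun setT u -> D (kr (rho (g0 * x)%g) u) (kr (rho g0) u) =
    D (kr (rho x) u) u.
  move=> mu'; rewrite [RHS]/D -(koopman_sqB (rho g0) (mkr _ _) mu'); apply: ge0_ae_eq_integral => //.
  - exact: msqB.
  - exact: msqB.
  - by move=> y _; rewrite lee_fin sqr_ge0.
  - by move=> y _; rewrite lee_fin sqr_ge0.
  - by apply: filterS (koopman_realM (rho g0) (rho x) mu') => y + _; rewrite /kr rhoM => ->.
have b1 := Dadd t _ _ _ t0 (mkr (rho (g0 * x)%g) f) (mkr (rho g0) f) (mkr k f).
have b2 := Dadd t _ _ _ t0 (mkr (rho (g0 * x)%g) h) (mkr (rho g0) h) (mkr k h).
rewrite step// in b1; rewrite step// in b2.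
apply: le_lt_trans (leeD b1 b2) _.
rewrite addeACA -!ge0_muleDr//.
rewrite -[(D _ _ + D _ _)%E]/A cE -EFinM.
have : (D (kr (rho x) f) f + D (kr (rho x) h) h < (2 * del)%:E)%E.
  by rewrite (_ : 2 * del = del + del) ?EFinD ?lteD//; ring.
move=> Hd; apply: lt_le_trans (_ : (((1 + t) * c)%:E + (1 + t^-1)%:E * (2 * del)%:E <= _)%E).
  by rewrite lteD2lE// lte_pmul2l.
rewrite -EFinM -EFinD lee_fin /del le_eqVlt; apply/orP; left; apply/eqP.
by field; rewrite !gt_eqF// addr_gt0.
Qed.

End sot.


Section square_integrals.
Import HBNNSimple.
Context d (T : measurableType d) (R : realType).
Variable mu : {measure set T -> \bar R}.
Implicit Types (f h : T -> R).

Lemma measurable_sq f : measurable_fun setT f ->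
  measurable_fun setT (fun x => ((f x) ^+ 2)%:E).
Proof. by move=> mf; apply/measurable_EFinP; exact: measurable_funX. Qed.

Lemma integral_sqZ c f : measurable_fun setT f ->
  (\int[mu]_x ((c * f x) ^+ 2)%:E = (c ^+ 2)%:E * \int[mu]_x ((f x) ^+ 2)%:E)%E.
Proof.
move=> mf; rewrite -ge0_integralZl_EFin//; last 3 first.
- by move=> x _; rewrite lee_fin sqr_ge0.
- exact: measurable_sq.
- exact: sqr_ge0.
by apply: eq_integral => x _; rewrite exprMn EFinM.
Qed.

Lemma integral_sqD_le f h : measurable_fun setT f -> measurable_fun setT h ->
  (\int[mu]_x ((f x + h x) ^+ 2)%:E <=
   2%:E * \int[mu]_x ((f x) ^+ 2)%:E + 2%:E * \int[mu]_x ((h x) ^+ 2)%:E)%E.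
Proof.
move=> mf mh; have Z (u : T -> R) : measurable_fun setT u ->
    (2%:E * \int[mu]_x ((u x) ^+ 2)%:E = \int[mu]_x (2%:E * ((u x) ^+ 2)%:E))%E.
  move=> mu'; rewrite ge0_integralZl_EFin//; last exact: measurable_sq.
  by move=> x _; rewrite lee_fin sqr_ge0.
have mZ (u : T -> R) : measurable_fun setT u -> measurable_fun setT (fun x => 2%:E * ((u x) ^+ 2)%:E)%E.
  by move=> mu'; apply: emeasurable_funM => //; exact: measurable_sq.
have Z0 (u : T -> R) x : setT x -> (0 <= 2%:E * ((u x) ^+ 2)%:E)%E.
  by move=> _; rewrite mule_ge0// lee_fin sqr_ge0.
rewrite !Z// -ge0_integralD//; try (by move=> ? _; exact: Z0); try exact: mZ.
apply: ge0_le_integral => //.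
- by move=> x _; rewrite lee_fin sqr_ge0.
- by apply: measurable_sq; exact: measurable_funD.
- by apply: emeasurable_funD; exact: mZ.
- move=> x _; rewrite -!EFinM -EFinD lee_fin.
  by have := sq_addr_le (f x) (h x) (@ltr01 R); rewrite invr1.
Qed.

Lemma eq_ae_integral_sq f h : measurable_fun setT f -> measurable_fun setT h ->
  {ae mu, forall x, f x = h x} ->
  (\int[mu]_x ((f x) ^+ 2)%:E = \int[mu]_x ((h x) ^+ 2)%:E)%E.
Proof.
move=> mf mh fh; apply: ge0_ae_eq_integral => //; try (by move=> ? _; rewrite lee_fin sqr_ge0);
  try exact: measurable_sq.
by apply: filterS fh => x -> _.
Qed.

Lemma integral_sq_approx f (e : R) : measurable_fun setT f ->
  (forall x, 0 <= f x) -> (\int[mu]_x ((f x) ^+ 2)%:E < +oo)%E -> 0 < e ->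
  exists k : {nnsfun T >-> R}, (forall x, k x <= f x) /\
    (\int[mu]_x ((f x - k x) ^+ 2)%:E < e%:E)%E.
Proof.
move=> mf f0 lf e0; have mef : measurable_fun setT (EFin \o f) by exact/measurable_EFinP.
pose k := nnsfun_approx measurableT mef.
have kcvg x : (fun n => k n x) @ \oo --> f x.
  have := @cvg_nnsfun_approx _ _ _ _ measurableT _ mef (fun x _ => f0 x) x I.
  by move/fine_cvgP => [].
have kf n x : k n x <= f x.
  rewrite -(cvg_lim (@Rhausdorff R) (kcvg x)); apply: nondecreasing_cvgn_le.
    by move=> i j ij; exact/lefP/nd_nnsfun_approx.
  by apply/cvg_ex; exists (f x); exact: kcvg.
have mk n : measurable_fun setT (fun x => f x - k n x) by exact: measurable_funB.
have : (\int[mu]_x ((f x - k n x) ^+ 2)%:E)%E @[n --> \oo] --> (\int[mu]_x (cst 0%E x))%E.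
  apply: (@dominated_cvg _ _ _ mu setT measurableT
    (fun n x => ((f x - k n x) ^+ 2)%:E) _ (fun x => ((f x) ^+ 2)%:E)) => //.
  - by move=> n; exact: measurable_sq.
  - move=> x _; apply: cvg_EFin; first exact: nearW.
    have fk0 : (fun n => f x - k n x) @ \oo --> (0 : R).
      by rewrite -(subrr (f x)); apply: cvgB; [exact: cvg_cst|exact: kcvg].
    by have H := cvgM fk0 fk0; rewrite mulr0 in H; exact: H.
  - apply/integrableP; split; first exact: measurable_sq.
    by under eq_integral do rewrite gee0_abs ?lee_fin ?sqr_ge0//.
  - move=> n x _; rewrite gee0_abs ?lee_fin ?sqr_ge0//.
    by rewrite ler_sqr ?nnegrE ?subr_ge0// gerBl.
rewrite integral0 => /fine_cvgP [finI /cvgrPdist_lt /(_ _ e0) [N _ NP]].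
have [M _ MP] := finI.
pose n := maxn N M; exists (k n); split => //.
have /MP /= fin := leq_maxr N M.
have := NP n (leq_maxl N M); rewrite /= sub0r normrN ger0_norm; last first.
  by rewrite fine_ge0// integral_ge0// => x _; rewrite lee_fin sqr_ge0.
by rewrite -lte_fin fineK.
Qed.

End square_integrals.


Section koopman_linear.
Context d (T : measurableType d) (R : realType).
Variable mu : {sigma_finite_measure set T -> \bar R}.
Variable g : aut_star mu.
Implicit Types (f h : T -> R).

Lemma koopman_realD f h : measurable_fun setT f -> measurable_fun setT h ->
  {ae mu, forall x, koopman_real g (fun y => f y + h y) x =
    koopman_real g f x + koopman_real g h x}.
Proof.
move=> mf mh; have mfh : measurable_fun setT (fun y => f y + h y) by exact: measurable_funD.
have mphi : measurable_fun setT (fun p : R * R => p.1 + p.2) by exact: measurable_funD.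
have t := translates_to_comp mphi
  (translates_to_pair mf mh (translateP g mf) (translateP g mh)).
have := translates_to_unique mfh mfh (aeW mu (fun x => erefl)) (translateP g mfh) t.
by apply: filterS => x; rewrite /koopman_real => -> /=; rewrite mulrDr.
Qed.

Lemma koopman_realZ c f : measurable_fun setT f ->
  {ae mu, forall x, koopman_real g (fun y => c * f y) x = c * koopman_real g f x}.
Proof.
move=> mf; have mcf : measurable_fun setT (fun y => c * f y) by exact: measurable_funM.
have mphi : measurable_fun setT (fun r : R => c * r) by exact: measurable_funM.
have t := translates_to_comp mphi (translateP g mf).
have := translates_to_unique mcf mcf (aeW mu (fun x => erefl)) (translateP g mcf) t.
by apply: filterS => x; rewrite /koopman_real => -> /=; rewrite mulrCA.
Qed.

Lemma koopman_real_indic A : aut mu g -> measurable A ->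
  {ae mu, forall x, koopman_real g (\1_A) x = \1_(malg_repr (g (malg_class mu A))) x}.
Proof.
move=> ag mA; have mI : measurable_fun setT (\1_A : T -> R) by exact: measurable_indic.
have d1 : is_density g (cst 1 : T -> R).
  split => // B mB; rewrite -ag aut_starKV malg_measure_class//.
  by rewrite -[RHS]/(\int[mu]_(x in B) (cst 1%E x))%E integral_cst// mul1e.
have e1 := density_unique (rn_derivativeP g) d1.
have e2 := translates_to_unique mI mI (aeW mu (fun x => erefl)) (translateP g mI)
  (translates_to_indic g mA).
by apply: filterS2 e1 e2 => x; rewrite /koopman_real => -> ->; rewrite sqrtr1 mul1r.
Qed.

End koopman_linear.

(** * Strong continuity of measure-preserving homomorphisms *)

Section measure_preserving_continuity.
Context d (T : measurableType d) (R : realType).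
Variable mu : {sigma_finite_measure set T -> \bar R}.
Variables (G : topologicalGroupType) (rho : G -> aut_star mu).
Hypothesis rho_mp : forall g, aut mu (rho g).
Hypothesis rho_set : forall B (e : R), measurable B -> (mu B < +oo)%E -> 0 < e ->
  nbhs 1%g [set g | (mu (B `\` malg_repr (rho g (malg_class mu B))) < e%:E)%E].
Import HBNNSimple.

Let near_fixed (f : T -> R) := forall e : R, 0 < e -> nbhs 1%g [set g |
    (\int[mu]_x ((koopman_real (rho g) f x - f x) ^+ 2)%:E < e%:E)%E].

Let mkr g f := measurable_koopman_real (rho g) f.

Let mkrB g f : measurable_fun setT f ->
  measurable_fun setT (fun x => koopman_real (rho g) f x - f x).
Proof. by move=> mf; apply: measurable_funB. Qed.

Let near_fixedD (f h : T -> R) : measurable_fun setT f -> measurable_fun setT h ->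
  near_fixed f -> near_fixed h -> near_fixed (fun x => f x + h x).
Proof.
move=> mf mh nf nh e e0; have e4 : 0 < e / 4 by rewrite divr_gt0.
apply: filterS (filterI (nf _ e4) (nh _ e4)) => g [/= gf gh].
have mfh : measurable_fun setT (fun y => f y + h y) by exact: measurable_funD.
have := integral_sqD_le mu (mkrB g mf) (mkrB g mh).
rewrite (@eq_ae_integral_sq _ _ _ mu _
  (fun x => koopman_real (rho g) (fun y => f y + h y) x - (f x + h x))); last first.
- by apply: filterS (koopman_realD (rho g) mf mh) => x ->; ring.
- exact: mkrB.
- by apply: measurable_funD; exact: mkrB.
move=> /le_lt_trans; apply.
apply: lt_le_trans (_ : 2%:E * (e / 4)%:E + 2%:E * (e / 4)%:E <= _)%E.
  by rewrite lteD// lte_pmul2l.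
by rewrite -!EFinM -EFinD lee_fin; lra.
Qed.

Let near_fixedZ c (f : T -> R) : measurable_fun setT f ->
  near_fixed f -> near_fixed (fun x => c * f x).
Proof.
move=> mf nf e e0; have c1 : 0 < c ^+ 2 + 1 by rewrite ltr_wpDl ?sqr_ge0.
have ec : 0 < e / (c ^+ 2 + 1) by rewrite divr_gt0.
apply: filterS (nf _ ec) => g /= gf.
have mcf : measurable_fun setT (fun y => c * f y) by exact: measurable_funM.
rewrite (@eq_ae_integral_sq _ _ _ mu _
  (fun x => c * (koopman_real (rho g) f x - f x))); last first.
- by apply: filterS (koopman_realZ (rho g) c mf) => x ->; ring.
- by apply: measurable_funM => //; exact: mkrB.
- exact: mkrB.
rewrite integral_sqZ; last exact: mkrB.
have : ((c ^+ 2 + 1)%:E * \int[mu]_x ((koopman_real (rho g) f x - f x) ^+ 2)%:E < e%:E)%E.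
  by rewrite muleC -lte_pdivlMr// EFinM -?EFinM.
apply: le_lt_trans; apply: lee_wpmul2r; last by rewrite lee_fin lerDl.
by apply: integral_ge0 => x _; rewrite lee_fin sqr_ge0.
Qed.

Let near_fixed_indic B : measurable B -> (mu B < +oo)%E -> near_fixed (\1_B : T -> R).
Proof.
move=> mB fB e e0; have e2 : 0 < e / 2 by rewrite divr_gt0.
apply: filterS (rho_set mB fB e2) => g /= gB.
set B' := malg_repr _ in gB; have mB' : measurable B' by exact: measurable_malg_repr.
have BB' : mu B' = mu B.
  by have := rho_mp g (malg_class mu B); rewrite malg_measure_class.
have mI := @measurable_indic _ T R setT B mB.
have mI' := @measurable_indic _ T R setT B' mB'.
rewrite (@eq_ae_integral_sq _ _ _ mu _ (fun x => \1_B' x - \1_B x)); last first.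
- by apply: filterS (koopman_real_indic (rho_mp g) mB) => x ->.
- exact: measurable_funB.
- exact: mkrB.
have mD := measurableD mB mB'; have mD' := measurableD mB' mB.
have BD : mu B = (mu (B `\` B') + mu (B `&` B'))%E by exact: measureDI.
have BD' : mu B' = (mu (B' `\` B) + mu (B' `&` B))%E by exact: measureDI.
(* Sets of equal finite measure have differences of equal measure, so the one-sided bound of
   [rho_set] controls the symmetric difference. *)
have DD : mu (B' `\` B) = mu (B `\` B').
  have fI : mu (B `&` B') \is a fin_num.
    rewrite ge0_fin_numE//; apply: le_lt_trans fB.
    by apply: le_measure; rewrite ?inE//; exact: measurableI.
  have := BB'; rewrite BD BD' (setIC B') => BBI.
  by rewrite -[LHS](addeK _ fI) BBI addeK.
have -> : (\int[mu]_x ((\1_B' x - \1_B x) ^+ 2)%:E = mu ((B' `\` B) `|` (B `\` B')))%E.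
  rewrite -[X in mu X]setIT -integral_indic//; last exact: measurableU.
  apply: eq_integral => x _; congr EFin; rewrite !indicE.
  have [b'|b'] := pselect (B' x); have [b|b] := pselect (B x).
  - rewrite (mem_set b) (mem_set b') memNset; first by rewrite subrr expr0n.
    by case=> -[].
  - rewrite (memNset b) (mem_set b') mem_set; first by rewrite subr0 expr1n.
    by left.
  - rewrite (mem_set b) (memNset b') mem_set; first by rewrite sub0r sqrrN expr1n.
    by right.
  - rewrite (memNset b) (memNset b') memNset; first by rewrite subrr expr0n.
    by case=> -[].
have U2 : (mu ((B' `\` B) `|` (B `\` B')) <= mu (B' `\` B) + mu (B `\` B'))%E.
  exact: measureU2.
by apply: le_lt_trans U2 _; rewrite DD [e]splitr EFinD lteD.
Qed.

Let near_fixed_approx (f : T -> R) : measurable_fun setT f ->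
  (forall e : R, 0 < e -> exists h : T -> R, [/\ measurable_fun setT h, near_fixed h &
    (\int[mu]_x ((f x - h x) ^+ 2)%:E < e%:E)%E]) -> near_fixed f.
Proof.
move=> mf H e e0; have e20 : 0 < e / 20 by rewrite divr_gt0.
have [h [mh nh fh]] := H _ e20.
apply: filterS (nh _ e20) => g /= gh.
have mfh : measurable_fun setT (fun x => f x - h x) by exact: measurable_funB.
have iso : (\int[mu]_x ((koopman_real (rho g) f x - koopman_real (rho g) h x) ^+ 2)%:E =
    \int[mu]_x ((f x - h x) ^+ 2)%:E)%E.
  apply: (@koopman_real_comp2 _ _ _ _ (rho g) f h (fun p => ((p.1 - p.2) ^+ 2)%:E)) => //.
  - by apply: measurable_sq; exact: measurable_funB.
  - by move=> p; rewrite lee_fin sqr_ge0.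
  - by move=> c a b _ /=; rewrite -mulrBr exprMn EFinM.
have hf : (\int[mu]_x ((h x - f x) ^+ 2)%:E = \int[mu]_x ((f x - h x) ^+ 2)%:E)%E.
  by apply: eq_integral => x _; rewrite -sqrrN opprB.
have mk : measurable_fun setT (fun x => koopman_real (rho g) f x - koopman_real (rho g) h x).
  exact: measurable_funB.
have mhf : measurable_fun setT (fun x => h x - f x) by exact: measurable_funB.
have mhk := mkrB g mh.
have mhkf : measurable_fun setT (fun x => (koopman_real (rho g) h x - h x) + (h x - f x)).
  exact: measurable_funD.
have h1 := integral_sqD_le mu mk mhkf.
have h2 := integral_sqD_le mu mhk mhf.
rewrite iso in h1; rewrite hf in h2.
rewrite (eq_integral (fun x => ((koopman_real (rho g) f x - koopman_real (rho g) h x +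
  (koopman_real (rho g) h x - h x + (h x - f x))) ^+ 2)%:E)); last first.
  by move=> x _; congr ((_ ^+ 2)%:E); ring.
apply: le_lt_trans h1 _.
have {h2} h3 : (\int[mu]_x ((koopman_real (rho g) h x - h x + (h x - f x)) ^+ 2)%:E < (e / 5)%:E)%E.
  apply: le_lt_trans h2 _.
  apply: lt_le_trans (_ : 2%:E * (e / 20)%:E + 2%:E * (e / 20)%:E <= _)%E.
    by rewrite lteD// lte_pmul2l.
  by rewrite -!EFinM -EFinD lee_fin; lra.
apply: lt_le_trans (_ : 2%:E * (e / 20)%:E + 2%:E * (e / 5)%:E <= _)%E.
  by rewrite lteD// lte_pmul2l.
by rewrite -!EFinM -EFinD lee_fin; lra.
Qed.

Let near_fixed_ge0 (f : T -> R) : measurable_fun setT f -> (forall x, 0 <= f x) ->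
  (\int[mu]_x ((f x) ^+ 2)%:E < +oo)%E -> near_fixed f.
Proof.
move=> mf f0 lf; apply: near_fixed_approx => // e e0.
have [k [kf ke]] := integral_sq_approx mf f0 lf e0.
exists k; split => //.
(* Chebyshev's inequality: on the level set, [r ^+ 2 = (k x) ^+ 2 <= (f x) ^+ 2]. *)
have level r : 0 < r -> (mu (k @^-1` [set r]) < +oo)%E.
  move=> r0; have mA : measurable (k @^-1` [set r]) by exact: measurable_preimage.
  have r2 : 0 < r ^+ 2 by rewrite exprn_gt0.
  have : ((r ^+ 2)%:E * mu (k @^-1` [set r]) <= \int[mu]_x ((f x) ^+ 2)%:E)%E.
    rewrite -[X in mu X]setIT -integral_indic// -ge0_integralZl_EFin ?(ltW r2)//; last first.
      by apply/measurable_EFinP; exact: measurable_indic.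
    apply: ge0_le_integral => //.
    - by move=> x _; rewrite -EFinM lee_fin mulr_ge0// ltW.
    - apply: emeasurable_funM => //; apply/measurable_EFinP; exact: measurable_indic.
    - exact: measurable_sq.
    - move=> x _; rewrite -EFinM lee_fin indicE.
      have [kx|nk] := pselect (k x = r); last by rewrite memNset// mulr0 sqr_ge0.
      by rewrite mem_set// mulr1 -kx ler_sqr ?nnegrE.
  move=> /le_lt_trans /(_ lf); rewrite -[ltLHS]muleC; case: (mu (k @^-1` [set r])) => [s _|+|]; rewrite ?ltry ?ltNyr//.
  by rewrite gt0_mulye ?lte_fin.
have mA r : measurable (k @^-1` [set r]) by exact: measurable_preimage.
have nterm r : near_fixed (fun x => r * \1_(k @^-1` [set r]) x).
  have [r0|r0|->] := ltgtP r 0.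
  - have -> : k @^-1` [set r] = set0.
      by rewrite -subset0 => x /= kx; have : 0 <= k x by []; rewrite kx leNgt r0.
    apply: near_fixedZ; first exact: measurable_indic.
    by apply: near_fixed_indic; rewrite ?measure0.
  - apply: near_fixedZ; first exact: measurable_indic.
    by apply: near_fixed_indic => //; exact: level.
  (* The level set of 0 may have infinite measure; its coefficient being 0, it is replaced by the
     empty set. *)
  - have -> : (fun x => 0 * \1_(k @^-1` [set 0]) x) = (fun x => 0 * \1_(set0 : set T) x) :> (T -> R).
      by apply/funext => x; rewrite !mul0r.
    apply: (@near_fixedZ 0 \1_set0); first exact: measurable_indic.
    by apply: near_fixed_indic; rewrite ?measure0.
have mterm r : measurable_fun setT (fun x => r * \1_(k @^-1` [set r]) x).
  by apply: measurable_funM => //; exact: measurable_indic.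
have -> : (k : T -> R) = fun x => \sum_(r <- (finmap.enum_fset (fset_set (range k)))) r * \1_(k @^-1` [set r]) x.
  by apply/funext => x; rewrite [LHS]fimfunE fsbig_finite.
suff : forall s : seq R, measurable_fun setT (fun x => \sum_(r <- s) r * \1_(k @^-1` [set r]) x) /\
    near_fixed (fun x => \sum_(r <- s) r * \1_(k @^-1` [set r]) x).
  by move=> /(_ (finmap.enum_fset (fset_set (range k)))) [].
elim=> [|r s [ms ns]].
  have -> : (fun x => \sum_(r <- [::]) r * \1_(k @^-1` [set r]) x) = \1_(set0 : set T) :> (T -> R).
    by apply/funext => x; rewrite big_nil indicE in_set0.
  split; first exact: measurable_indic.
  by apply: near_fixed_indic; rewrite ?measure0.
have -> : (fun x => \sum_(r' <- r :: s) r' * \1_(k @^-1` [set r']) x) =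
    (fun x => r * \1_(k @^-1` [set r]) x + \sum_(r' <- s) r' * \1_(k @^-1` [set r']) x) :> (T -> R).
  by apply/funext => x; rewrite big_cons.
split; first exact: measurable_funD.
exact: (near_fixedD (mterm r) ms (nterm r) ns).
Qed.

(** The functions almost fixed near the identity are closed under linear combinations and L^2
    limits, so indicators of sets of finite measure suffice; on these the Koopman operator merely
    moves the set, the density being 1. *)
Lemma measure_preserving_strongly_continuous : strongly_continuous rho.
Proof.
move=> f mf lf.
pose fp x := Num.max (f x) 0; pose fm x := Num.max (- f x) 0.
have mN : measurable_fun setT (fun x => - f x) by exact: measurable_funN.
have mp : measurable_fun setT fp by apply: measurable_maxr.
have mm : measurable_fun setT fm by apply: measurable_maxr.
have fE : f = fun x => fp x + -1 * fm x.
  apply/funext => x; rewrite /fp /fm mulN1r.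
  case/orP: (le_total 0 (f x)) => x0.
    by rewrite (max_l x0) max_r ?subr0// oppr_le0.
  by rewrite (max_r x0) max_l ?oppr_ge0// add0r opprK.
have lt_sq (h : T -> R) : measurable_fun setT h -> (forall x, (h x) ^+ 2 <= (f x) ^+ 2) ->
    (\int[mu]_x ((h x) ^+ 2)%:E < +oo)%E.
  move=> mh hf; refine (le_lt_trans _ lf); apply: ge0_le_integral => //.
  - by move=> x _; rewrite lee_fin sqr_ge0.
  - exact: measurable_sq.
  - exact: measurable_sq.
  - by move=> x _; rewrite lee_fin.
rewrite fE; apply: near_fixedD => //; first exact: measurable_funM.
  apply: near_fixed_ge0 => //; first by move=> x; rewrite le_max lexx orbT.
  apply: lt_sq => // x; rewrite /fp; case: (lerP 0 (f x)) => // _.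
  by rewrite expr0n sqr_ge0.
apply: near_fixedZ => //; apply: near_fixed_ge0 => //.
  by move=> x; rewrite le_max lexx orbT.
apply: lt_sq => // x; rewrite /fm; case: (lerP 0 (- f x)) => // _; first by rewrite sqrrN.
by rewrite expr0n sqr_ge0.
Qed.

End measure_preserving_continuity.

(** * Factor actions *)


(** An equation between bundled measures, so that rewriting with it carries along the types
    [malg nu] and the actions on them. It applies to induced and disjoint union measures, whose
    sigma-finiteness is proved separately. *)
Lemma ex_sigma_finite_measure d (T : measurableType d) (R : realType)
    (nu : {measure set T -> \bar R}) : sigma_finite setT nu ->
  exists nu' : {sigma_finite_measure set T -> \bar R},
    nu = nu' :> {measure set T -> \bar R}.
Proof.
case: nu => f c sf.
pose nu0 : {measure set T -> \bar R} := Measure.Pack c.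
pose m := Measure_isSigmaFinite.Build d T R nu0 sf.
pose nu' : {sigma_finite_measure set T -> \bar R} := HB.pack (Measure.sort nu0) m.
exists nu'.
by case: c @nu0 sf @m @nu'.
Qed.


Lemma malg_measure_eq0 d (T : measurableType d) (R : realType)
    (nu : {measure set T -> \bar R}) (b : malg nu) :
  malg_measure b = 0%E <-> b = \bot%O.
Proof.
have mb : measurable (malg_repr b) by exact: measurable_malg_repr.
by rewrite -{2}(malg_reprK b) (malg_class_eq0 _ mb).
Qed.

Section factor.
Context d1 d2 (T1 : measurableType d1) (T2 : measurableType d2) (R : realType).
Variables (mu : {sigma_finite_measure set T1 -> \bar R}).
Variables (nu : {sigma_finite_measure set T2 -> \bar R}).
Variables (H : topologicalGroupType) (rho : nonsingular_action H mu).
Variable F : malg mu -> malg nu.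
Hypothesis sF : sigma_morphism F.
Hypothesis F_surj : forall b, exists a, F a = b.
Hypothesis F_mp : forall h a, malg_measure (F (rho h a)) = malg_measure (F a).

Let rhoK h : cancel (rho h) (rho (h^-1)%g).
Proof.
move=> a; rewrite -[LHS]/((rho (h^-1) * rho h)%g a) -(actionM rho) mulVg.
by rewrite (action1 (actionM rho)).
Qed.

(** An inclusion means that a difference is null, and by [F_mp] being null in the factor is
    preserved by [rho h]. Hence [F a] determines [F (rho h a)]. *)
Let F_le h a a' : (F a <= F a')%O -> (F (rho h a) <= F (rho h a'))%O.
Proof.
have key b b' : (F b <= F b')%O <-> F (b `&` ~` b')%O = \bot%O.
  rewrite (sigma_morphismI sF) (sigma_morphismC sF).
  by rewrite -{1}[F b']complK -disj_leC; split => /eqP.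
have sr := aut_sigma_morphism (rho h).
rewrite !key => /malg_measure_eq0; rewrite -(F_mp h) => /malg_measure_eq0.
by rewrite (sigma_morphismI sr) (sigma_morphismC sr).
Qed.

Let F_eq h a a' : F a = F a' -> F (rho h a) = F (rho h a').
Proof. by move=> E; apply/eqP; rewrite eq_le !F_le// E. Qed.

Let s b := sval (cid (F_surj b)).
Let sE b : F (s b) = b. Proof. by rewrite /s; case: cid. Qed.

Let tau_fun h b := F (rho h (s b)).

Let tauE h a : tau_fun h (F a) = F (rho h a).
Proof. by apply: F_eq; rewrite sE. Qed.

Let tauK h : cancel (tau_fun h) (tau_fun h^-1%g).
Proof. by move=> b; rewrite -(sE b) !tauE rhoK. Qed.

Let tau_iso h : boolean_iso (tau_fun h).
Proof.
have sr := aut_sigma_morphism (rho h); split.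
- by exists (tau_fun h^-1%g) => // b; rewrite -{1}(invgK h) tauK.
- move=> b b'; rewrite -(sE b) -(sE b') -(sigma_morphismI sF) !tauE.
  by rewrite (sigma_morphismI sr) (sigma_morphismI sF).
- move=> b b'; rewrite -(sE b) -(sE b') -(sigma_morphismU sF) !tauE.
  by rewrite (sigma_morphismU sr) (sigma_morphismU sF).
- move=> b; rewrite -(sE b) -(sigma_morphismC sF) !tauE.
  by rewrite (sigma_morphismC sr) (sigma_morphismC sF).
Qed.

Let tau h := AutStar (tau_iso h).

Let tauM g h : tau (g * h)%g = (tau g * tau h)%g.
Proof.
by apply: aut_starP => b /=; rewrite -(sE b) !tauE (actionM rho).
Qed.

Let tau_mp h : aut nu (tau h).
Proof. by move=> b; have := F_mp h (s b); rewrite sE. Qed.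

(* Let [xi] be the density of [A |-> nu (F A `&` B)] and choose [A] with
   [F A = B].  The function [f], equal to [sqrt xi] on [A] and to [0] elsewhere,
   satisfies [nu (B `\` h B) = \int_(A `\` h A) xi <= |h f - f| ^ 2]. *)
Let tau_set B (e : R) : measurable B -> (nu B < +oo)%E -> 0 < e ->
  nbhs 1%g [set g | (nu (B `\` malg_repr (tau g (malg_class nu B))) < e%:E)%E].
Proof.
move=> mB fB e0; have [xi [mxi xi0 xiE]] := pullback_density sF mB fB.
pose A := malg_repr (s (malg_class nu B)).
have mA : measurable A by exact: measurable_malg_repr.
have FA : F (malg_class mu A) = malg_class nu B by rewrite malg_reprK sE.
pose f x := (\1_A x : R) * Num.sqrt (xi x).
have mf : measurable_fun setT f.
  apply: measurable_funM; first exact: measurable_indic.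
  by apply: measurableT_comp => //; exact: continuous_measurable_fun (@sqrt_continuous R).
have f2 x : A x -> f x ^+ 2 = xi x.
  by move=> Ax; rewrite /f indicE mem_set// mul1r sqr_sqrtr.
have f0 x : ~ A x -> f x = 0 by move=> nA; rewrite /f indicE memNset// mul0r.
have lf : (\int[mu]_x ((f x) ^+ 2)%:E < +oo)%E.
  have -> : (\int[mu]_x ((f x) ^+ 2)%:E = \int[mu]_(x in A) (xi x)%:E)%E.
    rewrite [RHS]integral_mkcond; apply: eq_integral => x _; rewrite patchE.
    by case: ifPn => [/set_mem/f2 ->//|/negP nA]; rewrite f0 ?expr0n// => /mem_set.
  rewrite -xiE//; apply: le_lt_trans fB.
  apply: le_measure; rewrite ?inE//.
  by apply: measurableI => //; exact: measurable_malg_repr.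
have cont := continuous_strongly_continuous (actionM rho) (@action_continuous _ _ _ _ _ rho).
apply: filterS (cont f mf lf e e0) => h /=; apply: le_lt_trans.
pose A' := malg_repr (rho h (malg_class mu A)).
have mA' : measurable A' by exact: measurable_malg_repr.
have mAA' : measurable (A `\` A') by exact: measurableD.
have -> : nu (B `\` malg_repr (tau h (malg_class nu B))) =
    (\int[mu]_(x in A `\` A') (xi x)%:E)%E.
  have mt : measurable (malg_repr (tau h (malg_class nu B))) by exact: measurable_malg_repr.
  rewrite -xiE//; apply: mu_eq_class.
  - exact: measurableD.
  - by apply: measurableI => //; exact: measurable_malg_repr.
  - rewrite setDE (malg_classI nu mB (measurableC mt)).
    rewrite (malg_classI nu (measurable_malg_repr _) mB) !malg_reprK.
    rewrite setDE (malg_classI mu mA (measurableC mA')) (sigma_morphismI sF) FA.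
    rewrite (malg_classC nu mt) (malg_classC mu mA') (sigma_morphismC sF) !malg_reprK.
    have -> : tau h (malg_class nu B) = F (rho h (malg_class mu A)).
      by rewrite -FA; exact: tauE.
    by rewrite meetAC meetxx malg_reprK.
have mk := measurable_koopman_real (rho h) f.
have md : measurable_fun setT (fun x => koopman_real (rho h) f x - f x).
  exact: measurable_funB.
have supp := koopman_real_support (rho h) mf mA (aeW mu f0).
have -> : (\int[mu]_(x in A `\` A') (xi x)%:E =
    \int[mu]_(x in A `\` A') ((koopman_real (rho h) f x - f x) ^+ 2)%:E)%E.
  apply: ae_eq_integral => //.
  - by apply/measurable_EFinP; exact: measurable_funTS.
  - by apply: measurable_funTS; exact: measurable_sq.
  - by apply: filterS supp => x kx [Ax A'x]; rewrite kx// sub0r sqrrN f2.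
apply: ge0_subset_integral => //.
- exact: measurable_sq.
- by move=> x _; rewrite lee_fin sqr_ge0.
Qed.

Theorem factor_action : exists tau : nonsingular_action H nu,
  measure_preserving tau /\ forall h a, tau h (F a) = F (rho h a).
Proof.
have ctau := strongly_continuous_continuous tauM
  (measure_preserving_strongly_continuous tau_mp tau_set).
by exists (NonsingularAction tauM ctau); split => // h a; exact: tauE.
Qed.

End factor.

(** * Pieces of a nonsingular action *)


Section koopman_L2.
Context d (T : measurableType d) (R : realType).
Variables (mu : {sigma_finite_measure set T -> \bar R}).
Variables (G : topologicalGroupType) (sigma : nonsingular_action G mu).

Local Notation E := (LfunType mu (lee1n 2)).
Local Notation dot := (@L2dot _ _ _ mu).
Local Notation sq x := (dot x x).

Lemma measurable_L2 (f : E) : measurable_fun setT f.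
Proof. by have /Lfun2P[] := LfunP f. Qed.

Lemma L2_lt (f : E) : (\int[mu]_x ((f x) ^+ 2)%:E < +oo)%E.
Proof. by have /Lfun2P[] := LfunP f. Qed.

Let mE := measurable_L2.

Lemma L2_sq_eq0 (x y : E) : sq (x - y) = 0 <-> {ae mu, forall t, x t = y t}.
Proof.
have xyE t : (x - y) t = x t - y t by [].
rewrite L2dot_eq0; split; apply: filterS => t; rewrite xyE.
  by move/eqP; rewrite subr_eq0 => /eqP.
by move=> ->; rewrite subrr.
Qed.

Let koopman_sq g (f : E) : (\int[mu]_x ((koopman_real (sigma g) f x) ^+ 2)%:E =
  \int[mu]_x ((f x) ^+ 2)%:E)%E.
Proof.
apply: (@koopman_real_comp2 _ _ _ _ (sigma g) f f (fun p => ((p.1) ^+ 2)%:E)) => //.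
- exact: measurable_sq.
- by move=> p; rewrite lee_fin sqr_ge0.
- by move=> c a b _ /=; rewrite exprMn EFinM.
Qed.

Let koopman_lt g (f : E) :
  (\int[mu]_x ((koopman_real (sigma g) f x) ^+ 2)%:E < +oo)%E.
Proof. by rewrite koopman_sq; exact: L2_lt. Qed.

Definition koopman_L2 g (f : E) : E :=
  toL2 (measurable_koopman_real (sigma g) f) (koopman_lt g f).
Local Notation K := koopman_L2.

Lemma koopman_L2M g h x : sq (K (g * h)%g x - K g (K h x)) = 0.
Proof.
by apply/L2_sq_eq0; rewrite /= actionM; exact: (koopman_realM (sigma g) (sigma h) (mE x)).
Qed.

Lemma koopman_L21 x : sq (K 1%g x - x) = 0.
Proof.
apply/L2_sq_eq0; rewrite /= (action1 (actionM sigma)).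
exact: (koopman_real1 mu (mE x)).
Qed.

Let L2dotN2 (x y : E) : sq (x + y) = sq x + sq y + 2 * dot x y.
Proof.
rewrite L2dotDl (L2dotC x) (L2dotC y) !L2dotDl (L2dotC y x).
by ring.
Qed.

Lemma koopman_L2dot g x y : dot (K g x) (K g y) = dot x y.
Proof.
have e1 z : sq (K g z) = sq z by apply: EFin_inj; rewrite !L2dotE; exact: koopman_sq.
have : sq (K g x + K g y) = sq (x + y).
  apply: EFin_inj; rewrite !L2dotE.
  apply: (@koopman_real_comp2 _ _ _ _ (sigma g) x y (fun p => ((p.1 + p.2) ^+ 2)%:E)) => //.
  - by apply: measurable_sq; exact: measurable_funD.
  - by move=> p; rewrite lee_fin sqr_ge0.
  - by move=> c a b _ /=; rewrite -mulrDr exprMn EFinM.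
by rewrite !L2dotN2 !e1 => /addrI; lra.
Qed.

Lemma koopman_L2_continuous x (e : R) : 0 < e ->
  nbhs 1%g [set g | sq (K g x - x) < e].
Proof.
move=> e0; have cont := continuous_strongly_continuous (actionM sigma)
  (@action_continuous _ _ _ _ _ sigma).
apply: filterS (cont x (mE x) (L2_lt x) e e0) => g /=.
by rewrite -lte_fin L2dotE.
Qed.

(** As an open [U] has finitely many double cosets, a [U]-fixed vector has finitely many
    coefficients. *)
Lemma koopman_L2_double_coset (U : groupClosed G) (f : E) u x v :
  (forall u, u \in U -> sq (K u f - f) = 0) -> u \in U -> v \in U ->
  dot (K (u * x * v)%g f) f = dot (K x f) f.
Proof.
move=> Uf uU vU.
have ae1 : {ae mu, forall t, K (u * x * v)%g f t = K u (K x f) t}.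
  have h1 := iffLR (L2_sq_eq0 _ _) (koopman_L2M (u * x)%g v f).
  have h2 := iffLR (L2_sq_eq0 _ _) (koopman_L2M u x f).
  have h3 := koopman_real_ae_eq (sigma (u * x)%g) (mE (K v f)) (mE f)
    (iffLR (L2_sq_eq0 _ _) (Uf v vU)).
  apply: filterS3 h1 h2 h3 => t -> <-; exact.
have ae2 : {ae mu, forall t, f t = K u f t}.
  by have := iffLR (L2_sq_eq0 _ _) (Uf u uU); apply: filterS => t ->.
by rewrite (L2dot_ae_eq ae1 ae2) koopman_L2dot.
Qed.

Section invariant_set.
Variable Z : malg mu.
Hypothesis Z_inv : forall g, sigma g Z = Z.

(** Signs outside [Z] are free, so that the dual cone consists of the nonnegative functions
    vanishing outside [Z] ([dual_ge0_onP]); this keeps the piece inside [Z]. *)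
Definition ge0_on : set E :=
  [set y | {ae mu, forall t, malg_repr Z t -> 0 <= y t}].

Let mZ : measurable (malg_repr Z) := measurable_malg_repr _.

Lemma koopman_L2_ge0_on g y : ge0_on y -> ge0_on (K g y).
Proof.
move=> y0; have mN : measurable (`]-oo, 0%R[ : set R) by exact: measurable_itv.
have [mt /(_ _ mN) tE] := translateP (sigma g) (mE y).
set t := translate _ _ in mt tE.
have mY : measurable (y @^-1` `]-oo, 0%R[) by exact: measurable_preimage.
have mT : measurable (t @^-1` `]-oo, 0%R[) by exact: measurable_preimage.
have le0 A : measurable A -> (malg_class mu A <= ~` Z)%O <->
    {ae mu, forall x, ~ (A `&` malg_repr Z) x}.
  move=> mA; rewrite -malg_class0_ae; last exact: measurableI.
  by rewrite malg_classI// malg_reprK -disj_leC; split => /eqP.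
have : {ae mu, forall x, ~ ((t @^-1` `]-oo, 0%R[) `&` malg_repr Z) x}.
  apply/le0 => //; rewrite tE -(Z_inv g) -(sigma_morphismC (aut_sigma_morphism _)).
  apply: sigma_morphism_le; first exact: aut_sigma_morphism.
  by apply/le0 => //; apply: filterS y0 => x yx [/=]; rewrite in_itv /= => /lt_geF y0' /yx; rewrite y0'.
apply: filterS => x tx Zx; rewrite /= /koopman_real mulr_ge0// leNgt.
by apply/negP => tx0; apply: tx; split => //=; rewrite in_itv.
Qed.

Lemma dual_ge0_onP (x : E) : dual_cone dot ge0_on x <->
  {ae mu, forall t, 0 <= x t} /\ {ae mu, forall t, ~ malg_repr Z t -> x t = 0}.
Proof.
split=> [Px|[x0 xZ] y y0]; last first.
  have -> : dot x y = fine (\int[mu]_t `|(x t * y t)%:E|)%E.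
    congr fine; apply: ae_eq_integral => //.
    - exact: measurable_int (L2_integrableM x y).
    - by apply: measurableT_comp => //; exact: measurable_int (L2_integrableM x y).
    - apply: filterS3 x0 xZ y0 => t x0 xZ y0 _; rewrite gee0_abs// lee_fin.
      have [/y0 /(mulr_ge0 x0)//|/xZ ->] := pselect (malg_repr Z t).
      by rewrite mul0r.
  by rewrite fine_ge0// integral_ge0.
(* A test vector: the negative part of [x] on [Z] and [- x] elsewhere. It lies in [ge0_on] and
   satisfies [x v = - v^2], so [0 <= <x, v> = - sq v] makes it null. *)
pose v t := \1_(malg_repr Z) t * Num.max (- x t) 0 + \1_(~` malg_repr Z) t * - x t.
have mNx : measurable_fun setT (fun t => - x t) by apply: measurable_funN; exact: mE.
have mv : measurable_fun setT v.
  have m1 := @measurable_indic _ T R setT _ mZ.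
  have m2 := @measurable_indic _ T R setT _ (measurableC mZ).
  have m3 : measurable_fun setT (fun t => Num.max (- x t) 0) by exact: measurable_maxr.
  by apply: measurable_funD; apply: measurable_funM.
have vZ t : malg_repr Z t -> v t = Num.max (- x t) 0.
  by move=> Zt; rewrite /v !indicE mem_set// memNset ?mul1r ?mul0r ?addr0// => /(_ Zt).
have vNZ t : ~ malg_repr Z t -> v t = - x t.
  by move=> Zt; rewrite /v !indicE memNset// mem_set// mul1r mul0r add0r.
have xv t : x t * v t = - (v t ^+ 2).
  have [/vZ|/vNZ] := pselect (malg_repr Z t) => ->; last by rewrite sqrrN mulrN expr2.
  case: (lerP (- x t) 0) => _; last by rewrite sqrrN mulrN expr2.
  by rewrite mulr0 expr0n oppr0.
have lv : (\int[mu]_t ((v t) ^+ 2)%:E < +oo)%E.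
  refine (le_lt_trans _ (L2_lt x)); apply: ge0_le_integral => //.
  - by move=> t _; rewrite lee_fin sqr_ge0.
  - exact: measurable_sq.
  - by apply: measurable_sq; exact: mE.
  - move=> t _; rewrite lee_fin.
    have [/vZ|/vNZ] := pselect (malg_repr Z t) => ->; last by rewrite sqrrN.
    by case: (lerP (- x t) 0) => _; rewrite ?sqrrN// expr0n sqr_ge0.
pose y : E := toL2 mv lv.
have Qy : ge0_on y.
  by apply: aeW => t /= /vZ ->; rewrite le_max lexx orbT.
have : sq y = 0.
  have := Px _ Qy; have -> : dot x y = - sq y.
    rewrite -mulN1r -L2dotZl; apply: eq_Rintegral => t _.
    by rewrite -[LHS]/(x t * v t) xv -[RHS]/(-1 * v t * v t) expr2 mulN1r mulNr.
  by move=> yy; have := L2dot_ge0 y; lra.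
move/L2dot_eq0 => v0; split; apply: filterS v0 => t; rewrite -[y t]/(v t).
  have [/vZ|/vNZ] := pselect (malg_repr Z t) => ->.
    by move=> m0; rewrite -oppr_le0 -m0 le_max lexx.
  by move/eqP; rewrite oppr_eq0 => /eqP ->.
by move=> vt /vNZ; rewrite vt => /eqP; rewrite eq_sym oppr_eq0 => /eqP.
Qed.

End invariant_set.
End koopman_L2.


Lemma ex_density_probability d (T : measurableType d) (R : realType)
    (mu : {measure set T -> \bar R}) (f : T -> R) : measurable_fun setT f ->
  (forall x, 0 <= f x) -> (\int[mu]_x (f x)%:E = 1)%E ->
  exists nu : probability T R, forall A, nu A = (\int[mu]_(x in A) (f x)%:E)%E.
Proof.
move=> mf f0 f1; pose k A := (\int[mu]_(x in A) (f x)%:E)%E.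
have k0 : k set0 = 0%E by rewrite /k integral_set0.
have k_ge0 A : (0 <= k A)%E by apply: integral_ge0 => x _; rewrite lee_fin.
have ksig : semi_sigma_additive k.
  by apply: semi_sigma_additive_nng_induced => //; exact/measurable_EFinP.
pose m := isMeasure.Build _ _ _ k k0 k_ge0 ksig.
pose k' : {measure set T -> \bar R} := HB.pack k m.
pose p := Measure_isProbability.Build _ _ _ k' f1.
pose nu : probability T R := HB.pack (Measure.sort k') p.
by exists nu.
Qed.

Lemma ex_finite_subset d (T : measurableType d) (R : realType)
    (mu : {sigma_finite_measure set T -> \bar R}) A : measurable A -> mu A <> 0%E ->
  exists B, [/\ measurable B, B `<=` A, (mu B < +oo)%E & mu B <> 0%E].
Proof.
move=> mA A0; have [P [mP fP tP UP]] := finite_cover mu.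
apply: contrapT => nB; apply: A0; rewrite (measure_partition mu mP tP UP mA).
apply: eseries0 => n _ _ /=; apply: contrapT => n0; apply: nB.
exists (A `&` P n); split => //; first exact: measurableI.
by apply: le_lt_trans (fP n); apply: le_measure; rewrite ?inE//; exact: measurableI.
Qed.

Section piece.
Variables (G : topologicalGroupType) (d : measure_display) (T : measurableType d).
Variables (R : realType) (mu : {sigma_finite_measure set T -> \bar R}).
Variable sigma : nonsingular_action G mu.

(** The vector [zeta] is forgotten from here on. By [piece_null], [nu] is equivalent to [mu]
    restricted to [S]; with [piece_invariant], this forces [S] to be [W]-invariant
    ([piece_stable]). *)
Record is_piece (W : groupClosed G) (S : set T) (nu : probability T R) : Prop :=
  IsPiece {
    piece_open : open [set` W] ;
    piece_sc : self_commensurating [set` W] ;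
    measurable_piece : measurable S ;
    piece_null : forall A, measurable A -> nu A = 0%E <-> mu (A `&` S) = 0%E ;
    piece_invariant : forall g A, g \in W -> measurable A ->
      nu (malg_repr (sigma g (malg_class mu A))) = nu A ;
    piece_disjoint : forall g, g \notin W ->
      (sigma g (malg_class mu S) `&` malg_class mu S)%O = \bot%O }.

Hypotheses (naG : non_archimedean G) (rpG : roelcke_precompact G).

Local Notation E := (LfunType mu (lee1n 2)).
Local Notation dot := (@L2dot _ _ _ mu).
Local Notation sq x := (dot x x).
Local Notation K := (koopman_L2 sigma).

(* The piece is the support of the vector [zeta], with density [zeta ^ 2].  As
   [zeta] and its translates are nonnegative, those that are orthogonal to
   [zeta] have a support disjoint from that of [zeta]. *)
Lemma ex_piece (Z : malg mu) : (forall g, sigma g Z = Z) -> Z <> \bot%O ->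
  exists W S nu, is_piece W S nu /\ (malg_class mu S <= Z)%O.
Proof.
move=> Z_inv Z0.
have mZ : measurable (malg_repr Z) by exact: measurable_malg_repr.
have /(ex_finite_subset mZ) [B [mB BZ fB B0]] : mu (malg_repr Z) <> 0%E.
  by move=> /(malg_class_eq0 mu mZ); rewrite malg_reprK.
have mI := @measurable_indic _ T R setT B mB.
have sqI : (\int[mu]_x ((\1_B x : R) ^+ 2)%:E = mu B)%E.
  rewrite -[X in mu X]setIT -integral_indic//; apply: eq_integral => x _.
  by rewrite indicE; case: (x \in B); rewrite ?expr1n ?expr0n.
have lI : (\int[mu]_x ((\1_B x : R) ^+ 2)%:E < +oo)%E by rewrite sqI.
pose xi : E := toL2 mI lI.
have Pxi : dual_cone dot (ge0_on Z) xi.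
  apply/dual_ge0_onP; split; first by apply: aeW => x; rewrite /= indicE.
  by apply: aeW => x Zx; rewrite /= indicE memNset// => /BZ.
have xi0 : 0 < sq xi.
  by rewrite -lte_fin L2dotE sqI lt0e; apply/andP; split => //; exact/eqP.
have xi8 : 0 < sq xi / 8 by rewrite divr_gt0.
have [U [Uo UK]] := naG (koopman_L2_continuous sigma xi xi8).
pose mE := @measurable_L2 _ _ _ mu.
have PQ : dual_cone dot (ge0_on Z) `<=` ge0_on Z.
  by move=> x /dual_ge0_onP [x0 _]; apply: filterS x0 => t.
have [f [Pf f0 Uf]] := ex_fixed_vector (@L2dotC _ _ _ mu) (@L2dotDl _ _ _ mu)
  (@L2dotZl _ _ _ mu) (@L2dot_ge0 _ _ _ mu) (@L2_complete _ _ _ mu)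
  (koopman_L2M sigma) (koopman_L21 sigma) (koopman_L2dot sigma)
  (koopman_L2_ge0_on Z_inv) Pxi xi0 (fun u uU => ltW (UK u uU)).
have [F finF UFU] := finite_double_cosets rpG Uo.
pose Phi := (fun x => dot (K x f) f) @` F.
have fPhi g : Phi (dot (K g f) f).
  have [u [x [v [uU Fx vU ->]]]] := UFU g.
  by exists x => //; rewrite (koopman_L2_double_coset x Uf uU vU).
have [W [zeta [Wo Wsc [Pz z0] Wz NWz]]] := ex_self_commensurating_vector
  (@L2dotC _ _ _ mu) (@L2dotDl _ _ _ mu)
  (@L2dotZl _ _ _ mu) (@L2dot_ge0 _ _ _ mu) (@L2_complete _ _ _ mu)
  (koopman_L2M sigma) (koopman_L21 sigma) (koopman_L2dot sigma)
  (koopman_L2_continuous sigma) (koopman_L2_ge0_on Z_inv) PQ rpG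
  (finite_image _ finF) Pf f0 fPhi.
have [z_ge0 zZ] := iffLR (dual_ge0_onP _ _) Pz.
have mz := mE zeta; set c := sq zeta in z0.
have mz0 : measurable [set z : R | z != 0].
  have -> : [set z : R | z != 0] = ~` [set 0] by apply/seteqP; split => z /= /eqP.
  by apply: measurableC; exact: measurable_set1.
pose S := zeta @^-1` [set z | z != 0].
have mS : measurable S by exact: measurable_preimage.
pose h x := c^-1 * (zeta x) ^+ 2.
have mh : measurable_fun setT h.
  by apply: measurable_funM => //; exact: measurable_funX.
have h0 x : 0 <= h x by rewrite /h mulr_ge0 ?sqr_ge0// invr_ge0 ltW.
have h1 : (\int[mu]_x (h x)%:E = 1)%E.
  under eq_integral do rewrite EFinM.
  rewrite ge0_integralZl_EFin//; last 3 first.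
  - by move=> x _; rewrite lee_fin sqr_ge0.
  - exact: measurable_sq.
  - by rewrite invr_ge0 ltW.
  by rewrite -L2dotE -EFinM mulVf// gt_eqF.
have [nu nuE] := ex_density_probability mh h0 h1.
have SP x : S x <-> h x != 0.
  rewrite /S /h /= mulf_eq0 invr_eq0 (gt_eqF z0) /= sqrf_eq0.
  by [].
exists W, S, nu; split; last first.
  rewrite -(malg_reprK Z); apply/malg_class_le => //.
  have mSZ : measurable (S `\` malg_repr Z) by exact: measurableD.
  apply/(malg_class_eq0 mu mSZ)/malg_class0_ae => //.
  by apply: filterS zZ => x zZ [Sx nZ]; have /eqP := zZ nZ; move/negP: Sx; apply.
split=> //.
- move=> A mA; rewrite nuE.
  have mAS : measurable (A `&` S) by exact: measurableI.
  rewrite -(malg_class_eq0 mu mAS) malg_class0_ae//.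
  have mhE : measurable_fun A (fun x => (h x)%:E).
    by apply: measurable_funTS; exact/measurable_EFinP.
  have -> : (\int[mu]_(x in A) (h x)%:E = \int[mu]_(x in A) `|(h x)%:E|)%E.
    by apply: eq_integral => x _; rewrite gee0_abs// lee_fin.
  rewrite ae_eq_integral_abs//; split; apply: filterS => x.
    by move=> H [/H [hx] /SP /eqP].
  by move=> nAS Ax; apply/eqP; rewrite eqe; apply: contrapT => /negP hx; apply: nAS; split=> //; exact/SP.
- move=> g A gW mA; set A' := malg_repr _.
  have mA' : measurable A' by exact: measurable_malg_repr.
  (* The change of variables replaces the indicator of [A] and [zeta] by their translates and brings
     in the density of [sigma g], which is the square of the factor in [K g zeta]; and
     [K g zeta = zeta] almost everywhere. *)
  pose phi (p : R * R) := (c^-1 * (p.1 ^+ 2 * p.2 ^+ 2))%:E.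
  have mphi : measurable_fun setT phi.
    apply/measurable_EFinP; apply: measurable_funM => //.
    by apply: measurable_funM; apply: measurable_funX.
  have phi0 p : (0 <= phi p)%E.
    rewrite lee_fin; apply: mulr_ge0; first by rewrite invr_ge0 ltW.
    by apply: mulr_ge0; exact: sqr_ge0.
  have nuphi C (z : T -> R) : measurable C -> (\int[mu]_(x in C) (c^-1 * z x ^+ 2)%:E =
      \int[mu]_x phi (\1_C x, z x))%E.
    move=> mC; rewrite integral_mkcond; apply: eq_integral => x _.
    rewrite patchE /phi /= indicE; case: ifPn => _; first by rewrite expr1n mul1r.
    by rewrite expr0n /= mul0r mulr0.
  have mIA := @measurable_indic _ T R setT A mA.
  rewrite !nuE !nuphi//.
  rewrite -(translates_change_of_variables (measurable_pair mIA mz)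
    (translates_to_pair mIA mz (translates_to_indic (sigma g) mA) (translateP (sigma g) mz))
    (rn_derivativeP (sigma g)) mphi phi0).
  have Kz := iffLR (L2_sq_eq0 _ _) (Wz g gW).
  have [mrn rn0 _] := rn_derivativeP (sigma g).
  have mt := measurable_translate (sigma g) zeta.
  have mIA' := @measurable_indic _ T R setT A' mA'.
  apply: ae_eq_integral => //.
  - by apply: measurableT_comp => //; exact: measurable_pair.
  - apply: emeasurable_funM; last exact/measurable_EFinP.
    by apply: measurableT_comp => //; exact: measurable_pair.
  - apply: filterS Kz => x /= <- _; rewrite /phi /koopman_real /= -EFinM.
    by congr EFin; rewrite exprMn sqr_sqrtr//; ring.
- move=> g gW; have := NWz g gW; rewrite L2dotC => zK.
  have mt := measurable_translate (sigma g) zeta; set t := translate _ _ in mt.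
  have [_ /(_ _ mz0) tE] := translateP (sigma g) mz.
  have mtS : measurable (t @^-1` [set z | z != 0]) by exact: measurable_preimage.
  rewrite -tE -malg_classI//; apply/malg_class0_ae; first exact: measurableI.
  have K0 := koopman_real_ge0 (sigma g) mz z_ge0.
  have rn0 := density_gt0 (rn_derivativeP (sigma g)).
  (* Both factors are nonnegative, so a zero integral makes their product vanish; as the density is
     positive, [t] and [zeta] are then not both nonzero. *)
  have : {ae mu, forall x, zeta x * K g zeta x = 0}.
    have mzK := measurable_int _ (L2_integrableM zeta (K g zeta)).
    have : (\int[mu]_x `|(zeta x * K g zeta x)%:E| = 0)%E.
      rewrite -[RHS]/(0%:E) -zK /dot /Rintegral fineK.
        apply: ae_eq_integral => //; first exact: measurableT_comp.
        by apply: filterS2 K0 z_ge0 => x k0 z0' _; rewrite gee0_abs// lee_fin mulr_ge0.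
      by apply: integrable_fin_num => //; exact: L2_integrableM.
    by move/(ae_eq_integral_abs _ measurableT mzK); apply: filterS => x /(_ I) [].
  apply: filterS2 rn0 => x rx /eqP; rewrite mulf_eq0 => zk [/= tx Sx].
  move: zk; rewrite (negbTE Sx) /= /koopman_real mulf_eq0 (negbTE tx) orbF.
  by rewrite sqrtr_eq0 leNgt rx.
Qed.

End piece.

(** * Exhaustion by pieces *)


(** Provides finite masses by which the exhaustion compares pieces. The weights
    [2^-(n+1) / (1 + mu (P n))] on a partition bound the total mass by 1. *)
Lemma ex_equivalent_finite_measure d (T : measurableType d) (R : realType)
    (mu : {sigma_finite_measure set T -> \bar R}) :
  exists m : {measure set T -> \bar R}, (m setT < +oo)%E /\
    forall A, measurable A -> m A = 0%E <-> mu A = 0%E.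
Proof.
have [P [mP fP tP UP]] := finite_cover mu.
have fin n : mu (P n) \is a fin_num by rewrite ge0_fin_numE.
have p1 n : 0 < 1 + fine (mu (P n)) by rewrite ltr_wpDr ?fine_ge0.
have c0 n : 0 < 1 / (2 ^ n.+1)%:R / (1 + fine (mu (P n))).
  by rewrite !divr_gt0// ltr0n expn_gt0.
pose c n : {nonneg R} := NngNum (ltW (c0 n)).
pose m := mseries (fun n => mscale (c n) (mrestr mu (mP n))) 0.
have mE A : m A = (\sum_(n <oo) (c n)%:num%:E * mu (A `&` P n))%E by [].
exists m; split.
  apply: (@le_lt_trans _ _ (1 : R)%:E); last exact: ltry.
  apply: le_trans (epsilon_trick0 xpredT ler01); rewrite [leLHS](mE setT).
  apply: lee_nneseries => [n _ _|n _]; first by rewrite mule_ge0// lee_fin ltW.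
  rewrite setTI -(fineK (fin n)) -EFinM lee_fin /=.
  rewrite [leLHS]mulrAC ler_pdivrMr//; apply: ler_wpM2l; first by rewrite divr_ge0.
  by rewrite lerDr.
move=> A mA; rewrite [X in X = _ <-> _](mE A); split=> [m0|A0]; last first.
  apply: eseries0 => n _ _; suff -> : mu (A `&` P n) = 0%E by rewrite mule0.
  by apply: (subset_measure0 _ mA _ A0) => //; exact: measurableI.
rewrite (measure_partition mu mP tP UP mA); apply: eseries0 => n _ _.
have : ((c n)%:num%:E * mu (A `&` P n) <= 0)%E.
  rewrite -[leRHS]m0; apply: le_trans (nneseries_lim_ge n.+1 _).
    by rewrite big_nat_recr//= leeDr// sume_ge0// => i _; rewrite mule_ge0// lee_fin ltW.
  by move=> i _ _; rewrite mule_ge0// lee_fin ltW.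
rewrite pmule_rle0; last by rewrite lte_fin c0.
by move=> h; apply/eqP; rewrite eq_le h measure_ge0.
Qed.

Section malg_sup.
Context d (T : measurableType d) (R : realType) (mu : {measure set T -> \bar R}).
Variables (I : Type) (b : I -> malg mu).

(** The least upper bound of the family when [I] is countable ([malg_supP]); for uncountable [I] a
    union of representatives has no such meaning. *)
Definition malg_sup : malg mu := malg_class mu (\bigcup_i malg_repr (b i)).

Lemma malg_supP : countable [set: I] ->
  forall a, (malg_sup <= a)%O <-> forall i, (b i <= a)%O.
Proof.
move=> /countable_injP [f /in2TT finj] a.
pose B n := \bigcup_(i in [set i | f i = n]) malg_repr (b i).
have Bf i : B (f i) = malg_repr (b i).
  apply/seteqP; split => x; last by exists i.
  by case=> j /= /finj ->.
have B0 n : ~ (exists i, f i = n) -> B n = set0.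
  by move=> ni; rewrite -subset0 => x [i /= fi]; case: ni; exists i.
have mB n : measurable (B n).
  have [[i <-]|/B0 ->//] := pselect (exists i, f i = n).
  by rewrite Bf; exact: measurable_malg_repr.
have supE : malg_sup = malg_class mu (\bigcup_n B n).
  congr malg_class; apply/seteqP; split => x.
    by case=> i _ bx; exists (f i) => //; exists i.
  by case=> n _ [i _ bx]; exists i.
rewrite supE; split=> [le_a i|le_a].
  apply: le_trans le_a; rewrite -[b i]malg_reprK -Bf.
  exact: (malg_class_le_bigcup mu (f i) mB).
apply: malg_class_bigcup_le => // n.
have [[i <-]|/B0 ->] := pselect (exists i, f i = n).
  by rewrite Bf malg_reprK.
by rewrite malg_class0 le0x.
Qed.

End malg_sup.

Lemma malg_leIC d (T : measurableType d) (R : realType) (mu : {measure set T -> \bar R})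
  (a x y : malg mu) : (a `&` x <= y)%O = (a <= ~` x `|` y)%O.
Proof. by rewrite -{1}[x]complK -diffE leBLR joinC. Qed.


Section action_lattice.
Variables (G : topologicalGroupType) (d : measure_display) (T : measurableType d).
Variables (R : realType) (mu : {sigma_finite_measure set T -> \bar R}).
Variable sigma : nonsingular_action G mu.
Implicit Types (a b : malg mu).

Lemma actE g h a : sigma (g * h)%g a = sigma g (sigma h a).
Proof. by rewrite actionM. Qed.

Lemma act1 a : sigma 1%g a = a.
Proof. by rewrite (action1 (actionM sigma)). Qed.

Lemma actK g : cancel (sigma g) (sigma g^-1%g).
Proof. by move=> a; rewrite -actE mulVg act1. Qed.

Lemma actKV g : cancel (sigma g^-1%g) (sigma g).
Proof. by move=> a; rewrite -actE mulgV act1. Qed.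

Lemma act_leR g a b : (a <= b)%O -> (sigma g a <= sigma g b)%O.
Proof. exact: sigma_morphism_le (aut_sigma_morphism _) _ _. Qed.

Lemma act_le g a b : (sigma g a <= b)%O = (a <= sigma g^-1%g b)%O.
Proof.
apply/idP/idP => [/(act_leR g^-1%g)|/(act_leR g)]; first by rewrite actK.
by rewrite actKV.
Qed.

Lemma actC g a : sigma g (~` a)%O = (~` sigma g a)%O.
Proof. exact: sigma_morphismC (aut_sigma_morphism _) _. Qed.

Lemma actI g a b : sigma g (a `&` b)%O = (sigma g a `&` sigma g b)%O.
Proof. exact: sigma_morphismI (aut_sigma_morphism _) _ _. Qed.

Lemma act_bot g : sigma g \bot%O = \bot%O.
Proof. exact: sigma_morphism0 (aut_sigma_morphism _). Qed.

Lemma act_invariant a : (forall g, (sigma g a <= a)%O) -> forall g, sigma g a = a.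
Proof. by move=> H g; apply/eqP; rewrite eq_le H -{1}(invgK g) -act_le H. Qed.

Lemma act_sup_invariant (I : Type) (b : I -> malg mu) : countable [set: I] ->
  (forall g i, (sigma g (b i) <= malg_sup b)%O) ->
  forall g, sigma g (malg_sup b) = malg_sup b.
Proof.
move=> cI H; apply: act_invariant => g; rewrite act_le.
by apply/malg_supP => // i; rewrite -act_le.
Qed.

End action_lattice.

Section orbit.
Variables (G : topologicalGroupType) (d : measure_display) (T : measurableType d).
Variables (R : realType) (mu : {sigma_finite_measure set T -> \bar R}).
Variable sigma : nonsingular_action G mu.
Hypothesis sepG : separable_space G.

Section piece.
Variables (W : groupClosed G) (S : set T) (nu : probability T R).
Hypothesis pc : is_piece sigma W S nu.

Let mS : measurable S := measurable_piece pc.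

Lemma piece_dominated A : measurable A -> mu A = 0%E -> nu A = 0%E.
Proof.
move=> mA A0; apply/(piece_null pc) => //.
by apply: (subset_measure0 _ mA _ A0) => //; exact: measurableI.
Qed.

Lemma piece_neq0 : malg_class mu S <> \bot%O.
Proof.
move=> /(malg_class_eq0 mu mS) S0.
have : nu setT = 0%E by apply/(piece_null pc) => //; rewrite setTI.
by rewrite probability_setT => /eqP; rewrite onee_eq0.
Qed.

Lemma piece_null_class a : nu (malg_repr a) = 0%E <-> (a `&` malg_class mu S)%O = \bot%O.
Proof.
have ma : measurable (malg_repr a) by exact: measurable_malg_repr.
rewrite -[a in X in _ <-> X]malg_reprK -malg_classI// malg_class_eq0; last exact: measurableI.
exact: piece_null pc _ ma.
Qed.

(** The complement of [S] is [nu]-null, hence so are its translates by [W]. This gives [S <= h S]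
    for [h] in [W], and the reverse inclusion comes from the inverse. *)
Lemma piece_stable g : g \in W -> sigma g (malg_class mu S) = malg_class mu S.
Proof.
have le_S h : h \in W -> (malg_class mu S <= sigma h (malg_class mu S))%O.
  move=> hW; rewrite -[leRHS]complK -disj_leC -actC meetC; apply/eqP/piece_null_class.
  rewrite -(malg_classC mu mS) (piece_invariant pc hW (measurableC mS)).
  by apply/(piece_null pc); rewrite ?setICl ?measure0//; exact: measurableC.
by move=> gW; apply/eqP; rewrite eq_le le_S// act_le le_S// gpredV.
Qed.

(** Indexed by cosets to remain countable; since [S] is stable under [W], it bounds the translates
    by all of [G] ([orbit_supP]). *)
Definition orbit_sup := malg_sup (fun c : cosets W => sigma (repr c) (malg_class mu S)).

Lemma orbit_supP a : (orbit_sup <= a)%O <-> forall g, (sigma g (malg_class mu S) <= a)%O.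
Proof.
have cW := countable_cosets sepG (piece_open pc).
rewrite /orbit_sup malg_supP//; split=> H g; last exact: H.
have [v vW] := repr_lcoset W g; have := H (lcoset W g) => /[swap] ->.
by rewrite actE (piece_stable vW).
Qed.

Lemma le_orbit_sup g : (sigma g (malg_class mu S) <= orbit_sup)%O.
Proof. by move: g; apply/orbit_supP. Qed.

Lemma orbit_sup_invariant g : sigma g orbit_sup = orbit_sup.
Proof.
apply: act_sup_invariant; first exact: countable_cosets sepG (piece_open pc).
by move=> h c; rewrite -actE; exact: le_orbit_sup.
Qed.

End piece.

End orbit.


Section exhaustion.
Variables (G : topologicalGroupType) (d : measure_display) (T : measurableType d).
Variables (R : realType) (mu : {sigma_finite_measure set T -> \bar R}).
Variable sigma : nonsingular_action G mu.
Hypotheses (sepG : separable_space G) (naG : non_archimedean G).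
Hypothesis rpG : roelcke_precompact G.

Local Notation orb p := (orbit_sup sigma p.1.1 p.1.2).
Local Notation piece_in p Z :=
  (is_piece sigma p.1.1 p.1.2 p.2 /\ (malg_class mu p.1.2 <= Z)%O).

Section greedy.
Variable m : {measure set T -> \bar R}.
Hypothesis m_fin : (m setT < +oo)%E.
Hypothesis m_null : forall A, measurable A -> m A = 0%E <-> mu A = 0%E.

Let M (a : malg mu) : R := fine (m (malg_repr a)).

Let fin A : measurable A -> m A \is a fin_num.
Proof.
move=> mA; rewrite ge0_fin_numE//; apply: le_lt_trans m_fin.
by apply: le_measure; rewrite ?inE.
Qed.

Let ME A : measurable A -> M (malg_class mu A) = fine (m A).
Proof.
move=> mA; rewrite /M; congr fine.
have mr : measurable (malg_repr (malg_class mu A)) by exact: measurable_malg_repr.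
apply: mu_eq_class => //; apply/malg_classP => //; apply/m_null.
  by apply: measurableU; exact: measurableD.
exact: mu_malg_repr.
Qed.

Let M_ge0 a : 0 <= M a. Proof. exact: fine_ge0. Qed.

Let M_gt0 a : a <> \bot%O -> 0 < M a.
Proof.
move=> a0; rewrite lt_neqAle M_ge0 andbT eq_sym; apply/negP => /eqP Ma0; apply: a0.
have ma : measurable (malg_repr a) by exact: measurable_malg_repr.
rewrite -(malg_reprK a); apply/(malg_class_eq0 mu ma)/m_null => //.
by rewrite -(fineK (fin ma)) -[fine _]/(M a) Ma0.
Qed.

Let MD a y : (y <= a)%O -> M a = M (a `&` ~` y)%O + M y.
Proof.
move=> ya; have ma : measurable (malg_repr a) by exact: measurable_malg_repr.
have my : measurable (malg_repr y) by exact: measurable_malg_repr.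
have -> : (a `&` ~` y)%O = malg_class mu (malg_repr a `\` malg_repr y).
  rewrite setDE (malg_classI mu ma (measurableC my)) (malg_classC mu my).
  by rewrite !malg_reprK.
have -> : y = malg_class mu (malg_repr a `&` malg_repr y).
  by rewrite (malg_classI mu ma my) !malg_reprK; apply/esym/meet_r.
rewrite [in M (malg_class _ (_ `\` _))]malg_classI// !malg_reprK (meet_r ya).
have mD : measurable (malg_repr a `\` malg_repr y) by exact: measurableD.
have mI : measurable (malg_repr a `&` malg_repr y) by exact: measurableI.
rewrite !ME// -fineD ?fin//; congr fine; exact: measureDI.
Qed.

Let M_le a y : (y <= a)%O -> M y <= M a.
Proof. by move=> /MD ->; rewrite lerDr. Qed.

(** The supremum of the orbit masses need not be attained; the factor 2 guarantees a witness. *)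
Let maximal (p : groupClosed G * set T * probability T R) Z := forall W S (nu : probability T R), is_piece sigma W S nu ->
  (malg_class mu S <= Z)%O -> M (orbit_sup sigma W S) <= 2 * M (orb p).

Let ex_maximal Z : (forall g, sigma g Z = Z) -> Z <> \bot%O ->
  exists p : groupClosed G * set T * probability T R, piece_in p Z /\ maximal p Z.
Proof.
move=> Zinv Z0; pose A := [set r | exists p : groupClosed G * set T * probability T R,
  piece_in p Z /\ r = M (orb p)].
have orb_gt0 (p : groupClosed G * set T * probability T R) : piece_in p Z -> 0 < M (orb p).
  move=> [pc _]; apply: M_gt0 => o0; apply: (piece_neq0 pc); apply/eqP.
  by rewrite -lex0 -o0 -{1}(act1 sigma (malg_class _ _)); exact: (le_orbit_sup sepG pc).
have [W [S [nu [pc SZ]]]] := ex_piece naG rpG Zinv Z0.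
have A0 : A (M (orbit_sup sigma W S)) by exists (W, S, nu).
have ubA : ubound A (M Z).
  move=> _ [p [[pcp pZ] ->]]; apply: M_le.
  by apply/(orbit_supP sepG pcp) => g; rewrite -(Zinv g); exact: act_leR.
have supA : has_sup A by split; [exists (M (orbit_sup sigma W S))|exists (M Z)].
have s0 : 0 < sup A.
  apply: lt_le_trans (orb_gt0 (W, S, nu) _) _ => //.
  exact: (ub_le_sup supA.2).
have s2 : 0 < sup A / 2 by rewrite divr_gt0.
have [_ [p [pZ ->]] sp] := sup_adherent s2 supA.
exists p; split=> // W' S' nu' pc' S'Z; apply: le_trans (_ : sup A <= _).
  by apply: (ub_le_sup supA.2); exists (W', S', nu').
by move: sp; lra.
Qed.

Variable p0 : groupClosed G * set T * probability T R.

(* Each step removes a piece whose orbit has at least half of the largest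
   possible mass in [Zs n].  A piece inside all the [Zs n] would bound these
   masses from below, but their sum is finite. *)
Lemma greedy_exhaustion : exists (D : set nat)
    (p : nat -> groupClosed G * set T * probability T R),
  [/\ forall n, D n -> is_piece sigma (p n).1.1 (p n).1.2 (p n).2,
      forall n, ~ D n -> p n = p0,
      forall n m g h, D n -> D m -> n <> m ->
        (sigma g (malg_class mu (p n).1.2) `&` sigma h (malg_class mu (p m).1.2))%O = \bot%O &
      forall a, (forall n g, D n -> (a `&` sigma g (malg_class mu (p n).1.2))%O = \bot%O) ->
        a = \bot%O].
Proof.
have /choice [pick pickP] : forall Z, exists p : groupClosed G * set T * probability T R,
    (forall g, sigma g Z = Z) -> Z <> \bot%O -> piece_in p Z /\ maximal p Z.
  move=> Z; have [[Zinv Z0]|nZ] := pselect ((forall g, sigma g Z = Z) /\ Z <> \bot%O).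
    by have [p pP] := ex_maximal Zinv Z0; exists p.
  by exists p0 => Zinv Z0; case: nZ.
pose Zs := fix Zs n := if n is n'.+1 then (Zs n' `&` ~` orb (pick (Zs n')))%O else \top%O.
have Zs_inv n g : sigma g (Zs n) = Zs n.
  elim: n g => [|n IHn] g /=; first exact: sigma_morphism1 (aut_sigma_morphism _).
  have [->|/eqP Zn0] := eqVneq (Zs n) \bot%O; first by rewrite meet0x act_bot.
  have [[pc _] _] := pickP _ IHn Zn0.
  by rewrite actI actC IHn (orbit_sup_invariant sepG pc).
pose D := [set n | Zs n <> \bot%O].
pose p n := if pselect (D n) then pick (Zs n) else p0.
have pE n : D n -> p n = pick (Zs n) by rewrite /p; case: pselect.
have pc n : D n -> is_piece sigma (p n).1.1 (p n).1.2 (p n).2.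
  by move=> Dn; rewrite (pE _ Dn); have [[]] := pickP _ (Zs_inv n) Dn.
have pZ n : D n -> (malg_class mu (p n).1.2 <= Zs n)%O.
  by move=> Dn; rewrite (pE _ Dn); have [[]] := pickP _ (Zs_inv n) Dn.
have Zs_dec n k : (Zs (n + k)%N <= Zs n)%O.
  elim: k => [|k IHk]; first by rewrite addn0.
  by rewrite addnS /= leIxl.
have disj n k g h : D n -> D k -> (n < k)%N ->
    (sigma g (malg_class mu (p n).1.2) `&` sigma h (malg_class mu (p k).1.2))%O = \bot%O.
  move=> Dn Dk nk; apply/eqP; rewrite meetC disj_leC.
  apply: (@le_trans _ _ (Zs k)); first by rewrite -(Zs_inv k h); apply: act_leR; exact: pZ.
  rewrite -(subnKC nk); apply: le_trans (Zs_dec _ _) _; rewrite /= -(pE n Dn).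
  by apply: leIxr; rewrite leC; exact: (le_orbit_sup sepG (pc n Dn)).
exists D, p; split => //.
- by move=> n; rewrite /p; case: pselect.
- move=> n k g h Dn Dk /eqP; rewrite neq_ltn => /orP[nk|kn]; first exact: disj.
  by rewrite meetC; exact: disj.
move=> a aD; apply: contrapT => a0.
(* An element disjoint from all the translates of the chosen pieces stays below every remainder; if
   it is nonzero, the process never stops and [D] contains every [n]. *)
have aZ n : (a <= Zs n)%O.
  elim: n => [|n IHn] /=; first exact: lex1.
  have Dn : D n by move=> Zn0; apply: a0; apply/eqP; rewrite -lex0 -Zn0.
  rewrite lexI IHn -(pE n Dn) lexC; apply/(orbit_supP sepG (pc n Dn)) => g.
  by rewrite -disj_leC meetC; apply/eqP; exact: aD.
have DT n : D n by move=> Zn0; apply: a0; apply/eqP; rewrite -lex0 -Zn0.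
have cN : countable [set: nat] by exact: countableP.
(* The complement of [L] is the infimum of the remainders. Invariant and nonzero, it contains a
   piece, of orbit mass [q], which was a candidate at every step; so each step removes at least
   [q / 2]. *)
pose L := malg_sup (fun n => ~` Zs n)%O.
have leL n : (~` Zs n <= L)%O.
  exact: (iffLR (malg_supP (fun n => ~` Zs n)%O cN L) (lexx _) n).
have LZ n : (~` L <= Zs n)%O by rewrite leCx; exact: leL.
have Linv g : sigma g (~` L)%O = (~` L)%O.
  rewrite actC; congr (~` _)%O; apply: act_sup_invariant => // h n.
  by rewrite actC Zs_inv; exact: leL.
have L0 : (~` L)%O <> \bot%O.
  move=> L0; apply: a0; apply/eqP; rewrite -lex0 -L0 lexC.
  by apply/malg_supP => // n; rewrite leC.
have [W [S [nu [pcq qL]]]] := ex_piece naG rpG Linv L0.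
have q0 : 0 < M (orbit_sup sigma W S).
  apply: M_gt0 => o0; apply: (piece_neq0 pcq); apply/eqP.
  by rewrite -lex0 -o0 -{1}(act1 sigma (malg_class _ _)); exact: (le_orbit_sup sepG pcq).
set q := M _ in q0.
have step n : M (Zs n.+1) <= M (Zs n) - q / 2.
  have [[pcn pn] mx] := pickP _ (Zs_inv n) (DT n).
  have := mx _ _ _ pcq (le_trans qL (LZ n)).
  have oZ : (orb (pick (Zs n)) <= Zs n)%O.
    by apply/(orbit_supP sepG pcn) => g; rewrite -[leRHS](Zs_inv n g); exact: act_leR.
  by rewrite (MD oZ) -/q /=; lra.
have bound n : M (Zs n) <= M \top%O - n%:R * (q / 2).
  elim: n => [|n IHn]; first by rewrite mul0r subr0.
  by have := step n; rewrite -(natr1 n) mulrDl mul1r; lra.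
have q2 : 0 < q / 2 by rewrite divr_gt0.
have := bound (Num.truncn (M \top%O / (q / 2))).+1.
have := truncnS_gt (M \top%O / (q / 2)); rewrite ltr_pdivrMr// => t1 t2.
by have := M_ge0 (Zs (Num.truncn (M \top%O / (q / 2))).+1); lra.
Qed.

End greedy.
End exhaustion.

(** * Induced actions *)


Lemma factor_action_measure d1 d2 (T1 : measurableType d1) (T2 : measurableType d2)
    (R : realType) (mu : {sigma_finite_measure set T1 -> \bar R})
    (nu : {measure set T2 -> \bar R}) (H : topologicalGroupType)
    (rho : nonsingular_action H mu) (F : malg mu -> malg nu) :
  sigma_finite setT nu -> sigma_morphism F -> (forall b, exists a, F a = b) ->
  (forall h a, malg_measure (F (rho h a)) = malg_measure (F a)) ->
  exists tau : nonsingular_action H nu,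
    measure_preserving tau /\ forall h a, tau h (F a) = F (rho h a).
Proof.
move=> /ex_sigma_finite_measure [nu' E]; move: F; rewrite E => F.
exact: factor_action.
Qed.

Section restriction.
Context d (T : measurableType d) (R : realType).
Variables (mu nu : {measure set T -> \bar R}).
Hypothesis nu_mu : forall A, measurable A -> mu A = 0%E -> nu A = 0%E.

(** The quotient map of measure algebras when [nu] is absolutely continuous with respect to [mu];
    for the measure of a piece it is the restriction to [S]. *)
Definition malg_restrict (a : malg mu) : malg nu := malg_class nu (malg_repr a).

Lemma malg_restrict_class A : measurable A ->
  malg_restrict (malg_class mu A) = malg_class nu A.
Proof.
move=> mA; have mr : measurable (malg_repr (malg_class mu A)).
  exact: measurable_malg_repr.
apply/malg_classP => //; apply: nu_mu; last exact: mu_malg_repr.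
by apply: measurableU; exact: measurableD.
Qed.

Lemma malg_restrict_sigma_morphism : sigma_morphism malg_restrict.
Proof.
split=> [a|A mA].
  have ma : measurable (malg_repr a) by exact: measurable_malg_repr.
  rewrite -(malg_reprK a) -(malg_classC mu ma) malg_restrict_class; last exact: measurableC.
  by rewrite malg_classC// malg_restrict_class.
rewrite malg_restrict_class; last exact: bigcup_measurable.
apply: malg_class_bigcup_eq => n; [exact: mA|exact: measurable_malg_repr|].
by rewrite malg_restrict_class// malg_reprK.
Qed.

Lemma malg_restrict_surj b : exists a, malg_restrict a = b.
Proof.
exists (malg_class mu (malg_repr b)); by rewrite malg_restrict_class ?malg_reprK.
Qed.

End restriction.

(** * Slices over the cosets *)

Section induced_measure_theory.
Context d (T : measurableType d) (R : realType).
Variables (G : topologicalGroupType) (W : groupClosed G).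
Variable nu : {sigma_finite_measure set T -> \bar R}.
Hypothesis cW : countable [set: cosets W].

Local Notation ind := (induced_measure W nu).
Local Notation slice A c := ((fun y => (c, y)) @^-1` A).

Lemma measurable_slice (A : set (cosets W * T)) c : measurable A -> measurable (slice A c).
Proof. by move=> mA; rewrite -[slice A c]xsectionE; exact: measurable_xsection. Qed.

Lemma measurable_slices (A : set (cosets W * T)) :
  (forall c, measurable (slice A c)) -> measurable A.
Proof.
move=> mA; have /countable_injP [f /in2TT finj] := cW.
have -> : A = \bigcup_n (\bigcup_(c in [set c | f c = n]) ([set c] `*` slice A c)).
  apply/seteqP; split=> [[c y] Acy|[c y] [n _ [c' _ [/= -> //]]]].
  by exists (f c) => //; exists c.
apply: bigcup_measurable => n _.
have [[c <-]|nc] := pselect (exists c, f c = n); last first.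
  have -> : \bigcup_(c in [set c | f c = n]) ([set c] `*` slice A c) = set0; last by [].
  by rewrite -subset0 => x [c /= fc]; case: nc; exists c.
have -> : \bigcup_(c' in [set c' | f c' = f c]) ([set c'] `*` slice A c') = [set c] `*` slice A c.
  apply/seteqP; split=> [x [c' /= /finj -> //]|x cx]; by exists c.
exact: measurableX.
Qed.

Lemma induced_measureE A : ind A = (\int[counting]_c nu (slice A c))%E.
Proof. by apply: eq_integral => c _ /=; rewrite xsectionE. Qed.

Lemma induced_measureX A B : measurable B -> ind (A `*` B) = (counting A * nu B)%E.
Proof. exact: product_measure1E. Qed.

Lemma induced_null A : measurable A -> ind A = 0%E <-> forall c, nu (slice A c) = 0%E.
Proof.
move=> mA; rewrite induced_measureE; split=> [A0 c|A0]; last by apply: integral0_eq.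
have mAc := measurable_slice c mA.
have cE : nu (slice A c) = ind ([set c] `*` slice A c).
  rewrite induced_measureX// /counting asboolT; last exact: finite_set1.
  by rewrite fset_set1 finmap.cardfs1 mul1e.
have h : (ind ([set c] `*` slice A c) <= ind A)%E.
  apply: le_measure; rewrite ?inE//; first exact: measurableX.
  by move=> [c' y] [/= ->].
by rewrite cE; apply/eqP; rewrite eq_le measure_ge0 andbT (le_trans h)// induced_measureE A0.
Qed.

Lemma induced_class_eq A B : measurable A -> measurable B ->
  malg_class ind A = malg_class ind B <->
  forall c, malg_class nu (slice A c) = malg_class nu (slice B c).
Proof.
move=> mA mB; have mAB : measurable (A `+` B) by apply: measurableU; exact: measurableD.
rewrite malg_classP// induced_null//; split=> H c.
  by apply/malg_classP; [exact: measurable_slice..|exact: H].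
exact: (iffLR (malg_classP _ (measurable_slice c mA) (measurable_slice c mB)) (H c)).
Qed.

Lemma sigma_finite_induced : (nu setT < +oo)%E -> sigma_finite setT ind.
Proof.
move=> fnu; have /countable_injP [f /in2TT finj] := cW.
exists (fun n => [set c | f c = n] `*` setT).
  by apply/seteqP; split=> [[c y] _|//]; exists (f c).
move=> n; split; first exact: measurableX.
rewrite induced_measureX//.
have fin : finite_set [set c | f c = n].
  have [[c <-]|nc] := pselect (exists c, f c = n).
    by apply: (sub_finite_set _ (finite_set1 c)) => c' /= /finj.
  by apply: (sub_finite_set _ (@finite_set0 _)) => c fc; case: nc; exists c.
rewrite /counting asboolT// lte_mul_pinfty// ?lee_fin//.
Qed.

End induced_measure_theory.


Lemma counting_preimage (T : choiceType) (R : realType) (f g : T -> T) (A : set T) :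
  cancel f g -> cancel g f -> counting (f @^-1` A) = counting A :> \bar R.
Proof.
move=> fK gK; have E : f @^-1` A = g @` A.
  apply/seteqP; split=> [x Ax|_ [y Ay <-]]; first by exists (f x).
  by rewrite /= gK.
rewrite E /counting; have [fA|iA] := pselect (finite_set A).
  rewrite !asboolT//; last exact: finite_image.
  rewrite fset_set_image//= finmap.card_imfset//; exact: can_inj gK.
rewrite !asboolF// => fgA; apply: iA; have : finite_set (f @` (g @` A)) by exact: finite_image.
by rewrite image_comp (_ : f \o g = id) ?image_id//; apply/funext => x; exact: gK.
Qed.

Section induced_piece.
Variables (G : topologicalGroupType) (d : measure_display) (T : measurableType d).
Variables (R : realType) (mu : {sigma_finite_measure set T -> \bar R}).
Variable sigma : nonsingular_action G mu.
Hypothesis sepG : separable_space G.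
Variables (W : groupClosed G) (S : set T) (nu : probability T R).
Hypothesis pc : is_piece sigma W S nu.

Local Notation ind := (induced_measure W nu).
Local Notation slice A c := ((fun y => (c, y)) @^-1` A).
Local Notation rs := (@malg_restrict _ _ _ mu nu).

Let cW : countable [set: cosets W] := countable_cosets sepG (piece_open pc).

Let sr : sigma_morphism rs := malg_restrict_sigma_morphism (piece_dominated pc).

(* The slice of index [c] is [s(c)^-1 a], for the section [s = repr] of [G/W]. *)
Definition translates (a : malg mu) : set (cosets W * T) :=
  [set x | malg_repr (sigma (repr x.1)^-1%g a) x.2].

Lemma measurable_translates a : measurable (translates a).
Proof. apply: (measurable_slices cW) => c.
exact: (measurable_malg_repr (sigma (repr c)^-1%g a)).
 Qed.

Definition translates_class a : malg ind := malg_class ind (translates a).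
Local Notation F := translates_class.

Definition slice_class (b : malg ind) c : malg nu := malg_class nu (slice (malg_repr b) c).

Lemma slice_class_inj b b' : (forall c, slice_class b c = slice_class b' c) -> b = b'.
Proof.
move=> H; rewrite -(malg_reprK b) -(malg_reprK b').
refine (iffRL (induced_class_eq nu (measurable_malg_repr b) (measurable_malg_repr b')) H).
Qed.

Lemma slice_classE A c : measurable A ->
  slice_class (malg_class ind A) c = malg_class nu (slice A c).
Proof.
move=> mA; rewrite /slice_class; move: c.
by apply/(induced_class_eq nu (measurable_malg_repr _) mA); rewrite malg_reprK.
Qed.

Lemma slice_translates a c : slice_class (F a) c = rs (sigma (repr c)^-1%g a).
Proof. by rewrite slice_classE//; exact: measurable_translates. Qed.

Lemma translates_class_sigma_morphism : sigma_morphism F.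
Proof.
split=> [a|A mA].
  have ma := measurable_translates a.
  rewrite /F -(malg_classC ind ma); apply: slice_class_inj => c.
  rewrite slice_translates slice_classE; last exact: measurableC.
  rewrite actC (sigma_morphismC sr).
  by rewrite -(malg_classC nu (measurable_malg_repr _)).
have mr n : measurable (malg_repr (F (malg_class mu (A n)))) by exact: measurable_malg_repr.
apply: slice_class_inj => c; rewrite slice_translates slice_classE; last exact: bigcup_measurable.
pose C n := malg_repr (sigma (repr c)^-1%g (malg_class mu (A n))).
have mC n : measurable (C n) by exact: measurable_malg_repr.
rewrite (sigma_morphism_bigcupE (aut_sigma_morphism _) mA mC) => [|n]; last by rewrite malg_reprK.
rewrite (malg_restrict_class (piece_dominated pc)); last exact: bigcup_measurable.
rewrite preimage_bigcup; apply: malg_class_bigcup_eq => // n; first exact: measurable_slice.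
by rewrite -[RHS]/(slice_class (F (malg_class mu (A n))) c) slice_translates.
Qed.

Lemma translates_class_null a : F a = \bot%O ->
  forall g, (a `&` sigma g (malg_class mu S))%O = \bot%O.
Proof.
move=> Fa g; have [w wW gE] := repr_lcoset W g.
have : rs (sigma (repr (lcoset W g))^-1%g a) = \bot%O.
  rewrite -slice_translates Fa -(malg_class0 ind) slice_classE//.
  by rewrite preimage_set0 malg_class0.
set x := sigma _ a => /(malg_class_eq0 nu (measurable_malg_repr x)).
move/(piece_null_class pc) => /(congr1 (sigma (repr (lcoset W g)))).
have gSE : sigma (repr (lcoset W g)) (malg_class mu S) = sigma g (malg_class mu S).
  by rewrite gE actE (piece_stable pc wW).
by rewrite actI act_bot /x actKV gSE.
Qed.

(** The slice of [F a] at [c] only sees the part of [a] inside the translate of [S] by [repr c],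
    since [nu] lives on [S]. By this criterion prescribed slices are realized in [ex_glue]. *)
Lemma translates_class_eq a (B : cosets W -> set T) : (forall c, measurable (B c)) ->
  (forall c, (a `&` sigma (repr c) (malg_class mu S))%O =
     sigma (repr c) (malg_class mu (B c) `&` malg_class mu S)%O) ->
  forall c, slice_class (F a) c = malg_class nu (B c).
Proof.
move=> mB aB c; rewrite slice_translates.
have rsS : rs (malg_class mu S) = \top%O.
  have mS := measurable_piece pc.
  rewrite (malg_restrict_class (piece_dominated pc) mS) -(malg_classT nu) -(setUv S).
  rewrite (malg_classU nu mS (measurableC mS)).
  have -> : malg_class nu (~` S) = \bot%O; last by rewrite joinx0.
  apply/malg_class_eq0; first exact: measurableC.
  by apply/(piece_null pc); rewrite ?setICl ?measure0//; exact: measurableC.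
have := congr1 (sigma (repr c)^-1%g) (aB c); rewrite actI !actK => /(congr1 rs).
by rewrite !(sigma_morphismI sr) rsS !meetx1 (malg_restrict_class (piece_dominated pc) (mB c)).
Qed.

Let nu_inv w x : w \in W -> nu (malg_repr (sigma w x)) = nu (malg_repr x).
Proof.
by move=> wW; rewrite -{1}(malg_reprK x) (piece_invariant pc wW).
Qed.

(** The slice of [h a] at [c] is a translate by [W] of the slice of [a] at [h^-1 c]. Translation by
    [W] preserves [nu], and permuting the cosets preserves the counting measure. *)
Lemma translates_class_measure h a :
  malg_measure (F (sigma h a)) = malg_measure (F a).
Proof.
rewrite !malg_measure_class; [|exact: measurable_translates..].
rewrite !induced_measureE.
pose phi (c : cosets W) := lcoset W (h^-1 * repr c)%g.
pose psi (c : cosets W) := lcoset W (h * repr c)%g.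
have phiK : cancel phi psi.
  move=> c; rewrite /psi -[RHS](lcoset_repr c) -[in RHS](mulVKg h (repr c)).
  by apply: lcosetMl; rewrite lcoset_repr.
have psiK : cancel psi phi.
  move=> c; rewrite /phi -[RHS](lcoset_repr c) -[in RHS](mulKg h (repr c)).
  by apply: lcosetMl; rewrite lcoset_repr.
pose f c := nu (slice (translates a) c).
have fE c : nu (slice (translates (sigma h a)) c) = f (phi c).
  have [v vW vE] := repr_lcoset W (h^-1 * repr c)%g.
  rewrite -[LHS]/(nu (malg_repr (sigma (repr c)^-1%g (sigma h a)))).
  rewrite -[RHS]/(nu (malg_repr (sigma (repr (phi c))^-1%g a))).
  have hE : ((repr c)^-1 * h = v * (repr (phi c))^-1)%g.
    by rewrite vE !invgM invgK mulVKg.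
  by rewrite -actE hE actE nu_inv.
transitivity (\int[counting]_c f (phi c))%E.
  by apply: eq_integral => c _; exact: fE.
have mphi : measurable_fun setT phi by [].
have -> : (\int[counting]_c f (phi c) = \int[pushforward counting phi]_c f c)%E.
  by rewrite ge0_integral_pushforward.
apply: eq_measure_integral => A _ _.
exact: counting_preimage phiK psiK.
Qed.

End induced_piece.


Section induced_action.
Variables (G : topologicalGroupType) (d : measure_display) (T : measurableType d).
Variables (R : realType) (mu : {sigma_finite_measure set T -> \bar R}).
Variable sigma : nonsingular_action G mu.
Hypothesis sepG : separable_space G.
Variables (W : groupClosed G) (S : set T) (nu : probability T R).
Hypothesis pc : is_piece sigma W S nu.

Local Notation ind := (induced_measure W nu).
Local Notation rs := (@malg_restrict _ _ _ mu nu).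
Local Notation F := (@translates_class _ _ _ _ _ sigma W nu).

Let restricted_continuous : continuous (fun w : subgroup_type W => sigma (val w)).
Proof.
move=> w; apply: cvg_comp; last exact: (@action_continuous _ _ _ _ _ sigma (val w)).
exact: (@initial_continuous _ _ (val : subgroup_type W -> G)).
Qed.

Lemma ex_restricted_action : exists alpha : nonsingular_action (subgroup_type W) nu,
  measure_preserving alpha /\ forall w a, alpha w (rs a) = rs (sigma (val w) a).
Proof.
have rM (v w : subgroup_type W) : sigma (val (v * w)%g) = (sigma (val v) * sigma (val w))%g.
  exact: actionM.
pose rho := @NonsingularAction _ _ _ _ mu (fun w : subgroup_type W => sigma (val w))
  rM restricted_continuous.
apply: (@factor_action _ _ _ _ _ mu nu _ rho rs).
- exact: malg_restrict_sigma_morphism (piece_dominated pc).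
- exact: malg_restrict_surj (piece_dominated pc).
- move=> w a; have wW : val w \in W := valP w.
  rewrite !malg_measure_class; [|exact: measurable_malg_repr..].
  by have := piece_invariant pc wW (measurable_malg_repr a); rewrite malg_reprK.
Qed.

Lemma ex_translates_action : (forall b, exists a, F a = b) ->
  exists beta : nonsingular_action G ind,
    measure_preserving beta /\ forall g a, beta g (F a) = F (sigma g a).
Proof.
move=> F_surj; apply: (@factor_action_measure _ _ _ _ _ mu ind _ sigma F).
- apply: sigma_finite_induced; first exact: countable_cosets sepG (piece_open pc).
  have nuT : (nu setT < +oo)%E by rewrite probability_setT ltry.
  exact: nuT.
- refine (translates_class_sigma_morphism sepG pc).
- exact: F_surj.
- refine (translates_class_measure sepG pc).
Qed.

Lemma slice_class_slice c0 a c :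
  slice_class (malg_slice c0 a : malg ind) c = if c == c0 then a else \bot%O.
Proof.
have ma : measurable (malg_repr a) by exact: measurable_malg_repr.
rewrite slice_classE; last exact: measurableX.
case: eqVneq => [->|/eqP cc0].
  by rewrite -[RHS]malg_reprK; congr malg_class; apply/seteqP; split=> [y []|y].
by rewrite -(malg_class0 nu); congr malg_class; rewrite -subset0 => y [] /= /cc0.
Qed.

Lemma is_section_repr : is_section (repr : cosets W -> G).
Proof. by move=> g; have [w wW ->] := repr_lcoset W g; rewrite mulKg. Qed.

(** The slice of [F (g x)] at [c] is [alpha v] applied to the slice of [F x] at [c' = g^-1 c], with
    [v = (repr c)^-1 g (repr c')]: the cocycle of the section [repr] when [c'] is the coset of
    [h]. *)
Lemma is_induced_translates (alpha : nonsingular_action (subgroup_type W) nu)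
    (beta : nonsingular_action G ind) : (forall b, exists a, F a = b) ->
  (forall w a, alpha w (rs a) = rs (sigma (val w) a)) ->
  (forall g a, beta g (F a) = F (sigma g a)) -> is_induced alpha beta.
Proof.
move=> F_surj alphaE betaE; split; first exact: piece_open pc.
  exact: countable_cosets sepG (piece_open pc).
exists repr, is_section_repr => g h a.
have [x xE] := F_surj (malg_slice (lcoset W h) a).
rewrite -xE betaE; apply: slice_class_inj => c.
rewrite (slice_translates sepG pc) slice_class_slice.
pose c' := lcoset W (g^-1 * repr c)%g.
have [v vW vE] := repr_lcoset W (g^-1 * repr c)%g; rewrite -/c' in vE.
have gE : ((repr c)^-1 * g = v * (repr c')^-1)%g.
  by rewrite vE !invgM invgK mulVKg.
pose v' : subgroup_type W := exist _ v vW.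
rewrite -actE gE actE -[v]/(val v') -alphaE -(slice_translates sepG pc) xE.
rewrite slice_class_slice.
have -> : (c == lcoset W (g * h)%g) = (c' == lcoset W h).
  apply/eqP/eqP => [cE|c'E].
    by rewrite /c' -[in RHS](mulKg g h); apply: lcosetMl; rewrite lcoset_repr.
  rewrite -(lcoset_repr c) -(mulVKg g (repr c)); apply: lcosetMl.
  by rewrite -c'E.
case: eqVneq => [c'E|_]; last exact: sigma_morphism0 (aut_sigma_morphism _).
congr (alpha _ a); apply: val_inj; rewrite /= /cocycle_val.
have -> : lcoset W (g * h)%g = c.
  rewrite -(lcoset_repr c) -(mulVKg g (repr c)); apply: lcosetMl.
  by rewrite -c'E.
by rewrite -c'E vE -!mulgA mulVKg mulKg.
Qed.

End induced_action.

(** * Disjoint unions *)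


Section dunion_theory.
Context d (T : nat -> measurableType d) (R : realType).
Variables (D : set nat) (nu : forall i, {measure set (T i) -> \bar R}).

Local Notation dun := (dunion_measure D nu).
Local Notation pre i A := (dunion_in T i @^-1` A).

Lemma dunion_measure_mkcond A :
  dun A = (\sum_(i <oo) (if i \in D then nu i (pre i A) else 0))%E.
Proof. by rewrite /dunion_measure eseries_mkcond. Qed.

Lemma dunion_null A : dun A = 0%E <-> forall i, D i -> nu i (pre i A) = 0%E.
Proof.
rewrite dunion_measure_mkcond; split=> [A0 i Di|A0]; last first.
  by apply: eseries0 => i _ _; case: ifPn => // /set_mem /A0.
have term0 j : (0 <= if j \in D then nu j (pre j A) else 0)%E by case: ifP.
have : (nu i (pre i A) <= 0)%E.
  rewrite -A0; apply: le_trans (nneseries_lim_ge i.+1 (fun j _ _ => term0 j)).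
  by rewrite big_nat_recr//= (mem_set Di) leeDr// sume_ge0.
by move=> h; apply/eqP; rewrite eq_le h measure_ge0.
Qed.

Lemma measurable_dunion_pre A i : measurable A -> measurable (pre i A).
Proof. exact. Qed.

Lemma dunion_class_eq A B : measurable A -> measurable B ->
  malg_class dun A = malg_class dun B <->
  forall i, D i -> malg_class (nu i) (pre i A) = malg_class (nu i) (pre i B).
Proof.
move=> mA mB; have mAi i := measurable_dunion_pre i mA.
have mBi i := measurable_dunion_pre i mB.
rewrite malg_classP//; split=> [/dunion_null H i Di|H].
  by apply/malg_classP => //; exact: H.
by apply/dunion_null => i Di; exact: (iffLR (malg_classP _ (mAi i) (mBi i)) (H i Di)).
Qed.

Definition dunion_component (b : malg dun) i : malg (nu i) :=
  malg_class (nu i) (pre i (malg_repr b)).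

Lemma dunion_component_inj b b' :
  (forall i, D i -> dunion_component b i = dunion_component b' i) -> b = b'.
Proof.
move=> H; rewrite -(malg_reprK b) -(malg_reprK b').
exact/(dunion_class_eq (measurable_malg_repr b) (measurable_malg_repr b')).
Qed.

Lemma dunion_component_class A i : measurable A -> D i ->
  dunion_component (malg_class dun A) i = malg_class (nu i) (pre i A).
Proof.
move=> mA; move: i.
by apply/(dunion_class_eq (measurable_malg_repr _) mA); rewrite malg_reprK.
Qed.

Lemma dunion_in_inj i : injective (dunion_in T i).
Proof.
move=> x y; exact: eq_from_Tagged.
Qed.

Lemma dunion_pre_bigcup (B : forall i, set (T i)) i :
  pre i (\bigcup_j (dunion_in T j @` B j)) = B i.
Proof.
apply/seteqP; split=> [x [j _ [y By E]]|x Bx]; last by exists i => //; exists x.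
have ji : j = i by exact: (congr1 (@projT1 _ _) E).
by subst j; move: E => /dunion_in_inj <-.
Qed.

Lemma measurable_dunion_bigcup (B : forall i, set (T i)) :
  (forall i, measurable (B i)) -> measurable (\bigcup_j (dunion_in T j @` B j)).
Proof.
move=> mB; suff : dunion_measurable (\bigcup_j (dunion_in T j @` B j)) by [].
by move=> i; rewrite dunion_pre_bigcup.
Qed.

Lemma dunion_component_malg_dunion (b : forall i, malg (nu i)) i : D i ->
  dunion_component (malg_dunion D b) i = b i.
Proof.
move=> Di; rewrite dunion_component_class//.
  by rewrite dunion_pre_bigcup malg_reprK.
by apply: measurable_dunion_bigcup => j; exact: measurable_malg_repr.
Qed.

Lemma malg_dunion_measure (b : forall i, malg (nu i)) :
  malg_measure (malg_dunion D b) = (\sum_(0 <= i <oo | i \in D) malg_measure (b i))%E.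
Proof.
rewrite malg_measure_class.
  by apply: eq_eseriesr => i _; rewrite dunion_pre_bigcup.
by apply: measurable_dunion_bigcup => j; exact: measurable_malg_repr.
Qed.

Lemma sigma_finite_dunion : (forall i, sigma_finite setT (nu i)) -> sigma_finite setT dun.
Proof.
move=> sf; pose E i := s2val (cid2 (sf i)).
have EU i : setT = \bigcup_n E i n := s2valP (cid2 (sf i)).
have EP i n : measurable (E i n) /\ (nu i (E i n) < +oo)%E := s2valP' (cid2 (sf i)) n.
pose B (m : nat) : set (dunion T) :=
  if unpickle m is Some (i, n) then dunion_in T i @` E i n else set0.
exists B.
  apply/seteqP; split=> // -[i x] _.
  have [n _ Enx] : (\bigcup_n E i n) x by rewrite -EU.
  by exists (pickle (i, n)) => //; rewrite /B pickleK; exists x.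
move=> m; rewrite /B; case: (unpickle m) => [[i n]|]; last by split; rewrite ?measure0.
(* The family equal to [E i n] at [i] and empty elsewhere, by transport along [i = j]. *)
pose C j : set (T j) := if pselect (i = j) is left e then eq_rect i (fun j => set (T j)) (E i n) j e else set0.
have Ci : C i = E i n.
  by rewrite /C; case: pselect => // e; rewrite (Prop_irrelevance e erefl).
have Cj j : i <> j -> C j = set0 by move=> ij; rewrite /C; case: pselect.
have EC : dunion_in T i @` E i n = \bigcup_j (dunion_in T j @` C j).
  apply/seteqP; split=> [z Ez|z [j _]]; first by exists i; rewrite // Ci.
  have [ij|/Cj ->] := pselect (i = j); last by rewrite image_set0.
  by subst j; rewrite Ci.
have [mE fE] := EP i n.
have mC j : measurable (C j).
  have [ij|/Cj -> //] := pselect (i = j).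
  by subst j; rewrite Ci.
rewrite EC; split; first exact: measurable_dunion_bigcup.
rewrite dunion_measure_mkcond.
pose u j := (if j \in D then nu j (C j) else 0)%E.
have -> : (\sum_(j <oo) (if j \in D then nu j (pre j (\bigcup_j (dunion_in T j @` C j))) else 0) =
    \sum_(j <oo) u j)%E.
  by apply: eq_eseriesr => j _; rewrite dunion_pre_bigcup.
have u0 j : j != i -> u j = 0%E.
  by move=> ji; rewrite /u Cj ?measure0 ?if_same// => ij; rewrite ij eqxx in ji.
have u_ge0 j : (0 <= u j)%E by rewrite /u; case: ifP.
rewrite (@nneseriesD1 _ u i) => [|j _|//]; last exact: u_ge0.
rewrite eseries0 ?adde0; last by move=> j _ /u0.
by rewrite /u Ci; case: ifP => // _; exact: ltry.
Qed.

End dunion_theory.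


(** An inclusion is the vanishing of a difference, so a trivial kernel makes [F] reflect the
    order. *)
Lemma injective_sigma_morphism_iso d1 d2 (T1 : measurableType d1)
    (T2 : measurableType d2) (R : realType) (mu : {measure set T1 -> \bar R})
    (nu : {measure set T2 -> \bar R}) (F : malg mu -> malg nu) :
  sigma_morphism F -> (forall b, exists a, F a = b) ->
  (forall a, F a = \bot%O -> a = \bot%O) -> boolean_iso F.
Proof.
move=> sF surj F0; have F_le a a' : (F a <= F a')%O -> (a <= a')%O.
  rewrite -[F a']complK -disj_leC -(sigma_morphismC sF) -(sigma_morphismI sF).
  by move/eqP/F0/eqP; rewrite disj_leC complK.
have Finj : injective F.
  by move=> a a' E; apply/eqP; rewrite eq_le !F_le// E.
have [s sE] := choice surj; split.
- by exists s => // a; apply: Finj; rewrite sE.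
- exact: sigma_morphismI sF.
- exact: sigma_morphismU sF.
- exact: sigma_morphismC sF.
Qed.

(** * The factor map attached to a family of pieces *)

Section family.
Variables (G : topologicalGroupType) (d : measure_display) (T : measurableType d).
Variables (R : realType) (mu : {sigma_finite_measure set T -> \bar R}).
Variable sigma : nonsingular_action G mu.
Hypothesis sepG : separable_space G.
Variables (D : set nat) (W : nat -> groupClosed G) (S : nat -> set T).
Variable nu : nat -> probability T R.
Hypothesis Wo : forall n, open [set` W n].
Hypothesis pc : forall n, D n -> is_piece sigma (W n) (S n) (nu n).
Hypothesis disj : forall n m g h, D n -> D m -> n <> m ->
  (sigma g (malg_class mu (S n)) `&` sigma h (malg_class mu (S m)))%O = \bot%O.

Local Notation ind n := (induced_measure (W n) (nu n)).
Local Notation F n := (@translates_class _ _ _ _ _ sigma (W n) (nu n)).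
Local Notation slice A c := ((fun y => (c, y)) @^-1` A).

Let countable_cells : countable [set: {n : nat & cosets (W n)}].
Proof.
have inj n : exists f : cosets (W n) -> nat, injective f.
  by have /countable_injP [f /in2TT] := countable_cosets sepG (Wo n); exists f.
pose f n := sval (cid (inj n)); have finj n : injective (f n) := svalP (cid (inj n)).
apply/countable_injP; exists (fun x => pickle (projT1 x, f (projT1 x) (projT2 x))).
move=> [n c] [m c'] _ _ /(pcan_inj pickleK) /= [nm]; subst m.
by move=> /finj ->.
Qed.

(** The prescribed slices are moved back to the cells [repr c (B n c & S n)], whose supremum is
    taken. Cells lie in pairwise disjoint translates, so each translate of [S n] meets the supremum
    in its own cell only. *)
Lemma ex_glue (b : forall n, malg (ind n)) : exists a, forall n, D n -> F n a = b n.
Proof.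
pose B n (c : cosets (W n)) := slice (malg_repr (b n)) c.
have mB n c : measurable (B n c).
  by apply: (@measurable_slice _ _ _ (W n)); exact: measurable_malg_repr.
pose cell n (c : cosets (W n)) :=
  sigma (repr c) (malg_class mu (B n c) `&` malg_class mu (S n))%O.
pose v (x : {n : nat & cosets (W n)}) := if pselect (D (projT1 x))
  then cell (projT1 x) (projT2 x) else \bot%O.
exists (malg_sup v) => n Dn.
apply: slice_class_inj => c.
refine (translates_class_eq sepG (pc Dn) (mB n) _ c) => {}c.
have vD m c' : D m -> v (existT _ m c') = cell m c' by rewrite /v /=; case: pselect.
have vND m c' : ~ D m -> v (existT _ m c') = \bot%O by rewrite /v /=; case: pselect.
have vE := vD n c Dn.
apply/eqP; rewrite eq_le -/(cell n c); apply/andP; split; last first.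
  rewrite lexI -vE (iffLR (malg_supP v countable_cells _) (lexx _)) vE.
  by apply: act_leR; exact: leIr.
(* Moving the translate across the inequality leaves a bound for each cell: those of another piece
   are disjoint from it by [disj], those of another coset by [piece_disjoint]. *)
rewrite malg_leIC; apply/malg_supP => // -[m c'].
have [Dm|/vND ->] := pselect (D m); last exact: le0x.
rewrite vD//.
have cell_le : (cell m c' <= sigma (repr c') (malg_class mu (S m)))%O.
  by apply: act_leR; exact: leIr.
have [mn|mn] := pselect (m = n); last first.
  apply: lexUl; apply: (le_trans cell_le); rewrite -disj_leC; apply/eqP.
  exact: disj.
subst m; have [->|c'c] := pselect (c' = c); first exact: leUr.
apply: lexUl; apply: (le_trans cell_le); rewrite -disj_leC; apply/eqP.
have -> : repr c' = (repr c * ((repr c)^-1 * repr c'))%g by rewrite mulVKg.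
rewrite actE -actI (piece_disjoint (pc Dn)) ?act_bot//.
by apply/negP => /lcosetP; rewrite !lcoset_repr => /esym.
Qed.

Lemma translates_class_surj n : D n -> forall b, exists a, F n a = b.
Proof.
(* Glue [b] at the index [n], by transport, with bottom elements elsewhere. *)
move=> Dn b; pose b' m : malg (ind m) := if pselect (n = m) is left e
  then eq_rect n (fun m => malg (ind m)) b m e else \bot%O.
have [a aE] := ex_glue b'; exists a; rewrite aE// /b'.
by case: pselect => // e; rewrite (Prop_irrelevance e erefl).
Qed.

Hypothesis cover : forall a,
  (forall n g, D n -> (a `&` sigma g (malg_class mu (S n)))%O = \bot%O) -> a = \bot%O.

Local Notation dun := (dunion_measure D (fun n => ind n)).

Definition family_class (a : malg mu) : malg dun := malg_dunion D (fun n => F n a).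
Local Notation FF := family_class.

Let componentE a n : D n -> dunion_component (FF a) n = F n a.
Proof. exact: dunion_component_malg_dunion. Qed.

Lemma family_class_sigma_morphism : sigma_morphism FF.
Proof.
split=> [a|A mA]; apply: dunion_component_inj => n Dn; rewrite componentE//.
  have mr : measurable (malg_repr (FF a)) by exact: measurable_malg_repr.
  rewrite -(malg_reprK (FF a)) -(malg_classC dun mr).
  rewrite dunion_component_class//; last exact: measurableC.
  rewrite (sigma_morphismC (translates_class_sigma_morphism sepG (pc Dn))).
  by rewrite -(componentE a Dn) -(malg_classC (ind n))//; exact: measurable_dunion_pre.
have mr k : measurable (malg_repr (FF (malg_class mu (A k)))) by exact: measurable_malg_repr.
rewrite dunion_component_class//; last exact: bigcup_measurable.
rewrite (sigma_morphism_bigcup (translates_class_sigma_morphism sepG (pc Dn)))//.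
rewrite preimage_bigcup; apply: malg_class_bigcup_eq => k.
- exact: measurable_malg_repr.
- exact: measurable_dunion_pre.
- by rewrite malg_reprK -(componentE _ Dn).
Qed.

Lemma family_class_surj b : exists a, FF a = b.
Proof.
have [a aE] := ex_glue (dunion_component b); exists a.
by apply: dunion_component_inj => n Dn; rewrite componentE// aE.
Qed.

Lemma family_class_iso : boolean_iso FF.
Proof.
apply: injective_sigma_morphism_iso.
- exact: family_class_sigma_morphism.
- exact: family_class_surj.
move=> a Fa; apply: cover => n g Dn.
apply: (translates_class_null sepG (pc Dn)).
rewrite -(componentE a Dn) Fa -(malg_class0 dun) dunion_component_class//.
by rewrite preimage_set0 malg_class0.
Qed.

Lemma family_class_measure h a : malg_measure (FF (sigma h a)) = malg_measure (FF a).
Proof.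
rewrite !malg_dunion_measure; apply: eq_eseriesr => n /set_mem Dn.
exact: (translates_class_measure sepG (pc Dn)).
Qed.

Lemma ex_family_action : exists tau : nonsingular_action G dun,
  measure_preserving tau /\ forall g a, tau g (FF a) = FF (sigma g a).
Proof.
apply: (@factor_action_measure _ _ _ _ _ mu dun _ sigma FF).
- apply: sigma_finite_dunion => n; apply: sigma_finite_induced.
    exact: countable_cosets sepG (Wo n).
  have nuT : (nu n setT < +oo)%E by rewrite probability_setT ltry.
  exact: nuT.
- exact: family_class_sigma_morphism.
- exact: family_class_surj.
- exact: family_class_measure.
Qed.

(** By gluing, every family of elements agrees on [D] with the images [F n a] of a single [a], and
    the other indices carry measure zero. *)
Lemma is_disjoint_union_family (beta : forall n, nonsingular_action G (ind n))
    (tau : nonsingular_action G dun) :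
  (forall n, D n -> forall g a, beta n g (F n a) = F n (sigma g a)) ->
  (forall g a, tau g (FF a) = FF (sigma g a)) -> is_disjoint_union beta tau.
Proof.
move=> betaE tauE g A; have [a aE] := ex_glue A.
have -> : malg_dunion D A = FF a.
  apply: dunion_component_inj => n Dn.
  by rewrite componentE// dunion_component_malg_dunion// aE.
rewrite tauE; apply: dunion_component_inj => n Dn.
by rewrite componentE// dunion_component_malg_dunion// -betaE// aE.
Qed.

End family.

Lemma trivial_action_continuous d (T : measurableType d) (R : realType)
    (mu : {measure set T -> \bar R}) (G : topologicalGroupType) :
  continuous (fun _ : G => 1%g : aut_star mu).
Proof. exact: cst_continuous. Qed.

(** A placeholder at the indices outside [D]. *)
Definition trivial_action d (T : measurableType d) (R : realType)
    (mu : {measure set T -> \bar R}) (G : topologicalGroupType) :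
    nonsingular_action G mu :=
  NonsingularAction (fun _ _ : G => esym (mulg1 (1%g : aut_star mu)))
    (@trivial_action_continuous _ _ _ mu G).

Theorem theorem3p4 (R : realType) (G : topologicalGroupType)
    (polishG : polish R G) (naG : non_archimedean G)
    (rpG : roelcke_precompact G)
    (d : measure_display) (Omega : measurableType d)
    (mu : {sigma_finite_measure set Omega -> \bar R})
    (sigma : nonsingular_action G mu) :
  [/\ exists (D : set nat) (V : nat -> groupClosed G)
        (d' : measure_display) (Omega' : nat -> measurableType d')
        (mu' : forall i, probability (Omega' i) R)
        (alpha : forall i, nonsingular_action (subgroup_type (V i)) (mu' i))
        (beta : forall i,
           nonsingular_action G (induced_measure (V i) (mu' i)))
        (tau : nonsingular_action G
           (dunion_measure D (fun i => induced_measure (V i) (mu' i)))),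
        [/\ forall i, D i -> open [set` V i] /\ self_commensurating [set` V i],
            forall i, D i -> measure_preserving (alpha i),
            forall i, D i -> is_induced (alpha i) (beta i),
            is_disjoint_union beta tau
          & isomorphic sigma tau],
      exists (d' : measure_display) (Omega' : measurableType d')
        (mu' : {sigma_finite_measure set Omega' -> \bar R})
        (tau : nonsingular_action G mu'),
        measure_preserving tau /\ isomorphic sigma tau
    & mu [set: Omega] != 0%E -> ergodic sigma ->
      exists (V : groupClosed G)
        (d' : measure_display) (Omega' : measurableType d')
        (mu' : probability Omega' R)
        (alpha : nonsingular_action (subgroup_type V) mu')
        (beta : nonsingular_action G (induced_measure V mu')),
        [/\ open [set` V], self_commensurating [set` V],
            measure_preserving alpha, is_induced alpha beta
          & isomorphic sigma beta] ].
Proof.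
have [sepG _] := polishG.
have [W0 W0E] : exists W0 : groupClosed G, [set` W0] = setT.
  exact: group_closed_of_set.
have [m [m_fin m_null]] := ex_equivalent_finite_measure mu.
(* Placeholder outside [D]. The whole group is open, so the coset space is countable and the induced
   measure sigma-finite at every index. *)
pose p0 : groupClosed G * set Omega * probability Omega R :=
  (W0, set0, \d_(point : Omega) : probability Omega R).
have [D [p [pc pN disj cover]]] := greedy_exhaustion sigma sepG naG rpG m_fin m_null p0.
pose W n := (p n).1.1; pose S n := (p n).1.2; pose nu n := (p n).2.
have Wo n : open [set` W n].
  have [/pc /piece_open //|/pN] := pselect (D n).
  by rewrite /W => ->; rewrite W0E; exact: openT.
pose ind n := induced_measure (W n) (nu n).
pose F n := @translates_class _ _ _ _ _ sigma (W n) (nu n).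
have F_surj n (Dn : D n) : forall b, exists a, F n a = b.
  exact: (translates_class_surj sepG Wo pc disj Dn).
have alphaP n : exists alpha : nonsingular_action (subgroup_type (W n)) (nu n),
    D n -> measure_preserving alpha /\
      forall w a, alpha w (malg_restrict (nu n) a) = malg_restrict (nu n) (sigma (val w) a).
  have [Dn|nD] := pselect (D n); last by exists (@trivial_action _ _ _ _ _) => /nD.
  by have [alpha H] := ex_restricted_action (pc n Dn); exists alpha.
have betaP n : exists beta : nonsingular_action G (ind n), D n ->
    forall g a, beta g (F n a) = F n (sigma g a).
  have [Dn|nD] := pselect (D n); last by exists (@trivial_action _ _ _ _ _) => /nD.
  by have [beta [_ H]] := ex_translates_action sepG (pc n Dn) (F_surj n Dn); exists beta.
pose alpha n := sval (cid (alphaP n)); pose beta n := sval (cid (betaP n)).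
have alphaE n : D n -> _ := svalP (cid (alphaP n)).
have betaE n : D n -> _ := svalP (cid (betaP n)).
have [tau [tau_mp tauE]] := ex_family_action sepG Wo pc disj.
have ind_ab n : D n -> is_induced (alpha n) (beta n).
  move=> Dn; apply: (is_induced_translates sepG (pc n Dn) (F_surj n Dn)).
    by have [] := alphaE n Dn.
  exact: betaE.
have iso : isomorphic sigma tau.
  exists (@family_class _ _ _ _ _ sigma D W nu).
    exact: (family_class_iso sepG Wo pc disj cover).
  by move=> g a; rewrite tauE.
split.
- exists D, W, d, (fun=> Omega), nu, alpha, beta, tau; split=> //.
  + by move=> n Dn; split; [exact: Wo|exact: piece_sc (pc n Dn)].
  + by move=> n Dn; have [] := alphaE n Dn.
  + exact: (is_disjoint_union_family sepG Wo pc disj).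
- have sfd : sigma_finite setT (dunion_measure D ind).
    apply: sigma_finite_dunion => n; apply: sigma_finite_induced.
      exact: countable_cosets sepG (Wo n).
    have nuT : (nu n setT < +oo)%E by rewrite probability_setT ltry.
    exact: nuT.
  have [mu' E] := ex_sigma_finite_measure sfd.
  move: tau {tauE} tau_mp iso; rewrite -/ind E => tau tau_mp iso.
  by exists default_measure_display, (dunion (fun n => (cosets (W n) * Omega)%type)), mu', tau.
(* With [D] empty, [cover] would identify top and bottom, against [mu0]. *)
- move=> mu0 erg; have [n Dn] : exists n, D n.
    apply: contrapT => nD; move/eqP: mu0; apply.
    apply/(malg_class_eq0 mu measurableT); apply: cover => n g Dn.
    by case: nD; exists n.
  exists (W n), d, Omega, (nu n), (alpha n), (beta n).
  split; [exact: Wo|exact: piece_sc (pc n Dn)|by have [] := alphaE n Dn|exact: ind_ab|].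
  exists (F n); last by move=> g a; rewrite betaE.
  apply: injective_sigma_morphism_iso.
  + exact: (translates_class_sigma_morphism sepG (pc n Dn)).
  + exact: F_surj.
  move=> a Fa.
  (* By ergodicity the invariant and nonzero orbit of a single piece is everything, so the kernel of
     [F n], whose elements are disjoint from this orbit, is trivial. *)
  have Y1 : orbit_sup sigma (W n) (S n) = \top%O.
    have [Y0|//] := erg _ (orbit_sup_invariant sepG (pc n Dn)).
    case: (piece_neq0 (pc n Dn)); apply/eqP; rewrite -lex0 -Y0.
    by rewrite -{1}(act1 sigma (malg_class _ _)); exact: (le_orbit_sup sepG (pc n Dn)).
  have : (\top <= ~` a)%O.
    rewrite -Y1; apply/(orbit_supP sepG (pc n Dn)) => g.
    by rewrite -disj_leC meetC (translates_class_null sepG (pc n Dn) Fa).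
  by rewrite -disj_leC meet1x => /eqP.
Qed.
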